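(* Let $q := \exp(2\pi i\tau)$ where $\tau := \frac{2}{99+\sqrt5}$. Then $H_q$ is meromorphic in the unit ball $\{z\in\mathbb{C}:|z|<1\}$ and analytic at $0$. There does not exist any subsequence of $\{\mu_n/\nu_n\}_{n=1}^\infty$ that converges uniformly in all compact subsets of $\mathcal{A} := \{z : |z|<0.46\}$ omitting poles of $H_q$. In particular, no subsequence of the sequence of Padé approximants $\{[n/n]\}_{n=1}^\infty$ to $H_q$, and no subsequence of the sequence of Padé approximants $\{[n+1/n]\}_{n=1}^\infty$ to $H_q$, can converge uniformly in all compact subsets of $\mathcal{A}$ omitting poles of $H_q$.
   Context: For $|q|=1$, $q$ not a root of unity, the Rogers-Ramanujan function is the power series $$G_q(z) := \sum_{j=0}^\infty \frac{q^{j^2}}{(1-q)(1-q^2)\cdots(1-q^j)}\, z^j ,$$ and $H_q(z) := G_q(z)/G_q(qz)$; when $H_q$ has a meromorphic continuation beyond the domain of definition of $G_q$, that continuation is also denoted $H_q$. (As formal power series, $H_q(z)=1+qz/H_q(qz)$, so $H_q$ corresponds to the continued fraction $1+\frac{qz|}{|1}+\frac{q^2z|}{|1}+\frac{q^3z|}{|1}+\cdots$.) For $n\ge 1$, $\frac{\mu_n}{\nu_n}(z) := 1+\frac{qz|}{|1}+\frac{q^2z|}{|1}+\cdots+\frac{q^nz|}{|1}$ denotes the $n$th convergent of this continued fraction, a rational function of $z$ with numerator polynomial $\mu_n$ and denominator polynomial $\nu_n$. (Here $b_0+\frac{a_1|}{|b_1}+\frac{a_2|}{|b_2}+\cdots$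 means $b_0+\cfrac{a_1}{b_1+\cfrac{a_2}{b_2+\cdots}}$.) Given integers $m,n\ge0$, the $(m,n)$ Padé approximant $[m/n]$ to a formal power series $f$ is the (unique) rational function $P/Q$ where $P,Q$ are polynomials of degree at most $m,n$ respectively, $Q\not\equiv0$, and $(fQ-P)(z)=O(z^{m+n+1})$, i.e. the coefficients of $1,z,\dots,z^{m+n}$ in $fQ-P$ vanish. *)

(* Defs.v *)
From HB Require Import structures.
From mathcomp Require Import all_boot all_order all_algebra.
From mathcomp Require Import complex.
From mathcomp Require Import all_classical all_reals all_analysis.

Set Implicit Arguments.
Unset Strict Implicit.
Unset Printing Implicit Defensive.

Import Order.TTheory GRing.Theory Num.Theory.
Import numFieldNormedType.Exports.

Local Open Scope classical_set_scope.
Local Open Scope ring_scope.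
Local Open Scope complex_scope.

(* The definitions below are used with K := R[i], the complex numbers over a
   realType R. They are stated for an abstract numFieldType because that is
   where the norm topology is attached; the complex modulus `|z| is then an
   element of K, and derivable f z 1 is complex differentiability. *)

(* exp(i t); the library has no complex exponential. *)
Definition expi (R : realType) (t : R) : R[i] := cos t +i* sin t.

Section ComplexFunctions.
Variable K : numFieldType.
Implicit Types (f : K -> K) (a c : nat -> K) (U A : set K).

Definition power_series c (z : K) : nat -> K := series (fun j => c j * z ^+ j).

(* c is the sequence of Taylor coefficients of f at x. *)
Definition taylor_at f (x : K) c : Prop :=
  \forall z \near x, power_series c (z - x) @ \oo --> f z.

Definition analytic_at f (x : K) : Prop := exists c, taylor_at f x c.

Definition holomorphic_at f (x : K) : Prop :=
  \forall z \near x, derivable (f : K^o -> K^o) z 1.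

(* The value f x itself is irrelevant when x is a pole. *)
Definition is_pole f (x : K) : Prop :=
  (\forall z \near x^', derivable (f : K^o -> K^o) z 1) /\
  (`|f z| @[z --> x^'] --> +oo).

Definition meromorphic_on U f : Prop :=
  forall x, U x -> holomorphic_at f x \/ is_pole f x.

End ComplexFunctions.

Section RogersRamanujan.
Variables (K : numFieldType) (q : K).

Definition RR_coef (j : nat) : K :=
  q ^+ (j ^ 2) / \prod_(1 <= k < j.+1) (1 - q ^+ k).

(* The open disc of convergence of the power series G_q. *)
Definition RR_dom : set K :=
  interior [set z | cvgn (power_series RR_coef z)].

Definition RR_G (z : K) : K := limn (power_series RR_coef z).

(* H is the function H_q on U: a meromorphic function on U that continues
   G_q(z) / G_q(q z) from the domain of definition of G_q, which has to be a
   genuine neighbourhood of 0. For a connected U containing 0 this determines H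
   off its poles. As |q| = 1, RR_dom is stable under multiplication by q. *)
Definition is_RR_H (U : set K) (H : K -> K) : Prop :=
  [/\ RR_dom 0, meromorphic_on U H &
      forall z, U z -> RR_dom z -> RR_G (q * z) != 0 ->
        H z = RR_G z / RR_G (q * z)].

End RogersRamanujan.

Section RationalFunctions.
Variable K : numFieldType.
Implicit Types (P Q : {poly K}) (r : {fraction {poly K}}).

Definition ratfun P Q : {fraction {poly K}} := tofrac P / tofrac Q.

(* The rational function r has no pole at z and takes the value w there. As P/Q
   ranges over all representations of r, removable singularities are removed. *)
Definition ratfun_value r (z w : K) : Prop :=
  exists P Q, [/\ r = ratfun P Q, Q.[z] != 0 & w = P.[z] / Q.[z]].

(* In particular r n has no pole in S for all large n. *)
Definition ratfun_unif_cvg (r : nat -> {fraction {poly K}}) (g : K -> K)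
    (S : set K) : Prop :=
  forall e : K, 0 < e -> exists N : nat, forall n, (N <= n)%N ->
    forall z, S z -> exists2 w, ratfun_value (r n) z w & `|w - g z| < e.

(* Some subsequence of (r n)_{n >= 1} converges (to some limit function g)
   uniformly in all compact subsets of A omitting poles of H. *)
Definition has_unif_cvg_subseq (A : set K) (H : K -> K)
    (r : nat -> {fraction {poly K}}) : Prop :=
  exists (phi : nat -> nat) (g : K -> K),
    [/\ {homo phi : m n / (m < n)%N}, (0 < phi 0)%N &
        forall S : set K, compact S -> S `<=` A ->
          (forall z, S z -> ~ is_pole H z) ->
          ratfun_unif_cvg (r \o phi) g S].

End RationalFunctions.

(* a_k|   a_{k+1}|         a_{k+n-1}|
   ---- + -------- + ... + ----------
   |b_k   |b_{k+1}         |b_{k+n-1}      (n terms, starting at index k) *)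
Fixpoint contfrac_tail (F : fieldType) (a b : nat -> F) (n k : nat) : F :=
  if n is n'.+1 then a k / (b k + contfrac_tail a b n' k.+1) else 0.

Definition contfrac (F : fieldType) (a b : nat -> F) (n : nat) : F :=
  b 0%N + contfrac_tail a b n 1.

(* mu_n / nu_n *)
Definition RR_convergent (K : numFieldType) (q : K) (n : nat) :
    {fraction {poly K}} :=
  contfrac (fun k => tofrac (q ^+ k *: 'X)) (fun=> 1) n.

Section Pade.
Variable K : numFieldType.

(* c is the coefficient sequence of a formal power series. *)
Definition is_pade (c : nat -> K) (m n : nat) (r : {fraction {poly K}}) : Prop :=
  exists P Q : {poly K},
    [/\ (size P <= m.+1)%N, (size Q <= n.+1)%N, Q != 0,
        forall k, (k <= m + n)%N -> \sum_(i < k.+1) c i * Q`_(k - i) - P`_k = 0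
      & r = ratfun P Q].

(* [m/n]: the unique r with is_pade c m n r. *)
Definition pade (c : nat -> K) (m n : nat) : {fraction {poly K}} :=
  xget 0 [set r | is_pade c m n r].

End Pade.

(* Main.v *)
Require Import Defs.
From Stdlib Require Import ZArith.
From HB Require Import structures.
From mathcomp Require Import all_boot all_order all_algebra.
From mathcomp Require Import complex.
From mathcomp Require Import all_classical all_reals all_analysis.
From mathcomp Require Import ring lra zify ssrZ.

(** Write G for the Rogers-Ramanujan series G_q and D(z) = conj (G (conj z)), the
    series for 1/q. The convergents are explicit: mu_n is the truncation of
    G(z) D(q^(n+1) z), and nu_n(z) that of G(q z) D(q^(n+1) z), at degrees about n
    ([cf_poly_coef]). Hence nu_n(z / q) is uniformly close on |z| <= 0.44 to
    G(z) D(q^n z) ([cf_poly1_approx]), whereas H has poles only where G(q z) = 0. Zeros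
    of the second factor D(q^n z) lie at the points conj (q^n x) with G(x) = 0; they
    give poles of mu_n / nu_n ([cf_poly_coprime]) which are poles of H only if
    conj (q^n x) is itself a zero of G.

    For the given q, G has two zeros a and b in |z| <= 0.44, and there are no others
    there. Both spurious zeros conj (q^n a), conj (q^n b) can be close to a and b
    themselves only if a * conj b is almost real, which it is not ([twisted_far]). So
    for each large n one of the two discs of radius 0.03 about them stays away from a
    and b, and by the minimum modulus principle ([min_modulus]) it contains a zero of
    nu_n(z / q) ([zero_in_disc]). Dividing by q puts a pole of the n-th convergent into
    one fixed compact subset of |z| < 0.46 free of poles of H, for every large n. This
    excludes locally uniform convergence of every subsequence
    ([no_unif_cvg_subseq]). By the degrees of mu_n and nu_n, the approximants [n/n] and
    [n+1/n] are the convergents of index 2n and 2n+1 ([pade_diag], [pade_superdiag]).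

    That H is meromorphic in the unit disc rests on |1 - q^k| >= 1 / (18 k), since tau
    is a quadratic irrational ([dioph_tau]). The coefficients of G then grow
    subexponentially by a recursion for 1 / (q)_n that has sums, not products, of the
    small denominators ([qpochV_logderiv], [qpochV_bounded]). The quotient
    G(z) / G(q z) has a pole at each zero of the denominator because G(z) and G(q z)
    have no common zero ([RR_G_no_common_zero]).

    The location of a and b and a lower bound of |G| away from them are numerical
    ([RR_G_two_zeros]). A polynomial P is found for which P G is close to
    (z - z1) (z - z2) (z - z3) (z - z4), where the zi approximate the four smallest
    zeros of G and z1, z2 stand for a and b. As |P| <= 1 on the disc, |G| is bounded
    below by the product of the |z - zi| up to a small error. The inequalities between
    integers to which ball arithmetic reduces this are checked by computation
    ([certificate_ok]), with the recursion for 1 / (q)_n bounding the tail of G. *)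

Set Implicit Arguments.
Unset Strict Implicit.
Unset Printing Implicit Defensive.

Import Order.TTheory GRing.Theory Num.Theory.
Import numFieldNormedType.Exports.
Local Open Scope classical_set_scope.
Local Open Scope ring_scope.
Local Open Scope complex_scope.

(** * The modulus as a real number *)

Section Modulus.
Variable R : realType.
Local Notation C := (R[i] : numFieldType).
Implicit Types (z w : C) (x : R).

(** The modulus on R[i] has values in R[i]. Taking its real part makes the
    estimates below inequalities in the totally ordered field R. *)
Definition cabs z : R := complex.Re `|z|.

Lemma cabsE z : `|z| = (cabs z)%:C.
Proof. by rewrite /cabs normc_def. Qed.

Lemma le_cabs z x : (`|z| <= x%:C) = (cabs z <= x).
Proof. by rewrite cabsE lecR. Qed.

Lemma lt_cabs z x : (`|z| < x%:C) = (cabs z < x).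
Proof. by rewrite cabsE ltcR. Qed.

Lemma cabs_ge0 z : 0 <= cabs z.
Proof. by rewrite -lecR -cabsE normr_ge0. Qed.

Lemma cabs0 : cabs 0 = 0.
Proof. by rewrite /cabs normr0. Qed.

Lemma cabs1 : cabs 1 = 1.
Proof. by rewrite /cabs normr1. Qed.

Lemma cabsM z w : cabs (z * w) = cabs z * cabs w.
Proof. by apply: complexI; rewrite -cabsE rmorphM /= -!cabsE normrM. Qed.

Lemma cabsX z n : cabs (z ^+ n) = cabs z ^+ n.
Proof. by elim: n => [|n IH]; rewrite ?expr0 ?cabs1 // !exprS cabsM IH. Qed.

Lemma cabsV z : cabs z^-1 = (cabs z)^-1.
Proof. by apply: complexI; rewrite -cabsE fmorphV /= -cabsE normfV. Qed.

Lemma cabs_div z w : cabs (z / w) = cabs z / cabs w.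
Proof. by rewrite cabsM cabsV. Qed.

Lemma cabsN z : cabs (- z) = cabs z.
Proof. by rewrite /cabs normrN. Qed.

Lemma cabsB z w : cabs (z - w) = cabs (w - z).
Proof. by rewrite /cabs distrC. Qed.

Lemma cabsD z w : cabs (z + w) <= cabs z + cabs w.
Proof. by rewrite -lecR rmorphD /= -!cabsE ler_normD. Qed.

Lemma cabs_eq0 z : (cabs z == 0) = (z == 0).
Proof. by rewrite -(inj_eq (@complexI R)) -cabsE normr_eq0. Qed.

Lemma cabs_gt0 z : (0 < cabs z) = (z != 0).
Proof. by rewrite lt_neqAle eq_sym cabs_eq0 cabs_ge0 andbT. Qed.

Lemma cabs_real x : cabs x%:C = `|x|.
Proof. by rewrite /cabs normc_def /= expr0n /= addr0 sqrtr_sqr. Qed.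

Lemma cabs_nat n : cabs n%:R = n%:R.
Proof. by rewrite -(rmorph_nat (real_complex R)) cabs_real normr_nat. Qed.

Lemma cabs_Re z : `|complex.Re z| <= cabs z.
Proof. by rewrite -lecR -cabsE normc_ge_Re. Qed.

Lemma cabs_Im z : `|complex.Im z| <= cabs z.
Proof.
case: z => x y /=; rewrite /cabs normc_def /= -sqrtr_sqr ler_sqrt ?lerDr ?sqr_ge0 //.
by rewrite addr_ge0 ?sqr_ge0.
Qed.

Lemma cabs_ReIm z : cabs z <= `|complex.Re z| + `|complex.Im z|.
Proof.
case: z => x y /=; rewrite /cabs normc_def /=.
rewrite -[leRHS]ger0_norm ?addr_ge0 // -sqrtr_sqr ler_sqrt ?sqr_ge0 //.
rewrite sqrrD !real_normK ?num_real //.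
have : 0 <= `|x| * `|y| by rewrite mulr_ge0.
lra.
Qed.

Lemma cabs_conj z : cabs z^* = cabs z.
Proof. by rewrite /cabs normcJ. Qed.

Lemma cabs_sqr z : cabs z ^+ 2 = complex.Re z ^+ 2 + complex.Im z ^+ 2.
Proof.
by rewrite /cabs normc_def /= sqr_sqrtr // addr_ge0 ?sqr_ge0.
Qed.

Lemma cabs_sum I (r : seq I) (P : pred I) (F : I -> R[i]) :
  cabs (\sum_(i <- r | P i) F i) <= \sum_(i <- r | P i) cabs (F i).
Proof.
elim/big_rec2: _ => [|i x y _ h]; first by rewrite cabs0.
by apply: le_trans (cabsD _ _) _; rewrite lerD2l.
Qed.

Lemma cabs_prod I (r : seq I) (P : pred I) (F : I -> R[i]) :
  cabs (\prod_(i <- r | P i) F i) = \prod_(i <- r | P i) cabs (F i).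
Proof.
elim/big_rec2: _ => [|i x y _ h]; first by rewrite cabs1.
by rewrite cabsM h.
Qed.

Lemma cabs_expi (t : R) : cabs (expi t) = 1.
Proof. by apply/eqP; rewrite -sqrp_eq1 ?cabs_ge0 // cabs_sqr /= cos2Dsin2. Qed.

Lemma lerB_cabs z w : cabs z - cabs w <= cabs (z - w).
Proof.
by rewrite lerBlDr -{1}[z](subrK w) cabsD.
Qed.

Lemma cvg_cabs (u : nat -> C) (l : C) :
  (forall e : R, 0 < e -> exists N, forall n, (N <= n)%N -> cabs (l - u n) <= e) ->
  u @ \oo --> l.
Proof.
move=> h; apply/cvgrPdist_le => /= e e0.
have eE : e = (complex.Re e)%:C by rewrite RRe_real // gtr0_real.
have [|N hN] := h (complex.Re e); first by rewrite -ltcR -eE.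
by exists N => // n /= Nn; rewrite eE le_cabs; apply: hN.
Qed.

Lemma cabs_cvg (u : nat -> C) (l : C) : u @ \oo --> l ->
  (forall e : R, 0 < e -> exists N, forall n, (N <= n)%N -> cabs (l - u n) <= e).
Proof.
move/cvgrPdist_le => /= h e e0.
have [|N _ hN] := h e%:C; first by rewrite ltcR.
by exists N => n Nn; rewrite -le_cabs; apply: hN.
Qed.

Lemma cvg_uniqC (u : nat -> C) (l m : C) :
  u @ \oo --> l -> u @ \oo --> m -> l = m.
Proof. by move=> h1 h2; apply: (cvg_unique _ h1 h2); exact: norm_hausdorff. Qed.

Lemma cvg_limC (u : nat -> C) (l : C) : u @ \oo --> l -> limn u = l.
Proof. by move=> h; apply: cvg_lim h; exact: norm_hausdorff. Qed.

Lemma geo_small (x A : R) : 0 <= x -> x < 1 -> forall e : R, 0 < e ->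
  exists N, forall n, (N <= n)%N -> A * x ^+ n <= e.
Proof.
move=> x0 x1 e e0.
have : (fun n => A * x ^+ n) @ \oo --> (0 : R).
  by apply: cvg_geometric; rewrite ger0_norm.
move/cvgrPdist_le => /(_ e e0) [N _ h]; exists N => n /h.
by rewrite sub0r normrN; apply: le_trans; rewrite ler_norm.
Qed.

Lemma geo_sum_le (x : R) m n : 0 <= x -> x < 1 ->
  \sum_(m <= j < n) x ^+ j <= x ^+ m / (1 - x).
Proof.
move=> x0 x1; have d0 : 0 < 1 - x by rewrite subr_gt0.
have [nm|mn] := leqP n m.
  by rewrite big_geq // divr_ge0 ?exprn_ge0 // ltW.
rewrite ler_pdivlMr //.
suff -> : (\sum_(m <= j < n) x ^+ j) * (1 - x) = x ^+ m - x ^+ n.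
  by rewrite gerBl exprn_ge0.
rewrite mulr_suml -[RHS]opprB -(telescope_sumr _ (ltnW mn)) -sumrN.
by apply: eq_bigr => j _; rewrite exprS; ring.
Qed.

Lemma geo_mulS_le (x : R) n : 0 <= x -> x < 1 -> n.+1%:R * x ^+ n <= (1 - x)^-1.
Proof.
move=> x0 x1; apply: (@le_trans _ _ (\sum_(0 <= j < n.+1) x ^+ j)); last first.
  by apply: le_trans (geo_sum_le 0 n.+1 x0 x1) _; rewrite expr0 div1r.
rewrite big_mkord -[n.+1 in leLHS]card_ord mulr_natl -sumr_const.
by apply: ler_sum => i _; apply: ler_wiXn2l => //; [exact: ltW | rewrite -ltnS].
Qed.

End Modulus.

(** * Power series with a geometric majorant *)

Section PowerSeries.
Variable R : realType.
Local Notation C := (R[i] : numFieldType).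
Implicit Types (z w x : C) (c : nat -> C).

Lemma cvg_ReIm (u : nat -> C) (a b : R) :
  (fun n => complex.Re (u n)) @ \oo --> a -> (fun n => complex.Im (u n)) @ \oo --> b ->
  u @ \oo --> ((a +i* b) : C).
Proof.
move=> /cvgrPdist_le ha /cvgrPdist_le hb; apply: cvg_cabs => e e0.
have e20 : 0 < e / 2 by lra.
have [N _ hN] := ha _ e20; have [N' _ hN'] := hb _ e20.
exists (maxn N N') => n; rewrite geq_max => /andP[n1 n2].
apply: le_trans (cabs_ReIm _) _.
have {hN}/= := hN n n1; have {hN'}/= := hN' n n2.
case: (u n) => x y /= h1 h2; lra.
Qed.

(** Closed discs are closed under limits; the centre is arbitrary, so this
    bounds differences of a limit and a partial sum. *)
Lemma cabs_lim_le (u : nat -> C) (l w : C) N (B : R) : u @ \oo --> l ->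
  (forall n, (N <= n)%N -> cabs (u n - w) <= B) -> cabs (l - w) <= B.
Proof.
move=> /cabs_cvg ul h; apply/ler_addgt0Pr => e /ul[N' hN'].
have /hN' h1 := leq_maxr N N'; have /h h2 := leq_maxl N N'.
rewrite -[l - w](subrKA (u (maxn N N'))).
by apply: le_trans (cabsD _ _) _; rewrite addrC lerD.
Qed.

(** Real and imaginary part are additive and bounded by the modulus, so
    absolute convergence of their series in R gives convergence in R[i]; the
    tail estimate passes to the limit from the partial sums. *)
Lemma series_geo (u : nat -> C) N (A t : R) : 0 <= t -> t < 1 ->
  (forall k, cabs (u (N + k)%N) <= A * t ^+ k) ->
  (series u @ \oo --> limn (series u)) /\
  cabs (limn (series u) - series u N) <= A / (1 - t).
Proof.
move=> t0 t1 hu.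
have cvR (f : C -> R) : (forall z, `|f z| <= cabs z) -> {morph f : x y / x + y} ->
    f 0 = 0 -> cvgn (fun n => f (series u n)).
  move=> hf fD f0.
  have fs n : f (series u n) = series (f \o u) n.
    rewrite /series /= (big_morph f fD f0) //.
  rewrite (_ : (fun n => _) = series (f \o u)); last exact/funext.
  suff /cvg_ex[l hl] : cvgn [sequence series (f \o u) (n + N)%N]_n.
    by apply/cvg_ex; exists l; rewrite -(cvg_shiftn N).
  rewrite (_ : [sequence _]_n = (fun n => series (f \o u) N
      + series (fun k => f (u (N + k)%N)) n)); last first.
    apply/funext => n; rewrite /series /= (big_cat_nat (n := N)) ?leq_addl //=.
    by congr +%R; rewrite -{1}[N]add0n big_addn addnK; under eq_bigr do rewrite addnC.
  apply: is_cvgD; first exact: is_cvg_cst.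
  apply: normed_cvg.
  apply: (@series_le_cvg _ _ (fun k => A * t ^+ k)) => //= k.
  - by rewrite (le_trans _ (hu k)) // cabs_ge0.
  - by rewrite (le_trans (hf _)) // hu.
  - by apply: is_cvg_geometric_series; rewrite ger0_norm.
have cv : series u @ \oo --> limn (series u).
  have /cvg_ex[a ha] := cvR _ (@cabs_Re R) (raddfD (@complex.Re R)) (raddf0 (@complex.Re R)).
  have /cvg_ex[b hb] := cvR _ (@cabs_Im R) (raddfD (@complex.Im R)) (raddf0 (@complex.Im R)).
  have h := cvg_ReIm ha hb.
  by rewrite (cvg_limC h).
split => //; apply: (cabs_lim_le (N := N) cv) => n Nn.
rewrite /series /= (big_cat_nat (n := N)) //= addrAC subrr add0r.
apply: le_trans (cabs_sum _ _ _) _.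
rewrite -(subnKC Nn) -{1}[N]add0n big_addn addKn.
apply: (@le_trans _ _ (\sum_(0 <= i < n - N) A * t ^+ i)).
  by apply: ler_sum => i _; rewrite addnC hu.
rewrite -mulr_sumr; have A0 : 0 <= A by have := le_trans (cabs_ge0 _) (hu 0%N); rewrite expr0 mulr1.
by apply: ler_wpM2l => //; apply: le_trans (geo_sum_le _ _ t0 t1) _; rewrite expr0 div1r.
Qed.

Definition geo_bounded c (M r : R) := forall n, cabs (c n) <= M * r ^+ n.

Definition psum c z : C := limn (power_series c z).

Lemma psum_lim c z l : power_series c z @ \oo --> l -> psum c z = l.
Proof. exact: cvg_limC. Qed.

Lemma eq_psum c d z w : power_series c z =1 power_series d w -> psum c z = psum d w.
Proof. by move=> /funext e; rewrite /psum e. Qed.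

Lemma geo_bounded_ge0 c M r : geo_bounded c M r -> 0 <= M.
Proof. by move/(_ 0%N); rewrite expr0 mulr1; apply: le_trans; rewrite cabs_ge0. Qed.

Lemma geo_bounded_term c M r z n : geo_bounded c M r ->
  cabs (c n * z ^+ n) <= M * (r * cabs z) ^+ n.
Proof.
by move=> h; rewrite cabsM cabsX exprMn mulrA ler_wpM2r // exprn_ge0 ?cabs_ge0.
Qed.

Section Bounded.
Variables (c : nat -> C) (M r : R).
Hypotheses (r0 : 0 <= r) (hc : geo_bounded c M r).

Lemma psum_tail_le z t N : r * cabs z <= t -> t < 1 ->
  cabs (psum c z - power_series c z N) <= M * t ^+ N / (1 - t).
Proof.
move=> rt t1; have t0 : 0 <= t by rewrite (le_trans _ rt) // mulr_ge0 // cabs_ge0.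
apply: (proj2 (@series_geo (fun j => c j * z ^+ j) N (M * t ^+ N) t t0 t1 _)) => k.
apply: le_trans (geo_bounded_term _ _ hc) _.
rewrite -mulrA -exprD ler_wpM2l ?(geo_bounded_ge0 hc) //.
by rewrite lerXn2r // nnegrE // mulr_ge0 // cabs_ge0.
Qed.

Lemma psum_cvg z : r * cabs z < 1 -> power_series c z @ \oo --> psum c z.
Proof.
move=> rt.
apply: (proj1 (@series_geo (fun j => c j * z ^+ j) 0 M (r * cabs z) _ rt _)).
  by rewrite mulr_ge0 // cabs_ge0.
by move=> k; apply: geo_bounded_term hc.
Qed.

Lemma psum_le z t : r * cabs z <= t -> t < 1 -> cabs (psum c z) <= M / (1 - t).
Proof.
move=> h1 h2; have := psum_tail_le 0 h1 h2.
by rewrite expr0 mulr1 /power_series /series /= big_geq // subr0.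
Qed.

End Bounded.

End PowerSeries.

(* Otherwise closing tactics compare two sums by unfolding the limits and then
   the arithmetic of their complex arguments. *)
Local Opaque psum.

(** * Power series in the unit disc *)

Section Disc.
Variable R : realType.
Local Notation C := (R[i] : numFieldType).
Implicit Types (z w x : C) (c d : nat -> C).

(** The radius of convergence is at least one. *)
Definition subexp c := forall r : R, 1 < r -> exists M, geo_bounded c M r.

Lemma subexp_radius (t : R) : 0 <= t -> t < 1 -> {r : R | 1 < r & r * t < 1}.
Proof.
move=> t0 t1; exists (2 / (1 + t)).
  by rewrite ltr_pdivlMr; lra.
by rewrite mulrAC ltr_pdivrMr; lra.
Qed.

Lemma subexp_sub c : (forall r : R, 1 < r -> exists2 r', 1 < r' <= r & exists M, geo_bounded c M r') -> subexp c.
Proof.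
move=> h r /h[r' /andP[r1 rr] [M hM]]; exists M => n.
apply: le_trans (hM n) _; rewrite ler_wpM2l ?(geo_bounded_ge0 hM) //.
rewrite lerXn2r // nnegrE; lra.
Qed.

Lemma subexp_shift c k : subexp c -> subexp (fun n => c (n + k)%N).
Proof.
move=> h r r1; have [M hM] := h r r1; exists (M * r ^+ k) => n.
by rewrite -mulrA -exprD addnC hM.
Qed.

Lemma subexp_psum_cvg c z : subexp c -> cabs z < 1 ->
  power_series c z @ \oo --> psum c z.
Proof.
move=> h z1; have [r r1 rz] := subexp_radius (cabs_ge0 z) z1.
have [M hM] := h r r1.
by apply: (psum_cvg _ hM) => //; lra.
Qed.

Lemma power_seriesS c z n : power_series c z n.+1 = power_series c z n + c n * z ^+ n.
Proof. by rewrite /power_series /series /= big_nat_recr. Qed.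

Lemma power_series_recl c z n :
  power_series c z n.+1 = c 0%N + z * power_series (c \o succn) z n.
Proof.
rewrite /power_series /series /= big_nat_recl // expr0 mulr1; congr +%R.
by rewrite mulr_sumr; apply: eq_bigr => i _; rewrite exprS mulrCA.
Qed.

Lemma geo_bounded_psum_recl c (M r : R) z : 0 <= r -> geo_bounded c M r ->
  r * cabs z < 1 -> psum c z = c 0%N + z * psum (c \o succn) z.
Proof.
move=> r0 hc z1; apply: (@cvg_uniqC _ (fun n => power_series c z n.+1)).
  by have := psum_cvg r0 hc z1; rewrite -cvg_shiftS.
under eq_fun do rewrite power_series_recl.
apply: cvgD; first exact: cvg_cst.
apply: cvgMr; apply: (psum_cvg (M := M * r) r0 _ z1) => n /=.
by rewrite -mulrA -exprS hc.
Qed.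

Lemma psum_recl c z : subexp c -> cabs z < 1 ->
  psum c z = c 0%N + z * psum (c \o succn) z.
Proof.
move=> h z1; have [r r1 rz] := subexp_radius (cabs_ge0 z) z1.
have [M hM] := h r r1; apply: (geo_bounded_psum_recl _ hM rz); lra.
Qed.

(** The coefficients of (psum c z - psum c x) / (z - x) as a power series in z
    about 0, by synthetic division. As this is again of the form psum, it gives
    continuity, differentiability and the division of zeros without complex
    integration. *)
Definition divdiff c x (i : nat) : C := psum (fun k => c (k + i.+1)%N) x.

Lemma divdiff_rec c x i : subexp c -> cabs x < 1 ->
  divdiff c x i = c i.+1 + x * divdiff c x i.+1.
Proof.
move=> h x1; rewrite /divdiff (psum_recl (subexp_shift i.+1 h) x1) add0n.
have -> : (fun k => c (k + i.+1)%N) \o succn = (fun k => c (k + i.+2)%N); last exact: erefl.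
by apply/funext => n /=; rewrite addSnnS.
Qed.

Lemma divdiff_subexp c x : subexp c -> cabs x < 1 -> subexp (divdiff c x).
Proof.
move=> h x1; apply: subexp_sub => r r1.
have [r' r'1 r'x] := subexp_radius (cabs_ge0 x) x1.
have m1 : 1 < Num.min r r' by rewrite lt_min r1.
have mx : Num.min r r' * cabs x < 1.
  by apply: le_lt_trans r'x; rewrite ler_wpM2r ?cabs_ge0 // ge_min lexx orbT.
set s := Num.min r r' in m1 mx *.
exists s; first by rewrite m1 ge_min lexx.
have [M hM] := h s m1; exists (M * s / (1 - s * cabs x)) => n.
have -> : M * s / (1 - s * cabs x) * s ^+ n = M * s ^+ n.+1 / (1 - s * cabs x).
  by rewrite exprS; ring.
apply: (psum_le _ _ (lexx _) mx); first lra.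
by move=> k; rewrite -mulrA -exprD addnC.
Qed.

(** Synthetic division of a partial sum; the remainder is one term of the
    quotient series, hence tends to 0. *)
Lemma divdiff_partial c x z n : subexp c -> cabs x < 1 ->
  (z - x) * power_series (divdiff c x) z n.+1 =
  power_series c z n.+1 - psum c x + divdiff c x n * z ^+ n.+1.
Proof.
move=> h x1; elim: n => [|n IH].
  rewrite /power_series /series /= !big_nat1 expr0 expr1 !mulr1.
  rewrite [psum c x]psum_recl // /divdiff.
  rewrite (_ : (fun k => c (k + 1)%N) = c \o succn); first by ring.
  by apply/funext => k /=; rewrite addn1.
rewrite power_seriesS mulrDr IH [in RHS]power_seriesS divdiff_rec //.
by rewrite [z ^+ n.+2]exprS; ring.
Qed.

Lemma psum_divdiff c x z : subexp c -> cabs x < 1 -> cabs z < 1 ->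
  psum c z = psum c x + (z - x) * psum (divdiff c x) z.
Proof.
move=> h x1 z1; apply/eqP; rewrite addrC -subr_eq; apply/eqP.
have hd := divdiff_subexp h x1.
apply: (@cvg_uniqC _ (fun n => (z - x) * power_series (divdiff c x) z n.+1)); last first.
  by apply: cvgMr; have := subexp_psum_cvg hd z1; rewrite -cvg_shiftS.
under eq_fun do rewrite divdiff_partial //.
rewrite -[psum c z - psum c x]addr0; apply: cvgD.
  apply: cvgB; last exact: cvg_cst.
  by have := subexp_psum_cvg h z1; rewrite -cvg_shiftS.
apply: cvg_cabs => e e0; have [r r1 rz] := subexp_radius (cabs_ge0 z) z1.
have [M hM] := hd r r1.
have rz0 : 0 <= r * cabs z by rewrite mulr_ge0 ?cabs_ge0 //; lra.
have [N hN] := geo_small M rz0 rz e0; exists N => n /hN; apply: le_trans.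
rewrite sub0r cabsN cabsM cabsX exprMn mulrA.
apply: ler_pM => //; rewrite ?exprn_ge0 ?cabs_ge0 //.
by rewrite exprS ler_piMl ?exprn_ge0 ?cabs_ge0 // ltW.
Qed.

End Disc.

(** * Continuity and differentiability *)

Section Holo.
Variable R : realType.
Local Notation C := (R[i] : numFieldType).
Implicit Types (z w x : C) (c d : nat -> C) (f g : C -> C).

Lemma near_cabs x (P : C -> Prop) :
  (\forall z \near x, P z) <-> exists2 e : R, 0 < e & forall z, cabs (z - x) < e -> P z.
Proof.
split.
  move/nbhs_ballP => [e /= e0 he].
  have eE : e = (complex.Re e)%:C by rewrite RRe_real // gtr0_real.
  exists (complex.Re e); first by rewrite -ltcR -eE.
  by move=> z hz; apply: he; rewrite /ball /= distrC eE lt_cabs.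
move=> [e e0 he]; apply/nbhs_ballP; exists e%:C => /=; first by rewrite ltcR.
by move=> z; rewrite /ball /= distrC lt_cabs => /he.
Qed.

Lemma dnear_cabs x (P : C -> Prop) :
  (\forall z \near x^', P z) <->
  exists2 e : R, 0 < e & forall z, z != x -> cabs (z - x) < e -> P z.
Proof.
have -> : (\forall z \near x^', P z) = (\forall z \near x, z != x -> P z) by [].
rewrite near_cabs; split => -[e e0 he]; exists e => // z.
  by move=> h1 h2; apply: he.
by move=> h2 h1; apply: he.
Qed.

Definition cont_at f x := forall e : R, 0 < e ->
  exists2 d : R, 0 < d & forall z, cabs (z - x) < d -> cabs (f z - f x) <= e.

Lemma cont_at_near f x (e : R) : cont_at f x -> 0 < e ->
  exists2 d : R, 0 < d & forall z, cabs (z - x) < d -> cabs (f z - f x) < e.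
Proof.
move=> h e0; have [|d d0 hd] := h (e / 2); first lra.
by exists d => // z /hd h'; apply: (le_lt_trans h'); lra.
Qed.

(** Caratheodory's form of differentiability: the value at x of a slope function
    that is continuous at x is the derivative. *)
Lemma derivable_slope f g x :
  (exists2 e : R, 0 < e & forall z, cabs (z - x) < e -> f z = f x + (z - x) * g z) ->
  cont_at g x -> derivable (f : C^o -> C^o) x 1.
Proof.
move=> [e e0 hfg] gc; apply/cvg_ex; exists (g x : C^o).
apply/cvgrPdist_le => /= t t0.
have tE : t = (complex.Re t)%:C by rewrite RRe_real // gtr0_real.
have t0' : 0 < complex.Re t by rewrite -ltcR -tE.
have [d d0 hd] := gc _ t0'.
apply/dnear_cabs; exists (Num.min e d) => [|h hn]; first by rewrite lt_min e0 d0.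
rewrite subr0 lt_min => /andP[he hdd].
rewrite tE le_cabs cabsB [h *: 1]mulr1.
rewrite (hfg (h + x)) ?addrK // [f x + _]addrC addrK /GRing.scale /= mulKf //.
by apply: hd; rewrite addrK.
Qed.

Lemma derivable_cont f x : derivable (f : C^o -> C^o) x 1 -> cont_at f x.
Proof.
move=> /derivable1_diffP /differentiable_continuous fc e e0.
have /near_cabs[d d0 hd] : \forall z \near x, `|f x - f z| <= e%:C.
  by move/cvgrPdist_le: fc; apply; rewrite ltcR.
by exists d => // z /hd; rewrite le_cabs cabsB.
Qed.

Lemma psum_bounded c (t : R) : subexp c -> t < 1 ->
  exists2 B : R, 0 < B & forall z, cabs z <= t -> cabs (psum c z) <= B.
Proof.
move=> h t1; have [t0|t0] := ltP t 0.
  by exists 1 => // z hz; have := cabs_ge0 z; lra.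
have [r r1 rt] := subexp_radius t0 t1; have [M hM] := h r r1.
exists (M / (1 - r * t) + 1) => [|z hz].
  by rewrite ltr_wpDl // divr_ge0 ?(geo_bounded_ge0 hM) //; lra.
have r0 : 0 <= r by lra.
apply: (@le_trans _ _ (M / (1 - r * t))); last by rewrite lerDl.
by apply: (psum_le r0 hM _ rt); rewrite ler_wpM2l.
Qed.

Lemma psum_cont c x : subexp c -> cabs x < 1 -> cont_at (psum c) x.
Proof.
move=> h x1 e e0; have hd := divdiff_subexp h x1.
have [|B B0 hB] := @psum_bounded _ ((1 + cabs x) / 2) hd; first lra.
exists (Num.min ((1 - cabs x) / 2) (e / B)) => [|z].
  by rewrite lt_min; apply/andP; split; [lra | rewrite divr_gt0].
rewrite lt_min => /andP[h1 h2].
have hz : cabs z <= (1 + cabs x) / 2.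
  by rewrite -[z](subrK x); have := cabsD (z - x) x; lra.
rewrite (psum_divdiff h x1 (z := z)); last lra.
rewrite addrC addKr cabsM; have h3 := hB z hz.
have -> : e = (e / B) * B by rewrite divfK // gt_eqF.
by apply: ler_pM => //; rewrite ?cabs_ge0 // ltW.
Qed.

End Holo.

(** * Zeros of power series are isolated *)

Section Zeros.
Variable R : realType.
Local Notation C := (R[i] : numFieldType).
Implicit Types (z w x : C) (c d : nat -> C) (f g : C -> C).

Lemma psum_derivable c x : subexp c -> cabs x < 1 ->
  derivable (psum c : C^o -> C^o) x 1.
Proof.
move=> h x1; apply: (@derivable_slope _ _ (psum (divdiff c x))).
  exists (1 - cabs x) => [|z hz]; first lra.
  apply: psum_divdiff => //.
  by rewrite -[z](subrK x); have := cabsD (z - x) x; lra.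
by apply: psum_cont => //; apply: divdiff_subexp.
Qed.

Definition zeros_cluster c x := forall e : R, 0 < e ->
  exists z, [/\ z != x, cabs (z - x) < e, cabs z < 1 & psum c z = 0].

Lemma cluster_zero c x : subexp c -> cabs x < 1 -> zeros_cluster c x ->
  psum c x = 0.
Proof.
move=> h x1 hz; apply/eqP; rewrite -cabs_eq0; apply/eqP/le_anti.
rewrite cabs_ge0 andbT; apply/ler_addgt0Pr => e e0; rewrite add0r.
have [d d0 hd] := psum_cont h x1 e0.
have [z [_ hzx _ z0]] := hz d d0.
by have := hd z hzx; rewrite z0 sub0r cabsN.
Qed.

Lemma cluster_divdiff c x : subexp c -> cabs x < 1 -> zeros_cluster c x ->
  zeros_cluster (divdiff c x) x.
Proof.
move=> h x1 hz e e0; have [z [zx zxe z1 cz]] := hz e e0.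
exists z; split=> //; have := psum_divdiff h x1 z1.
rewrite cz (cluster_zero h) // add0r => /esym/eqP.
by rewrite mulf_eq0 subr_eq0 (negPf zx) => /eqP.
Qed.

(** When zeros accumulate at x, the factor z - x can be divided out n times for
    every n. The coefficients of the n-th quotient are at most
    M (1/r - |x|)^-n r^i, so the factor |z - x|^n wins for z close to x. *)
Lemma cluster_vanish c x (r M : R) z : subexp c -> cabs x < 1 -> 
  1 < r -> geo_bounded c M r -> zeros_cluster c x -> cabs (z - x) < r^-1 - cabs x ->
  psum c z = 0.
Proof.
move=> h x1 r1 hM hx hz; have r0 : 0 < r by lra.
have rV : r * r^-1 = 1 by rewrite divff // gt_eqF.
have zr : cabs z < r^-1.
  by rewrite -[z](subrK x); have := cabsD (z - x) x; lra.
have rV1 : r^-1 < 1 by rewrite invf_lt1.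
have rz1 : r * cabs z < 1 by rewrite -rV ltr_pM2l.
have rx1 : r * cabs x < 1.
  by rewrite -rV ltr_pM2l //; have := cabs_ge0 (z - x); lra.
pose k := r / (1 - r * cabs x).
have k0 : 0 < k by rewrite divr_gt0 //; lra.
have kz : k * cabs (z - x) < 1.
  rewrite /k mulrAC ltr_pdivrMr; last lra.
  have : r * cabs (z - x) < r * (r^-1 - cabs x) by rewrite ltr_pM2l.
  by rewrite mulrBr rV mul1r.
have key n : exists d, [/\ subexp d, zeros_cluster d x,
    geo_bounded d (M * k ^+ n) r & psum c z = (z - x) ^+ n * psum d z].
  elim: n => [|n [d [hd ad bd ed]]].
    by exists c; split; rewrite ?expr0 ?mulr1 ?mul1r.
  exists (divdiff d x); split.
  - exact: divdiff_subexp.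
  - exact: cluster_divdiff.
  - move=> i; rewrite /divdiff.
    have -> : M * k ^+ n.+1 * r ^+ i = (M * k ^+ n * r ^+ i.+1) / (1 - r * cabs x).
      by rewrite exprS [r ^+ i.+1]exprS /k; ring.
    apply: (psum_le _ _ (lexx _) rx1) => [|j]; first lra.
    by rewrite addnC -mulrA -exprD bd.
  - have z1 : cabs z < 1 by lra.
    by rewrite ed (psum_divdiff hd x1 z1) (cluster_zero hd x1 ad) add0r exprSr mulrA.
apply/eqP; rewrite -cabs_eq0; apply/eqP/le_anti.
rewrite cabs_ge0 andbT; apply/ler_addgt0Pr => e e0; rewrite add0r.
have kz0 : 0 <= k * cabs (z - x) by rewrite mulr_ge0 ?cabs_ge0 // ltW.
have [N hN] := geo_small (M / (1 - r * cabs z)) kz0 kz e0.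
apply: le_trans (hN N (leqnn N)).
have [d [_ _ bd ->]] := key N.
rewrite cabsM cabsX exprMn.
have := psum_le (ltW r0) bd (lexx _) rz1.
move/(ler_wpM2l (exprn_ge0 N (cabs_ge0 (z - x)))) => /le_trans; apply.
by rewrite le_eqVlt; apply/orP; left; apply/eqP; ring.
Qed.

(** If zeros accumulated at x, the sum would vanish on a disc about x, so zeros
    would accumulate at all its points. The radius of that disc is at least
    1/r - |x| wherever one stands in |y| <= |x|, so finitely many steps along the
    segment from x to 0 reach 0, where the sum is c 0. *)
Lemma psum_zero_isolated c x : subexp c -> c 0%N != 0 -> cabs x < 1 ->
  exists2 e : R, 0 < e & forall z, z != x -> cabs (z - x) < e -> psum c z != 0.
Proof.
move=> h c0 x1; apply: contrapT => hn.
have acc0 : zeros_cluster c x.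
  move=> e e0; apply: contrapT => hz; apply: hn.
  exists (Num.min e (1 - cabs x)) => [|z zx]; first by rewrite lt_min e0; lra.
  rewrite lt_min => /andP[h1 h2]; apply/eqP => cz; apply: hz; exists z; split=> //.
  by rewrite -[z](subrK x); have := cabsD (z - x) x; lra.
have [r r1 rx] := subexp_radius (cabs_ge0 x) x1; have [M hM] := h r r1.
have r0 : 0 < r by lra.
pose d := r^-1 - cabs x.
have d0 : 0 < d by rewrite subr_gt0 -(ltr_pM2l r0) divff ?gt_eqF.
have [N hN] : exists N, cabs x / d < N.+1%:R.
  have [N HN] : exists N, cabs x / d < N%:R by exists (Num.bound (cabs x / d)); apply: archi_boundP; rewrite divr_ge0 ?cabs_ge0 ?ltW.
  by exists N; apply: (lt_trans HN); rewrite ltr_nat.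
pose y k : C := x * (1 - k%:R / N.+1%:R).
have N0 : (0 : C) < N.+1%:R by rewrite ltr0n.
have yle k : (k <= N.+1)%N -> cabs (y k) <= cabs x.
  move=> kN; rewrite cabsM ler_piMr ?cabs_ge0 //.
  have -> : 1 - k%:R / N.+1%:R = (N.+1 - k)%:R / N.+1%:R :> C.
    by rewrite natrB // mulrBl divff ?gt_eqF.
  by rewrite cabs_div !cabs_nat ler_pdivrMr ?ltr0n // mul1r ler_nat leq_subr.
have stepE k : cabs (y k.+1 - y k) < d.
  have -> : y k.+1 - y k = - (x / N.+1%:R).
    by rewrite /y -[in k.+1%:R]addn1 natrD; ring.
  by rewrite cabsN cabs_div cabs_nat ltr_pdivrMr ?ltr0n // mulrC -ltr_pdivrMr.
have accy k : (k <= N.+1)%N -> zeros_cluster c (y k).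
  elim: k => [|k IH] kN; first by rewrite /y mul0r subr0 mulr1.
  have yk1 : cabs (y k) < 1 by have := yle k (ltnW kN); lra.
  have van z : cabs (z - y k) < d -> psum c z = 0.
    move=> hz; apply: (cluster_vanish h yk1 r1 hM (IH (ltnW kN))).
    by apply: lt_le_trans hz _; rewrite lerB // yle // ltnW.
  move=> e e0; pose eta := Num.min e (Num.min (d - cabs (y k.+1 - y k)) (1 - cabs x)) / 2.
  have eta0 : 0 < eta.
    rewrite divr_gt0 // !lt_min e0 subr_gt0 stepE /=; lra.
  have : eta * 2 <= Num.min e (Num.min (d - cabs (y k.+1 - y k)) (1 - cabs x)).
    by rewrite /eta divfK.
  rewrite !le_min => /and3P[e1 e2 e3].
  have en : cabs (eta%:C) = eta by rewrite cabs_real gtr0_norm.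
  exists (y k.+1 + eta%:C); split.
  - by rewrite -subr_eq0 addrAC subrr add0r -cabs_eq0 en gt_eqF.
  - by rewrite addrAC subrr add0r en; lra.
  - by have := cabsD (y k.+1) (eta%:C); have := yle _ kN; rewrite en; lra.
  - apply: van; rewrite addrAC; have := cabsD (y k.+1 - y k) (eta%:C); rewrite en; lra.
have := cluster_zero h _ (accy N.+1 (leqnn _)).
rewrite /y divff ?gt_eqF // subrr mulr0 cabs0 => /(_ ltr01).
rewrite psum_recl ?cabs0 // mul0r addr0 => /eqP; exact/negP.
Qed.

End Zeros.

(** * The reciprocals of q-Pochhammer products *)

Section QPochhammer.
Variable R : realType.
Local Notation C := (R[i] : numFieldType).
Variable q : C.

(** The distance from q^k to 1 decreases at most like 1/k: q is an irrational
    point of the circle that is badly approximable by roots of unity. *)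
Definition dioph (A : R) := forall k, (0 < k)%N -> 1 <= A * k%:R * cabs (1 - q ^+ k).

Definition qpoch n : C := \prod_(1 <= k < n.+1) (1 - q ^+ k).

Lemma qpoch0 : qpoch 0 = 1.
Proof. by rewrite /qpoch big_geq. Qed.

Lemma qpochS n : qpoch n.+1 = qpoch n * (1 - q ^+ n.+1).
Proof. by rewrite /qpoch big_nat_recr. Qed.

Section NonRoot.
Hypothesis q1 : forall k, (0 < k)%N -> 1 - q ^+ k != 0.

Lemma qpoch_neq0 n : qpoch n != 0.
Proof. by elim: n => [|n IH]; rewrite ?qpoch0 ?oner_eq0 // qpochS mulf_neq0 ?q1. Qed.

Local Notation e n := (qpoch n)^-1.

Lemma qpochV_rec n : e n.+1 * (1 - q ^+ n.+1) = e n.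
Proof. by rewrite qpochS invfM mulfVK // q1. Qed.

Lemma qpochV_sum n : \sum_(j < n.+1) e j * q ^+ j = e n.
Proof.
elim: n => [|n IH]; first by rewrite big_ord1 expr0 mulr1.
by rewrite big_ord_recr /= IH -[in LHS](qpochV_rec n); ring.
Qed.

(** Formally, sum_n z^n / (q)_n is the product of the 1 / (1 - z q^i), whose
    logarithmic derivative is sum_k z^(k-1) / (1 - q^k). It replaces the product
    (q)_n, whose small factors accumulate, by a sum of small denominators. *)
Lemma qpochV_logderiv n :
  n%:R * e n = \sum_(k < n) e (n - k.+1)%N / (1 - q ^+ k.+1).
Proof.
elim: n => [|n IH]; first by rewrite mul0r big_ord0.
have d0 := q1 (ltn0Sn n); apply: (mulIf d0).
rewrite -mulrA qpochV_rec mulr_suml.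
have split_term (k : 'I_n.+1) : true -> e (n.+1 - k.+1)%N / (1 - q ^+ k.+1) * (1 - q ^+ n.+1)
    = e (n - k)%N * (1 - q ^+ (n - k)) / (1 - q ^+ k.+1) + e (n - k)%N * q ^+ (n - k).
  move=> _; rewrite subSS.
  have -> : q ^+ n.+1 = q ^+ (n - k) * q ^+ k.+1.
    by rewrite -exprD; congr (_ ^+ _); have := ltn_ord k; lia.
  have dk := q1 (ltn0Sn k); field; apply/andP; split => //; exact: qpoch_neq0.
rewrite (eq_bigr _ split_term) big_split /= -natr1 mulrDl mul1r; congr +%R.
  rewrite IH big_ord_recr /= subnn expr0 subrr mulr0 mul0r addr0.
  apply: eq_bigr => k _; congr (_ / _).
  have -> : (n - k = (n - k.+1).+1)%N by have := ltn_ord k; lia.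
  by rewrite qpochV_rec.
rewrite -[LHS]qpochV_sum (reindex_inj rev_ord_inj) /=.
by apply: eq_bigr => k _; rewrite subSS.
Qed.

End NonRoot.

Lemma sum_mul_geo (x : R) n : 0 <= x -> x < 1 ->
  \sum_(k < n) k.+1%:R * x ^+ k.+1 <= x / (1 - x) ^+ 2.
Proof.
move=> x0 x1; have d0 : 0 < 1 - x by lra.
rewrite ler_pdivlMr ?exprn_gt0 //.
suff -> : (\sum_(k < n) k.+1%:R * x ^+ k.+1) * (1 - x) ^+ 2 =
  x - x ^+ n.+1 * (n.+1%:R * (1 - x) + x).
  rewrite gerBl mulr_ge0 ?exprn_ge0 //.
  by rewrite addr_ge0 // mulr_ge0 // ltW.
elim: n => [|n IH]; first by rewrite big_ord0 expr1; ring.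
rewrite big_ord_recr /= mulrDl IH -[n.+2%:R]natr1 [x ^+ n.+2]exprSr -[n.+1%:R]natr1; ring.
Qed.

Section Growth.
Variable A : R.
Hypothesis hA : dioph A.

Lemma dioph_neq0 k : (0 < k)%N -> 1 - q ^+ k != 0.
Proof.
move=> k0; apply/eqP => h; have := hA k0.
by rewrite h cabs0 mulr0 ler10.
Qed.

Lemma dioph_inv k : (0 < k)%N -> cabs (1 - q ^+ k)^-1 <= A * k%:R.
Proof.
move=> k0; rewrite cabsV -[leLHS]mul1r ler_pdivrMr ?cabs_gt0 ?dioph_neq0 //.
exact: hA.
Qed.

(** The recursion n e_n = sum_k e_(n-k) / (1 - q^k) for e_n = 1 / (q)_n propagates
    a bound M r^n, because sum_k A k r^-k = A r / (r - 1)^2 is at most n once n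
    reaches N. For any r > 1 only finitely many e_n have to be inspected, which
    is also what makes an explicit bound computable. *)
Lemma qpochV_bounded (M r : R) N : 1 < r -> 0 <= M ->
  A * r / (r - 1) ^+ 2 <= N%:R ->
  (forall n, (n < N)%N -> cabs (qpoch n)^-1 <= M * r ^+ n) ->
  geo_bounded (fun n => (qpoch n)^-1) M r.
Proof.
move=> r1 M0 hN hM n; have r0 : 0 < r by lra.
have [k] := ubnP n; elim: k => // k IH in n * => nk.
have [/hM //|Nn] := ltnP n N.
have A0 : 0 <= A by have := le_trans (cabs_ge0 _) (dioph_inv (ltn0Sn 0)); rewrite mulr1.
have n0 : (0 < n)%N.
  rewrite lt0n; apply/eqP => n0; move: Nn hN; rewrite n0 leqn0 => /eqP->.
  rewrite leNgt divr_gt0 ?exprn_gt0 //; last lra.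
  rewrite mulr_gt0 // lt_neqAle A0 andbT; apply/eqP => A00.
  by have := hA (ltn0Sn 0); rewrite -A00 !mul0r ler10.
have nR0 : (0 : R) < n%:R by rewrite ltr0n.
rewrite -(ler_pM2l nR0) -cabs_nat -cabsM (qpochV_logderiv dioph_neq0).
apply: le_trans (cabs_sum _ _ _) _.
have xr : r^-1 < 1 by rewrite invf_lt1.
have xr0 : 0 <= r^-1 by rewrite invr_ge0 ltW.
apply: (@le_trans _ _ (\sum_(k < n) (M * r ^+ n * A) * (k.+1%:R * r^-1 ^+ k.+1))).
  apply: ler_sum => i _; rewrite cabsM.
  have h1 : cabs (qpoch (n - i.+1))^-1 <= M * r ^+ (n - i.+1).
    by apply: IH; have := ltn_ord i; lia.
  apply: (le_trans (ler_pM (cabs_ge0 _) (cabs_ge0 _) h1 (dioph_inv (ltn0Sn i)))).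
  have -> : r ^+ n = r ^+ (n - i.+1) * r ^+ i.+1 by rewrite -exprD subnK.
  rewrite le_eqVlt; apply/orP; left; apply/eqP.
  rewrite exprVn; field; rewrite expf_neq0 // gt_eqF //.
rewrite -mulr_sumr cabs_nat.
have Mr0 : 0 <= M * r ^+ n by rewrite mulr_ge0 // exprn_ge0 // ltW.
have h := sum_mul_geo n xr0 xr.
apply: le_trans (ler_wpM2l (mulr_ge0 Mr0 A0) h) _.
have -> : M * r ^+ n * A * (r^-1 / (1 - r^-1) ^+ 2) = M * r ^+ n * (A * r / (r - 1) ^+ 2).
  by field; rewrite subr_eq0 !gt_eqF.
rewrite mulrC ler_wpM2r //; apply: le_trans hN _.
by rewrite ler_nat.
Qed.

Lemma qpochV_subexp : subexp (fun n => (qpoch n)^-1).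
Proof.
move=> r r1; have r0 : 0 < r by lra.
have [N hN] : exists N, A * r / (r - 1) ^+ 2 <= N%:R.
  exists (Num.bound `|A * r / (r - 1) ^+ 2|); apply: le_trans (ler_norm _) _.
  by rewrite ltW // archi_boundP.
exists (\sum_(i < N) cabs (qpoch i)^-1).
apply: (qpochV_bounded r1 _ hN) => [|n nN].
  by apply: sumr_ge0 => i _; exact: cabs_ge0.
apply: (@le_trans _ _ (\sum_(i < N) cabs (qpoch i)^-1)).
  by rewrite (bigD1 (Ordinal nN)) //= lerDl sumr_ge0 // => i _; exact: cabs_ge0.
rewrite ler_peMr ?sumr_ge0 // => [i _|]; first exact: cabs_ge0.
by rewrite exprn_ege1 // ltW.
Qed.

End Growth.
End QPochhammer.

(** * The quadratic irrational tau *)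

Section Angle.
Variable R : realType.
Local Notation C := (R[i] : numFieldType).
Implicit Types (x y t : R).

Lemma expiD x y : expi (x + y) = expi x * expi y.
Proof. by rewrite /expi cosD sinD; simpc; congr (_ +i* _); ring. Qed.

Lemma expi0 : expi (0 : R) = 1.
Proof. by rewrite /expi cos0 sin0. Qed.

Lemma expiX x n : expi x ^+ n = expi (n%:R * x).
Proof.
elim: n => [|n IH]; first by rewrite mul0r expi0.
by rewrite exprS IH -expiD -natr1; congr expi; ring.
Qed.

Lemma expi_2piZ (p : int) : expi (2 * pi * p%:~R) = 1 :> R[i].
Proof.
have nat_case (n : nat) : expi (n%:R * (2 * pi)) = 1 :> R[i].
  by rewrite -expiX /expi mulr_natl cos2pi sin2pi expr1n.
case: p => n; first by rewrite mulrC nat_case.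
rewrite NegzE mulrNz mulrN mulrC.
have := expiD (n.+1%:R * (2 * pi)) (- (n.+1%:R * (2 * pi))).
by rewrite subrr expi0 nat_case mul1r => /esym.
Qed.

Lemma cabs_1Bexpi x : cabs (1 - expi (2 * x)) = 2 * `|sin x|.
Proof.
apply/eqP; rewrite -(eqrXn2 (n := 2)) ?cabs_ge0 ?mulr_ge0 //; apply/eqP.
rewrite cabs_sqr exprMn real_normK ?num_real // /expi /=.
rewrite mulr_natl cos_mulr2n sin_mulr2n sub0r.
have := cos2Dsin2 x; move: (cos x) (sin x) => c s h.
have -> : c ^+ 2 = 1 - s ^+ 2 by rewrite -h addrK.
transitivity (4 * s ^+ 4 + 4 * c ^+ 2 * s ^+ 2); first by ring.
have -> : c ^+ 2 = 1 - s ^+ 2 by rewrite -h addrK.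
ring.
Qed.

(** Jordan's inequality, from the mean value theorem on [0, x] and [x, pi/2]:
    the slopes of sin decrease because cos does. *)
Lemma jordan x : 0 <= x <= pi / 2 -> x <= pi / 2 * sin x.
Proof.
move=> /andP[]; rewrite le_eqVlt => /orP[/eqP<-|x0]; first by rewrite sin0 mulr0.
rewrite le_eqVlt => /orP[/eqP->|x1]; first by rewrite sin_pihalf mulr1.
have der (z : R) : is_derive z (1 : R) (@sin R) (cos z) by exact: is_derive_sin.
have cont (a b : R) : {within `[a, b], continuous (@sin R)}.
  by apply: continuous_subspaceT => z; exact: continuous_sin.
have [c1 /[!in_itv]/= /andP[c10 c1x] e1] := MVT x0 (fun z _ => der z) (cont _ _).
have [c2 /[!in_itv]/= /andP[c2x c21] e2] := MVT x1 (fun z _ => der z) (cont _ _).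
move: e1 e2; rewrite sin0 !subr0 sin_pihalf => e1 e2.
have pi0 := pi_gt0 R.
have hc : cos c2 < cos c1.
  by rewrite ltr_cos ?in_itv /=; lra.
have : (1 - sin x) * x <= sin x * (pi / 2 - x).
  have h : cos c2 * ((pi / 2 - x) * x) <= cos c1 * ((pi / 2 - x) * x).
    by rewrite ler_wpM2r ?ltW // mulr_gt0 // subr_gt0.
  by rewrite e2 e1; move: h; lra.
by lra.
Qed.

Lemma jordan_norm x : `|x| <= pi / 2 -> `|x| <= pi / 2 * `|sin x|.
Proof.
move=> h; have := @jordan `|x|; rewrite h normr_ge0 => /(_ isT) /le_trans; apply.
rewrite ler_wpM2l ?divr_ge0 ?pi_ge0 //.
have [x0|x0] := leP 0 x; first by rewrite ger0_norm // ler_norm.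
by rewrite ltr0_norm // sinN -normrN ler_norm.
Qed.

(** The chord between 1 and exp(2 i pi x) has length 2 |sin (pi x)|. *)
Lemma chord_ge t k (p : int) : `|k%:R * t - p%:~R| <= 1 / 2 ->
  4 * `|k%:R * t - p%:~R| <= cabs (1 - expi (2 * pi * t) ^+ k).
Proof.
set x := k%:R * t - p%:~R => hx.
have -> : expi (2 * pi * t) ^+ k = expi (2 * (pi * x)).
  rewrite expiX -[RHS]mulr1 -(expi_2piZ p) -expiD; congr expi; rewrite /x; ring.
rewrite cabs_1Bexpi; have pi0 := pi_gt0 R.
have nx : `|pi * x| = pi * `|x| by rewrite normrM gtr0_norm.
have := @jordan_norm (pi * x); rewrite nx => h.
have : pi * `|x| <= pi * (1 / 2 * `|sin (pi * x)|).
  have -> : pi * (1 / 2 * `|sin (pi * x)|) = pi / 2 * `|sin (pi * x)| by ring.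
  by apply: h; rewrite -(ler_pM2l pi0) in hx; lra.
by rewrite ler_pM2l //; lra.
Qed.

(** The exponent of 5 is even on the left and odd on the right. *)
Lemma sqr5_neq (X p : int) : p != 0 -> X ^+ 2 != 5 * p ^+ 2.
Proof.
move=> p0; apply/eqP => h.
have : (`|X| ^ 2 = 5 * `|p| ^ 2)%N.
  by have := congr1 absz h; rewrite abszX abszM abszX.
have p0' : (0 < `|p|)%N by rewrite absz_gt0.
move/(congr1 (logn 5)); rewrite lognM ?expn_gt0 ?p0' // !lognX (_ : logn 5 5 = 1%N) //.
by move/(congr1 odd); rewrite oddD !oddM.
Qed.

Local Notation tau := (2 / (99 + Num.sqrt 5) : R).

Lemma sqrt5_bounds : [/\ (Num.sqrt 5 : R) ^+ 2 = 5, 11 / 5 < (Num.sqrt 5 : R)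
  & (Num.sqrt 5 : R) < 9 / 4].
Proof.
have s2 : (Num.sqrt 5 : R) ^+ 2 = 5 by rewrite sqr_sqrtr.
have s0 : 0 <= (Num.sqrt 5 : R) by rewrite sqrtr_ge0.
move: (Num.sqrt 5) s2 s0 => s; rewrite expr2 => s2 s0; split; first exact: s2.
  rewrite ltNge; apply/negP => h.
  have : s * s <= 11 / 5 * (11 / 5) by apply: ler_pM.
  by rewrite s2; lra.
rewrite ltNge; apply/negP => h.
have : 9 / 4 * (9 / 4) <= s * s by apply: ler_pM => //; lra.
by rewrite s2; lra.
Qed.

Lemma tau_bounds (s t : R) : 11 / 5 < s -> s < 9 / 4 -> t * (99 + s) = 2 ->
  1 / 51 < t /\ t < 1 / 50.
Proof.
move=> s_lo s_hi ts; split; rewrite ltNge; apply/negP => h.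
  have : t * (99 + s) <= 1 / 51 * (99 + s) by rewrite ler_wpM2r //; lra.
  by rewrite ts; lra.
have : 1 / 50 * (99 + s) <= t * (99 + s) by rewrite ler_wpM2r //; lra.
by rewrite ts; lra.
Qed.

(** The contradiction in [tau_approx], with K = k, P = |p| and y = |k tau - p|: if
    72 K y < 1, the norm of 2 k - 99 p - sqrt 5 p is less than 1. *)
Lemma conjugate_bound (s K P y : R) : 11 / 5 < s -> s < 9 / 4 ->
  25 < K -> 0 <= P -> P <= K * (1 / 50) + y -> 0 <= y -> 72 * K * y < 1 ->
  (99 + s) * y * ((99 + s) * y + 2 * s * P) < 1.
Proof.
move=> s_lo s_hi K25 P0 hP y0 hy.
have ykub : 25 * y <= K * y by rewrite ler_wpM2r //; lra.
have f1 : (99 + s) * y <= 102 * y by rewrite ler_wpM2r //; lra.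
have f10 : 0 <= (99 + s) * y by rewrite mulr_ge0 //; lra.
have f2 : 2 * s * P <= 9 / 2 * (K * (1 / 50) + y).
  by apply: ler_pM => //; lra.
have f20 : 0 <= 2 * s * P by rewrite mulr_ge0 //; lra.
apply: (@le_lt_trans _ _ (102 * y * (102 * y + 9 / 2 * (K * (1 / 50) + y)))).
  by apply: ler_pM => //; lra.
have z2 : y < 1 / 200 by lra.
have z3 : y * y <= 1 / 200 * y by rewrite ler_wpM2r // ltW.
have -> : 102 * y * (102 * y + 9 / 2 * (K * (1 / 50) + y)) =
  (102 * 102 + 102 * 9 / 2) * (y * y) + 102 * 9 / 2 * (1 / 50) * (K * y).
  by ring.
by lra.
Qed.

(** tau is a root of 2449 X^2 - 99 X + 1, whose discriminant is 5. With
    X = 2 k - 99 p, the integer X^2 - 5 p^2 is nonzero, so at least 1 in modulus,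
    and it is the product of X - sqrt 5 p = (99 + sqrt 5) (k tau - p) with a
    conjugate of size 2 sqrt 5 |p|, about k / 11. *)
Lemma tau_approx k (p : int) : (0 < k)%N -> `|k%:R * tau - p%:~R| <= 1 / 2 ->
  1 <= 72 * k%:R * `|k%:R * tau - p%:~R|.
Proof.
move=> k0; have [s2 s_lo s_hi] := sqrt5_bounds.
have : tau * (99 + Num.sqrt 5) = 2 by rewrite divfK // gt_eqF //; lra.
move: (Num.sqrt 5) s2 s_lo s_hi tau => s s2 s_lo s_hi t ts hx0.
have [t_lo t_hi] := tau_bounds s_lo s_hi ts.
move: hx0; set x := k%:R * _ - _ => hx.
have kR1 : (1 : R) <= k%:R by rewrite ler1n.
pose X := 2 * k%:R - 99 * p%:~R : R.
have Xm : X - s * p%:~R = (99 + s) * x.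
  by rewrite /X /x mulrBr mulrCA -[(99 + s) * t]mulrC ts; ring.
have Xp : X + s * p%:~R = (99 + s) * x + 2 * s * p%:~R by rewrite -Xm; ring.
have norm1 : 1 <= `|X ^+ 2 - 5 * p%:~R ^+ 2|.
  have -> : X ^+ 2 - 5 * p%:~R ^+ 2 = (((2 * k%:Z - 99 * p) ^+ 2 - 5 * p ^+ 2)%R)%:~R :> R.
    by rewrite /X !(rmorphB, rmorphM, rmorphXn, rmorph_nat) /=.
  rewrite -intr_norm ler1z -gtz0_ge1 normr_gt0 subr_eq0.
  have [->|p0] := eqVneq p 0; last exact: sqr5_neq.
  by rewrite expr0n /= !mulr0 !subr0 sqrf_eq0 mulf_eq0 /= eqz_nat -lt0n.
have t0 : 0 < t by apply: lt_trans t_lo; rewrite divr_gt0.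
rewrite leNgt; apply/negP => hlt.
have [p0|p0] := eqVneq p 0.
  have xE : x = k%:R * t by rewrite /x p0 subr0.
  have tx : t <= `|x| by rewrite xE normrM (gtr0_norm t0) ler_peMl ?(ltW t0) // normr_nat.
  have : 72 * `|x| <= 72 * k%:R * `|x| by rewrite ler_wpM2r // ler_peMr.
  by move: hlt tx t_lo; clear; move: `|x| (72 * k%:R * `|x|) => ? ?; lra.
have P1 : 1 <= `|p%:~R : R|.
  by rewrite -intr_norm ler1z -gtz0_ge1 normr_gt0.
have xr : k%:R * t = x + p%:~R by rewrite /x subrK.
have kt0 : 0 < k%:R * t by rewrite mulr_gt0 // (lt_le_trans ltr01).
have pk : `|p%:~R : R| <= k%:R * t + `|x|.
  by rewrite -[p%:~R](addKr x) -xr addrC (le_trans (ler_normB _ _)) // gtr0_norm.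
have k25 : 25 < k%:R :> R.
  rewrite ltNge; apply/negP => k25.
  have : k%:R * t <= 25 * t by rewrite ler_wpM2r // ltW.
  move: pk P1 hx t_hi; clear; move: `|x| `|p%:~R| (k%:R * t) => ? ? ?; lra.
have pk2 : `|p%:~R : R| <= k%:R * (1 / 50) + `|x|.
  by apply: le_trans pk _; rewrite lerD2r ler_wpM2l // ltW.
have s99 : `|99 + s| = 99 + s.
  by rewrite gtr0_norm // addr_gt0 // (lt_trans _ s_lo) // divr_gt0.
have := conjugate_bound s_lo s_hi k25 (normr_ge0 _) pk2 (normr_ge0 x) hlt.
apply/negP; rewrite -leNgt; apply: le_trans norm1 _.
rewrite -s2 (_ : X ^+ 2 - _ = (X - s * p%:~R) * (X + s * p%:~R)); last by ring.
rewrite normrM Xm normrM s99; apply: ler_wpM2l; first by rewrite -s99 mulr_ge0.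
rewrite Xp; apply: le_trans (ler_normD _ _) _; rewrite 2!normrM s99 lerD2l normrM.
by rewrite ler_wpM2r // !ger0_norm // (le_trans _ (ltW s_lo)) // divr_ge0.
Qed.

Lemma dioph_tau : dioph (expi (2 * pi * tau)) (18 : R).
Proof.
move=> k k0; pose p : int := Num.floor (k%:R * tau + 1 / 2).
have hp : `|k%:R * tau - p%:~R| <= 1 / 2.
  have := real_floor_le (num_real (k%:R * tau + 1 / 2)); have := real_floorD1_gt (num_real (k%:R * tau + 1 / 2)).
  rewrite -/p intrD ler_norml; lra.
have := tau_approx k0 hp; have := chord_ge hp.
move: (cabs _) (`|_ - _|) => a b h1 h2; apply: (le_trans h2).
have : 18 * k%:R * (4 * b) <= 18 * k%:R * a by rewrite ler_wpM2l.
lra.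
Qed.

End Angle.

(** * Cauchy products *)

Section Convolution.
Variable R : realType.
Local Notation C := (R[i] : numFieldType).
Implicit Types (z w x : C) (a b : nat -> C).

Definition conv a b k : C := \sum_(i < k.+1) a i * b (k - i)%N.

Lemma power_series_poly a z n : power_series a z n = (\poly_(i < n) a i).[z].
Proof.
rewrite /power_series /series /= big_mkord (horner_coef_wide _ (size_poly _ _)).
by apply: eq_bigr => i _; rewrite coef_poly ltn_ord.
Qed.

Section Bounds.
Variables (a b : nat -> C) (Ma Mb r s : R).
Hypotheses (r0 : 0 < r) (rs : r < s).
Hypotheses (ha : geo_bounded a Ma r) (hb : geo_bounded b Mb r).

Local Notation B := (Ma * Mb / (1 - r / s)).

Let s0 : 0 < s. Proof. exact: lt_trans rs. Qed.
Let Ma0 : 0 <= Ma. Proof. exact: geo_bounded_ge0 ha. Qed.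
Let Mb0 : 0 <= Mb. Proof. exact: geo_bounded_ge0 hb. Qed.

Lemma conv_sum_bound (a' b' : nat -> C) k :
  (forall i, cabs (a' i) <= Ma * r ^+ i) -> (forall i, cabs (b' i) <= Mb * r ^+ i) ->
  cabs (\sum_(i < k.+1) a' i * b' (k - i)%N) <= B * s ^+ k.
Proof.
move=> ha' hb'; apply: le_trans (cabs_sum _ _ _) _.
apply: (@le_trans _ _ (\sum_(i < k.+1) Ma * Mb * r ^+ k)).
  apply: ler_sum => i _; rewrite cabsM.
  have -> : Ma * Mb * r ^+ k = (Ma * r ^+ i) * (Mb * r ^+ (k - i)).
    by rewrite -{1}(subnKC (ltn_ord i : (i <= k)%N)) exprD; ring.
  by apply: ler_pM; rewrite ?cabs_ge0.
rewrite sumr_const card_ord -mulr_natl.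
have x0 : 0 <= r / s by rewrite divr_ge0 // ltW.
have x1 : r / s < 1 by rewrite ltr_pdivrMr // mul1r.
have -> : k.+1%:R * (Ma * Mb * r ^+ k) = Ma * Mb * (k.+1%:R * (r / s) ^+ k) * s ^+ k.
  by rewrite expr_div_n; field; rewrite expf_neq0 // gt_eqF.
rewrite ler_wpM2r ?exprn_ge0 ?(ltW s0) // ler_wpM2l ?mulr_ge0 //.
exact: geo_mulS_le.
Qed.

Lemma conv_geo_bounded : geo_bounded (conv a b) B s.
Proof. by move=> k; apply: conv_sum_bound. Qed.

(** Up to degree n the convolution agrees with the product of the truncated
    series, so the difference consists of the terms of degree n to 2 n of a
    product of two polynomials. The constants depend on the majorants of a and b
    alone, which makes this uniform in families of series. *)
Lemma conv_partial_le z t n : s * cabs z <= t -> t < 1 ->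
  cabs (power_series (conv a b) z n - power_series a z n * power_series b z n)
  <= B * t ^+ n / (1 - t).
Proof.
move=> st t1; have t0 : 0 <= t by rewrite (le_trans _ st) // mulr_ge0 ?cabs_ge0 // ltW.
pose pa := \poly_(i < n) a i; pose pb := \poly_(i < n) b i.
have bnd (c : nat -> C) (M : R) i : geo_bounded c M r -> cabs (\poly_(i < n) c i)`_i <= M * r ^+ i.
  move=> hc; rewrite coef_poly; case: ifP => _ //.
  by rewrite cabs0 mulr_ge0 ?exprn_ge0 ?(geo_bounded_ge0 hc) // ltW.
have sz : (size (pa * pb)%R <= n + n)%N.
  apply: leq_trans (size_polyMleq _ _) _.
  have := size_poly n a; have := size_poly n b; rewrite -/pa -/pb; lia.
rewrite !power_series_poly -hornerM (horner_coef_wide _ sz) -/pa -/pb.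
rewrite (horner_coef_wide _ (size_poly _ _)).
rewrite [X in _ - X]big_split_ord /= opprD addrA.
have -> : \sum_(i < n) (\poly_(j < n) conv a b j)`_i * z ^+ i =
   \sum_(i < n) (pa * pb)`_i * z ^+ i.
  apply: eq_bigr => i _; rewrite coef_poly ltn_ord coefM; congr (_ * _).
  apply: eq_bigr => j _; rewrite !coef_poly.
  have ji := ltn_ord j; have jn : (j < n)%N by have := ltn_ord i; lia.
  by rewrite jn (leq_ltn_trans (leq_subr _ _) (ltn_ord i)).
rewrite subrr sub0r cabsN; apply: le_trans (cabs_sum _ _ _) _.
have B0 : 0 <= B.
  by rewrite divr_ge0 ?mulr_ge0 // subr_ge0 ler_pdivrMr // mul1r ltW.
apply: (@le_trans _ _ (\sum_(i < n) B * t ^+ (n + i))).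
  apply: ler_sum => i _; rewrite cabsM cabsX.
  apply: (@le_trans _ _ (B * s ^+ (n + i) * cabs z ^+ (n + i))).
    rewrite ler_wpM2r ?exprn_ge0 ?cabs_ge0 // coefM.
    by apply: (@conv_sum_bound (fun i => pa`_i) (fun i => pb`_i)) => j; apply: bnd.
  rewrite -[leLHS]mulrA -exprMn ler_wpM2l // lerXn2r // nnegrE.
  by rewrite mulr_ge0 ?cabs_ge0 // ltW.
rewrite -mulr_sumr -[leRHS]mulrA ler_wpM2l //.
rewrite (eq_bigr (fun i : (ordinal n) => t ^+ n * t ^+ i)); last by move=> i _; rewrite exprD.
rewrite -mulr_sumr ler_wpM2l ?exprn_ge0 //.
have := geo_sum_le 0 n t0 t1; rewrite big_mkord expr0 div1r; exact.
Qed.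

Lemma psum_conv z : s * cabs z < 1 -> psum (conv a b) z = psum a z * psum b z.
Proof.
move=> sz; have t0 : 0 <= s * cabs z by rewrite mulr_ge0 ?cabs_ge0 // ltW.
have rz : r * cabs z < 1.
  by apply: le_lt_trans sz; rewrite ler_wpM2r ?cabs_ge0 // ltW.
apply: (@cvg_uniqC _ (fun n => power_series (conv a b) z n)).
  by apply: (psum_cvg (ltW s0) conv_geo_bounded sz).
have -> : (fun n => power_series (conv a b) z n) =
  (fun n => power_series a z n * power_series b z n +
    (power_series (conv a b) z n - power_series a z n * power_series b z n)).
  by apply/funext => n; rewrite addrC subrK.
rewrite -[psum a z * _]addr0; apply: cvgD.
  by apply: cvgM; [apply: (psum_cvg (ltW r0) ha rz) | apply: (psum_cvg (ltW r0) hb rz)].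
apply: cvg_cabs => e e0; have [N hN] := geo_small (B / (1 - s * cabs z)) t0 sz e0.
exists N => n /hN; apply: le_trans; rewrite sub0r cabsN.
by apply: (le_trans (conv_partial_le n (lexx _) sz)); rewrite mulrAC.
Qed.

End Bounds.

End Convolution.

(** * The Rogers-Ramanujan function *)

Section RogersRamanujanSeries.
Variable R : realType.
Local Notation C := (R[i] : numFieldType).
Variables (q : C) (A : R).
Hypotheses (hq : cabs q = 1) (hA : dioph q A).
Local Notation c := (RR_coef q).

Let q1 k : (0 < k)%N -> 1 - q ^+ k != 0. Proof. exact: dioph_neq0 hA k. Qed.

Lemma cabs_q_pow n : cabs (q ^+ n) = 1.
Proof. by rewrite cabsX hq expr1n. Qed.

Let q0 : q != 0. Proof. by rewrite -cabs_eq0 hq oner_eq0. Qed.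

Lemma RR_coefE n : c n = q ^+ (n ^ 2) * (qpoch q n)^-1.
Proof. by []. Qed.

Lemma cabs_RR_coef n : cabs (c n) = cabs (qpoch q n)^-1.
Proof. by rewrite RR_coefE cabsM cabs_q_pow mul1r. Qed.

Lemma RR_coef0 : c 0%N = 1.
Proof. by rewrite RR_coefE qpoch0 invr1 mulr1. Qed.

Lemma RR_coefS n : c n.+1 * (1 - q ^+ n.+1) = q ^+ (2 * n).+1 * c n.
Proof.
rewrite !RR_coefE -mulrA (qpochV_rec q1) mulrA -exprD; congr (q ^+ _ * _).
by rewrite -!mulnn; lia.
Qed.

Lemma RR_subexp : subexp c.
Proof.
move=> r r1; have [M hM] := qpochV_subexp hA r1.
by exists M => n; rewrite cabs_RR_coef.
Qed.

Local Transparent psum.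

Lemma RR_GE z : RR_G q z = psum c z.
Proof. by []. Qed.

Local Opaque psum RR_G.

Lemma RR_G0 : RR_G q 0 = 1.
Proof.
by rewrite RR_GE psum_recl ?cabs0 // ?mul0r ?addr0 ?RR_coef0 //; exact: RR_subexp.
Qed.

Lemma cabs_qM z : cabs (q * z) = cabs z.
Proof. by rewrite cabsM hq mul1r. Qed.

Lemma cabs_qXM n z : cabs (q ^+ n * z) = cabs z.
Proof. by rewrite cabsM cabs_q_pow mul1r. Qed.

(** The q-difference equation behind the continued fraction. *)
Lemma RR_G_rec z : cabs z < 1 ->
  RR_G q z = RR_G q (q * z) + q * z * RR_G q (q ^+ 2 * z).
Proof.
move=> z1; have hc := RR_subexp; rewrite !RR_GE.
apply: (@cvg_uniqC _ (fun n => power_series c z n.+1)).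
  by have := subexp_psum_cvg hc z1; rewrite -cvg_shiftS.
have -> : (fun n => power_series c z n.+1) = (fun n => power_series c (q * z) n.+1 +
    q * z * power_series c (q ^+ 2 * z) n).
  apply/funext; elim => [|n IH].
    by rewrite /power_series /series /= !big_nat1 big_geq // !expr0 mulr0 addr0.
  rewrite (power_seriesS c z n.+1) (power_seriesS c (q * z) n.+1) IH (power_seriesS c (q ^+ 2 * z) n).
  have -> : c n.+1 * z ^+ n.+1 = (c n.+1 * q ^+ n.+1 + q ^+ (2 * n).+1 * c n) * z ^+ n.+1.
    by rewrite -RR_coefS; ring.
  have -> : (q ^+ 2 * z) ^+ n = q ^+ (2 * n) * z ^+ n by rewrite exprMn exprM.
  by rewrite exprMn [q ^+ (2 * n).+1]exprS [z ^+ n.+1]exprS; ring.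
apply: cvgD.
  by have := subexp_psum_cvg (z := q * z) hc; rewrite -cvg_shiftS cabs_qM; exact.
by apply: cvgMr; apply: subexp_psum_cvg => //; rewrite cabs_qXM.
Qed.

(** The solution of L(z) - L(q z) = G(z) - 1; the small divisors 1 - q^n cost only
    a factor A n. *)
Definition coboundary n : C := if n is 0%N then 0 else c n / (1 - q ^+ n).

Lemma coboundary_subexp : subexp coboundary.
Proof.
move=> r r1.
have [s s1 sr] : exists2 s, 1 < s & s < r by exists ((1 + r) / 2); lra.
have [M hM] := RR_subexp s1; have M0 := geo_bounded_ge0 hM.
have A0 : 0 <= A by have := le_trans (cabs_ge0 _) (dioph_inv hA (ltn0Sn 0)); rewrite mulr1.
have x0 : 0 <= s / r by rewrite divr_ge0 //; lra.
have x1 : s / r < 1 by rewrite ltr_pdivrMr; lra.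
exists (M * A / (1 - s / r)) => -[|n].
  by rewrite cabs0 expr0 mulr1 divr_ge0 ?mulr_ge0 // subr_ge0 ltW.
rewrite [coboundary _]/= cabsM.
apply: (le_trans (ler_pM (cabs_ge0 _) (cabs_ge0 _) (hM _) (dioph_inv hA (ltn0Sn n)))).
have h : n.+1%:R * (s / r) ^+ n.+1 <= (1 - s / r)^-1.
  by apply: le_trans (geo_mulS_le n.+1 x0 x1); rewrite ler_wpM2r ?exprn_ge0 // ler_nat.
have -> : M * s ^+ n.+1 * (A * n.+1%:R) = M * A * (n.+1%:R * (s / r) ^+ n.+1) * r ^+ n.+1.
  have rn : r ^+ n.+1 != 0 by rewrite expf_neq0 // gt_eqF //; lra.
  by rewrite expr_div_n; field.
rewrite ler_wpM2r ?exprn_ge0 //; first lra.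
by rewrite ler_wpM2l ?mulr_ge0.
Qed.

Lemma coboundaryE z : cabs z < 1 ->
  psum coboundary z - psum coboundary (q * z) = RR_G q z - 1.
Proof.
move=> z1; have hc := RR_subexp; have hl := coboundary_subexp.
apply: (@cvg_uniqC _ (fun n => power_series coboundary z n.+1 - power_series coboundary (q * z) n.+1)).
  apply: cvgB; first by have := subexp_psum_cvg hl z1; rewrite -cvg_shiftS.
  by have := subexp_psum_cvg (z := q * z) hl; rewrite -cvg_shiftS cabs_qM; exact.
have -> : (fun n => power_series coboundary z n.+1 - power_series coboundary (q * z) n.+1)
   = (fun n => power_series c z n.+1 - 1).
  apply/funext; elim => [|n IH].
    by rewrite /power_series /series /= !big_nat1 RR_coef0 !expr0 !mul0r mulr1 !subrr.
  have hn : coboundary n.+1 * (1 - q ^+ n.+1) = c n.+1 by rewrite divfK // q1.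
  rewrite (power_seriesS c z n.+1) [RHS]addrAC -IH !(power_seriesS coboundary _ n.+1) -hn.
  by move: (coboundary n.+1) => l; rewrite exprMn; ring.
apply: (@cvgB _ _ _ _ _ (fun n => power_series c z n.+1) (fun=> 1)); last exact: cvg_cst.
by have := subexp_psum_cvg hc z1; rewrite -cvg_shiftS.
Qed.

(** By the q-difference equation, a common zero of G(z) and G(q z) gives
    G(q^n x) = 0 for all n. Along this orbit the coboundary equation
    L(z) - L(q z) = G(z) - 1 makes L grow by 1 at each step, although the orbit
    stays on a circle, where L is bounded. *)
Lemma RR_G_no_common_zero x : cabs x < 1 -> RR_G q x = 0 -> RR_G q (q * x) != 0.
Proof.
move=> x1 g0; apply/eqP => g1.
have gn n : RR_G q (q ^+ n * x) = 0 /\ RR_G q (q ^+ n.+1 * x) = 0.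
  elim: n => [|n [IH1 IH2]]; first by rewrite expr0 expr1 mul1r.
  split; first exact: IH2.
  have := @RR_G_rec (q ^+ n * x).
  rewrite cabs_qXM !mulrA -exprS -exprD => /(_ x1).
  rewrite IH1 IH2 add0r => /esym/eqP; rewrite mulf_eq0 => /orP[|/eqP //].
  rewrite mulf_eq0 (negPf (expf_neq0 _ q0)) /= => /eqP x00.
  exfalso; move: (oner_neq0 C); rewrite -RR_G0 -{1}x00 g0; clear.
  by rewrite eqxx.
have ln n : psum coboundary (q ^+ n * x) = psum coboundary x + n%:R.
  elim: n => [|n IH]; first by rewrite expr0 mul1r addr0.
  have := @coboundaryE (q ^+ n * x); rewrite cabs_qXM => /(_ x1).
  rewrite (gn n).1 mulrA -exprS IH sub0r => h.
  have := congr1 -%R h; rewrite opprB opprK => /(canRL (subrK _)) ->.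
  by rewrite -natr1; ring.
have [B B0 hB] := psum_bounded coboundary_subexp x1.
pose n := Num.bound (B + B).
have hn : B + B < n%:R.
  by have := archi_boundP (addr_ge0 (ltW B0) (ltW B0)).
have h1 := hB (q ^+ n * x); have h2 := hB x (lexx _).
move: h1; rewrite cabs_qXM => /(_ (lexx _)); rewrite ln => h1.
have := lerB_cabs (n%:R) (- psum coboundary x).
by rewrite cabsN opprK addrC cabs_nat [n%:R + _]addrC; lra.
Qed.

End RogersRamanujanSeries.

(** * The meromorphic quotient *)

Section Poles.
Variable R : realType.
Local Notation C := (R[i] : numFieldType).
Implicit Types (f g h : C -> C) (x : C).

Lemma punctured_near (P : C -> Prop) x : P x ->
  (exists2 e : R, 0 < e & forall z, z != x -> cabs (z - x) < e -> P z) ->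
  exists2 e : R, 0 < e & forall z, cabs (z - x) < e -> P z.
Proof.
move=> Px [e e0 he]; exists e => // z hz.
by have [->|zx] := eqVneq z x; [|exact: he].
Qed.

(** The filter of positive infinity on R[i] is generated by the upper sets of
    real numbers, which is why a bound is found through the real part. *)
Lemma quotient_to_pinfty f g x : cont_at f x -> cont_at g x -> f x != 0 -> g x = 0 ->
  (exists2 e : R, 0 < e & forall z, z != x -> cabs (z - x) < e -> g z != 0) ->
  `|f z / g z| @[z --> x^'] --> +oo.
Proof.
move=> fc gc fx gx [e e0 he] P [m [mr hP]]; apply/dnear_cabs.
have f0 : 0 < cabs (f x) by rewrite cabs_gt0.
pose M := `|complex.Re m| + 1; have M0 : 0 < M by rewrite ltr_wpDl.
have hM : 0 < cabs (f x) / 2 / M by rewrite !divr_gt0.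
have f2 : 0 < cabs (f x) / 2 by rewrite divr_gt0.
have [d1 d10 hd1] := fc _ f2.
have [d2 d20 hd2] := cont_at_near gc hM.
exists (Num.min e (Num.min d1 d2)) => [|z zx]; first by rewrite !lt_min e0 d10 d20.
rewrite !lt_min => /and3P[/(he z zx) gz /hd1 b1 /hd2]; rewrite gx subr0 => b2.
apply: hP; have {b1}b1 : cabs (f x) / 2 <= cabs (f z).
  by have := lerB_cabs (f x) (f z); rewrite cabsB; move: b1; lra.
rewrite cabsE -(RRe_real mr) ltcR; apply: (@lt_le_trans _ _ M).
  by rewrite (le_lt_trans (ler_norm _)) // ltrDl.
rewrite cabs_div ler_pdivlMr ?cabs_gt0 //; apply: le_trans b1.
by move: b2; rewrite ltr_pdivlMr // mulrC => /ltW.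
Qed.

(** A pole is a limit statement on the punctured neighbourhood, so agreement
    with a function that is continuous at x excludes it. *)
Lemma cont_not_pole h f x : cont_at f x ->
  (exists2 e : R, 0 < e & forall z, cabs (z - x) < e -> h z = f z) -> ~ is_pole h x.
Proof.
move=> fc [e e0 he] [_ hoo]; have [d d0 hd] := fc _ ltr01.
pose B := cabs (f x) + 1.
have /dnear_cabs[d' d'0 hd'] : \forall z \near x^', B%:C < `|h z|.
  apply: (hoo [set y : C | B%:C < y]).
  by exists B%:C; split => //; apply/complex_realP; exists B.
pose k := Num.min (Num.min e d) d' / 2.
have m0 : 0 < Num.min (Num.min e d) d' by rewrite !lt_min e0 d0.
have k0 : 0 < k by rewrite divr_gt0.
have : k < Num.min (Num.min e d) d' by rewrite /k ltr_pdivrMr // ltr_pMr // ltr1n.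
rewrite !lt_min => /andP[/andP[ke kd] kd'].
pose z := x + k%:C.
have zx : cabs (z - x) = k by rewrite /z addrAC subrr add0r cabs_real gtr0_norm.
have zn : z != x by rewrite -subr_eq0 -cabs_eq0 zx gt_eqF.
have := hd' z zn; rewrite zx => /(_ kd'); rewrite cabsE ltcR he ?zx //.
have := hd z; rewrite zx => /(_ kd); have := lerB_cabs (f z) (f x).
by rewrite /B; lra.
Qed.

End Poles.

Section Meromorphic.
Variable R : realType.
Local Notation C := (R[i] : numFieldType).
Variables (q : C) (A : R).
Hypotheses (hq : cabs q = 1) (hA : dioph q A).
Local Notation c := (RR_coef q).
Local Notation G := (RR_G q).
Local Notation H0 := (fun z : C => G z / G (q * z)).

Lemma RR_dom_disc z : cabs z < 1 -> RR_dom q z.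
Proof.
move=> z1; apply/(near_cabs z (fun w => cvgn (power_series c w))).
exists (1 - cabs z) => [|w hw]; first by lra.
have w1 : cabs w < 1 by rewrite -[w](subrK z); have := cabsD (w - z) z; lra.
by apply/cvg_ex; exists (psum c w); exact: (subexp_psum_cvg (RR_subexp hq hA)).
Qed.

(** The Taylor coefficients at 0 of the denominator G(q z) of H. *)
Definition RR_coefq n : C := c n * q ^+ n.

Lemma RR_coefq_subexp : subexp RR_coefq.
Proof.
move=> r r1; have [M hM] := RR_subexp hq hA r1; exists M => n.
by rewrite cabsM cabs_q_pow // mulr1.
Qed.

Lemma psum_coefq z : psum RR_coefq z = G (q * z).
Proof.
rewrite RR_GE; apply: eq_psum => n.
by apply: eq_bigr => i _; rewrite /RR_coefq exprMn; ring.
Qed.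

Lemma G_q_isolated x : cabs x < 1 ->
  exists2 e : R, 0 < e & forall z, z != x -> cabs (z - x) < e -> cabs z < 1 /\ G (q * z) != 0.
Proof.
move=> x1; have c0 : RR_coefq 0 != 0 by rewrite /RR_coefq RR_coef0 mul1r oner_eq0.
have [e e0 he] := psum_zero_isolated RR_coefq_subexp c0 x1.
exists (Num.min e (1 - cabs x)) => [|z zx]; first by rewrite lt_min e0 subr_gt0.
rewrite lt_min => /andP[h1 h2]; rewrite -psum_coefq; split; last exact: he.
by rewrite -[z](subrK x); have := cabsD (z - x) x; lra.
Qed.

Lemma G_q_near x : cabs x < 1 -> G (q * x) != 0 ->
  exists2 e : R, 0 < e & forall z, cabs (z - x) < e -> cabs z < 1 /\ G (q * z) != 0.
Proof. by move=> x1 gx; exact: (punctured_near (conj x1 gx) (G_q_isolated x1)). Qed.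

Lemma H0_derivable z : cabs z < 1 -> G (q * z) != 0 -> derivable (H0 : C^o -> C^o) z 1.
Proof.
move=> z1 gz.
have -> : H0 = (fun z => psum c z * (psum RR_coefq z)^-1).
  by apply/funext => w; rewrite psum_coefq RR_GE.
apply: derivableM; first exact: (psum_derivable (RR_subexp hq hA)).
apply: derivableV; first by rewrite psum_coefq.
exact: (psum_derivable RR_coefq_subexp).
Qed.

Lemma H0_holomorphic x : cabs x < 1 -> G (q * x) != 0 -> holomorphic_at H0 x.
Proof.
move=> x1 gx; have [e e0 he] := G_q_near x1 gx.
apply/near_cabs; exists e => // z /he[z1 gz]; exact: H0_derivable.
Qed.

Lemma RR_G_cont x : cabs x < 1 -> cont_at G x.
Proof.
have -> : G = psum c by apply/funext => w; rewrite RR_GE.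
exact: (psum_cont (RR_subexp hq hA)).
Qed.

Lemma RR_Gq_cont x : cabs x < 1 -> cont_at (fun z => G (q * z)) x.
Proof.
have -> : (fun z => G (q * z)) = psum RR_coefq by apply/funext => w; rewrite psum_coefq.
exact: (psum_cont RR_coefq_subexp).
Qed.

Lemma H0_pole x : cabs x < 1 -> G (q * x) = 0 -> is_pole H0 x.
Proof.
move=> x1 gx; have [e e0 he] := G_q_isolated x1; split.
  by apply/dnear_cabs; exists e => // z zx /(he _ zx)[z1 gz]; exact: H0_derivable.
apply: (quotient_to_pinfty (RR_G_cont x1) (RR_Gq_cont x1) _ gx); last first.
  by exists e => // z zx /(he _ zx)[].
by apply/eqP => h; have := RR_G_no_common_zero hq hA x1 h; rewrite gx eqxx.
Qed.

Lemma H0_is_RR_H : is_RR_H q [set z : C | `|z| < 1] H0.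
Proof.
split; first by apply: RR_dom_disc; rewrite cabs0.
  move=> x /=; rewrite -[1]/((1 : R)%:C) lt_cabs => x1.
  have [gx|gx] := eqVneq (G (q * x)) 0; first by right; exact: H0_pole.
  by left; exact: H0_holomorphic.
by [].
Qed.

Section Continuation.
Variable H : C -> C.
Hypothesis hH : is_RR_H q [set z : C | `|z| < 1] H.

Lemma RR_HE z : cabs z < 1 -> G (q * z) != 0 -> H z = G z / G (q * z).
Proof.
move=> z1 gz; case: hH => _ _; apply=> //; last exact: RR_dom_disc.
by rewrite /= -[1]/((1 : R)%:C) lt_cabs.
Qed.

Lemma RR_H_not_pole x : cabs x < 1 -> G (q * x) != 0 -> ~ is_pole H x.
Proof.
move=> x1 gx; apply: (cont_not_pole (derivable_cont (H0_derivable x1 gx))).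
have [e e0 he] := G_q_near x1 gx; exists e => // z /he[]; exact: RR_HE.
Qed.

End Continuation.
End Meromorphic.

(** * Formal power series *)

Section FormalSeries.
Variable R : realType.
Local Notation C := (R[i] : numFieldType).
Implicit Types (a b c d h : nat -> C).

(** Convolution is polynomial multiplication in low degree, which transfers
    commutativity and associativity. *)
Lemma conv_poly a b N k : (k < N)%N ->
  conv a b k = (\poly_(i < N) a i * \poly_(i < N) b i)`_k.
Proof.
move=> kN; rewrite coefM; apply: eq_bigr => i _; rewrite !coef_poly.
by rewrite (leq_trans (ltn_ord i)) // (leq_ltn_trans (leq_subr _ _)).
Qed.

Lemma convC a b : conv a b =1 conv b a.
Proof. by move=> k; rewrite !(@conv_poly _ _ k.+1) // mulrC. Qed.

Lemma eq_conv a a' b b' k : (forall i, (i <= k)%N -> a i = a' i) ->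
  (forall i, (i <= k)%N -> b i = b' i) -> conv a b k = conv a' b' k.
Proof.
move=> ea eb; apply: eq_bigr => i _.
by rewrite ea ?eb ?leq_subr // -ltnS.
Qed.

Lemma convA a b c : conv a (conv b c) =1 conv (conv a b) c.
Proof.
move=> k; have coefs (u v : nat -> C) i : (i < k.+1)%N ->
    (\poly_(j < k.+1) conv u v j)`_i = (\poly_(j < k.+1) u j * \poly_(j < k.+1) v j)`_i.
  by move=> ik; rewrite coef_poly ik; exact: conv_poly.
rewrite !(@conv_poly _ _ k.+1) // !coefM.
under eq_bigr => i _ do rewrite coefs ?ltnS ?leq_subr //.
under [RHS]eq_bigr => i _ do rewrite coefs ?ltn_ord //.
by rewrite -!coefM mulrA.
Qed.

(** The first n coefficients of the formal quotient a / b when b 0 = 1; the list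
    makes the course-of-values recursion structural. *)
Fixpoint quo_list (a b : nat -> C) n : seq C :=
  if n is m.+1 then
    let s := quo_list a b m in rcons s (a m - \sum_(i < m) s`_i * b (m - i)%N)
  else [::].

Definition quo a b n : C := (quo_list a b n.+1)`_n.

Lemma size_quo_list a b n : size (quo_list a b n) = n.
Proof. by elim: n => //= n IH; rewrite size_rcons IH. Qed.

Lemma nth_quo_list a b n i : (i < n)%N -> (quo_list a b n)`_i = quo a b i.
Proof.
elim: n => // n IH; rewrite ltnS leq_eqVlt => /orP[/eqP-> //|ltin].
by rewrite /= nth_rcons size_quo_list ltin IH.
Qed.

Lemma quoE a b n : quo a b n = a n - \sum_(i < n) quo a b i * b (n - i)%N.
Proof.
rewrite {1}/quo /= nth_rcons size_quo_list ltnn eqxx; congr (_ - _).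
by apply: eq_bigr => i _; rewrite nth_quo_list.
Qed.

Lemma conv_quo a b : b 0%N = 1 -> conv (quo a b) b =1 a.
Proof.
by move=> b0 n; rewrite /conv big_ord_recr /= subnn b0 mulr1 [quo a b n]quoE addrC subrK.
Qed.

(** The radius shrinks from 1/r to 1/(r (M + 1)): the recursion sums a geometric
    progression of ratio M + 1. *)
Lemma quo_geo_bounded a b (M r : R) : 0 < r -> geo_bounded a M r -> geo_bounded b M r ->
  geo_bounded (quo a b) M (r * (M + 1)).
Proof.
move=> r0 ha hb; have M0 := geo_bounded_ge0 ha.
move=> n; have [m] := ubnP n; elim: m => // m IH in n * => nm.
rewrite quoE; apply: le_trans (cabsD _ _) _; rewrite cabsN.
apply: (@le_trans _ _ (M * r ^+ n + \sum_(i < n) M * (r * (M + 1)) ^+ i * (M * r ^+ (n - i)))).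
  apply: lerD; first exact: ha.
  apply: le_trans (cabs_sum _ _ _) _; apply: ler_sum => i _; rewrite cabsM.
  by apply: ler_pM; rewrite ?cabs_ge0 //; apply: IH; have := ltn_ord i; lia.
have -> : \sum_(i < n) M * (r * (M + 1)) ^+ i * (M * r ^+ (n - i)) =
    M * r ^+ n * (M * \sum_(i < n) (M + 1) ^+ i).
  rewrite !mulr_sumr; apply: eq_bigr => i _; rewrite exprMn.
  have -> : r ^+ n = r ^+ i * r ^+ (n - i) by rewrite -exprD subnKC // ltnW.
  by ring.
have -> : M * \sum_(i < n) (M + 1) ^+ i = (M + 1) ^+ n - 1.
  by rewrite subrX1 addrK.
by rewrite exprMn le_eqVlt; apply/orP; left; apply/eqP; ring.
Qed.

Lemma psum_eq0_coef0 d (M r e : R) : 0 < r -> geo_bounded d M r -> 0 < e ->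
  (forall z, z != 0 -> cabs z < e -> psum d z = 0) -> d 0%N = 0.
Proof.
have aux (N x t : R) : 0 <= t -> 0 < x -> x <= 1 / 2 -> x * (2 * (N + 1)) <= t -> N * x <= t * (1 - x).
  move=> t0 x0 x2 h; have : t * x <= t * (1 / 2) by rewrite ler_wpM2l.
  by lra.
move=> r0 hd e0 hz; apply/eqP; rewrite -cabs_eq0; apply/eqP/le_anti; rewrite cabs_ge0 andbT.
apply/ler_addgt0Pr => t t0; rewrite add0r.
have M0 := geo_bounded_ge0 hd; have M1 : 0 < 2 * (M + 1) by rewrite mulr_gt0 // ltr_wpDl.
have [x [x0 x1 x2 x3]] : exists x : R, [/\ 0 < x, x <= 1 / 2, x < e * r & x * (2 * (M + 1)) <= t].
  pose m := Num.min (1 / 2) (Num.min (e * r / 2) (t / (2 * (M + 1)))).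
  exists m; have : m <= m by []; rewrite {2}/m !le_min => /and3P[m1 m2 m3]; split => //.
  - by rewrite !lt_min; apply/and3P; split; rewrite divr_gt0 // mulr_gt0.
  - by apply: (le_lt_trans m2); rewrite ltr_pdivrMr // ltr_pMr ?mulr_gt0 // ltr1n.
  - by rewrite -ler_pdivlMr.
pose z : C := (x / r)%:C; have zx : cabs z = x / r by rewrite cabs_real gtr0_norm // divr_gt0.
have rz : r * cabs z <= x by rewrite zx mulrCA divff ?gt_eqF // mulr1.
have x11 : x < 1 by lra.
have := psum_tail_le (ltW r0) hd 1 rz x11; rewrite (hz z); last 2 first.
- by rewrite -cabs_eq0 zx gt_eqF // divr_gt0.
- by rewrite zx ltr_pdivrMr.
rewrite sub0r cabsN /power_series /series /= big_nat1 expr0 mulr1 expr1.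
move/le_trans; apply; rewrite ler_pdivrMr ?subr_gt0 //.
by apply: aux => //; exact: ltW.
Qed.

(** A convergent series that vanishes near 0 has zero coefficients: its constant
    term is its limit at 0, and dividing by z shifts the coefficients. *)
Lemma psum_eq0_coef d (M r e : R) : 0 < r -> geo_bounded d M r -> 0 < e ->
  (forall z, z != 0 -> cabs z < e -> psum d z = 0) -> forall n, d n = 0.
Proof.
move=> r0 hd e0 hz; pose e' := Num.min e r^-1.
have e'0 : 0 < e' by rewrite lt_min e0 invr_gt0.
have {}hz z : z != 0 -> cabs z < e' -> psum d z = 0.
  by move=> z0; rewrite lt_min => /andP[ze _]; exact: hz.
have re' z : cabs z < e' -> r * cabs z < 1.
  by rewrite lt_min => /andP[_ h]; rewrite mulrC -ltr_pdivlMr // div1r.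
move=> n; elim: n d M hd hz => [|n IH] d M hd hz.
  exact: (psum_eq0_coef0 r0 hd e'0 hz).
have d0 := psum_eq0_coef0 r0 hd e'0 hz.
apply: (IH (d \o succn) (M * r)) => [i /=|z z0 ze].
  by rewrite -mulrA -exprS hd.
have /eqP := hz z z0 ze; rewrite (geo_bounded_psum_recl (ltW r0) hd (re' z ze)) d0 add0r.
by rewrite mulf_eq0 (negPf z0) => /eqP.
Qed.

End FormalSeries.

(** * The Taylor series of the quotient *)

Section Taylor.
Variable R : realType.
Local Notation C := (R[i] : numFieldType).
Implicit Types (a b c d h : nat -> C).

Lemma geo_bounded_mono a (M r s : R) : 0 <= r -> r <= s -> geo_bounded a M r -> geo_bounded a M s.
Proof.
move=> r0 rs ha n; apply: le_trans (ha n) _.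
rewrite ler_wpM2l ?(geo_bounded_ge0 ha) // lerXn2r // nnegrE //.
exact: le_trans rs.
Qed.

Lemma geo_bounded_cvg h (k : R) (l : C) : 0 < k ->
  power_series h k%:C @ \oo --> l -> exists M, geo_bounded h M k^-1.
Proof.
move=> k0 /cabs_cvg /(_ _ ltr01)[N hN].
have kk : cabs (k%:C : C) = k by rewrite cabs_real gtr0_norm.
suff [B hB] : exists B : R, forall n, cabs (h n * (k%:C) ^+ n) <= B.
  exists B => n; have := hB n; rewrite cabsM cabsX kk exprVn.
  by rewrite -ler_pdivlMr ?exprn_gt0.
exists (2 + \sum_(i < N) cabs (h i * k%:C ^+ i)) => n.
have S0 : 0 <= \sum_(i < N) cabs (h i * k%:C ^+ i) by rewrite sumr_ge0 // => i _; exact: cabs_ge0.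
have [nN|Nn] := ltnP n N.
  rewrite (bigD1 (Ordinal nN)) //= addrCA lerDl addr_ge0 //.
  by rewrite sumr_ge0 // => i _; exact: cabs_ge0.
have -> : h n * k%:C ^+ n = (l - power_series h k%:C n) - (l - power_series h k%:C n.+1).
  by rewrite power_seriesS; ring.
have h1 := hN n Nn; have h2 := hN n.+1 (leqW Nn).
apply: le_trans (cabsD _ _) _; rewrite cabsN; move: h1 h2 S0.
move: (cabs _) (cabs _) (\sum_(i < N) _) => x y z; lra.
Qed.

Lemma psumB a b (M M' r : R) z : 0 <= r -> geo_bounded a M r -> geo_bounded b M' r ->
  r * cabs z < 1 -> psum (fun n => a n - b n) z = psum a z - psum b z.
Proof.
move=> r0 ha hb rz; apply: psum_lim.
have -> : power_series (fun n => a n - b n) z = (fun n => power_series a z n - power_series b z n).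
  apply/funext => n; rewrite /power_series /series /= -sumrB.
  by apply: eq_bigr => i _; ring.
by apply: cvgB; [exact: (psum_cvg r0 ha rz)|exact: (psum_cvg r0 hb rz)].
Qed.

(** Multiplication of convergent series followed by uniqueness of coefficients:
    an identity of functions near 0 becomes one of formal power series. *)
Lemma conv_of_quotient a b h (M M' M'' r e : R) : 0 < r -> 0 < e ->
  geo_bounded a M r -> geo_bounded b M' r -> geo_bounded h M'' r ->
  (forall z, cabs z < e -> psum h z * psum b z = psum a z) -> conv h b =1 a.
Proof.
move=> r0 e0 ha hb hh hz n; apply/eqP; rewrite -subr_eq0; apply/eqP; move: n.
have rs : r < r + 1 by lra.
have s0 : 0 < r + 1 by lra.
have hc := conv_geo_bounded r0 rs hh hb.
have ha' := geo_bounded_mono (ltW r0) (ltW rs) ha.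
set B := _ / _ in hc.
have hd : geo_bounded (fun n => conv h b n - a n) (B + M) (r + 1).
  by move=> n; rewrite mulrDl; apply: le_trans (cabsD _ _) _; rewrite cabsN; exact: lerD.
have e'0 : 0 < Num.min e (r + 1)^-1 by rewrite lt_min e0 invr_gt0.
apply: (psum_eq0_coef s0 hd e'0) => z _; rewrite lt_min => /andP[ze zs].
have sz : (r + 1) * cabs z < 1 by rewrite mulrC -ltr_pdivlMr // div1r.
by rewrite (psumB (ltW s0) hc ha' sz) (psum_conv r0 rs hh hb sz) hz // subrr.
Qed.

Section Continuation.
Variables (q : C) (A : R).
Hypotheses (hq : cabs q = 1) (hA : dioph q A).
Local Notation c := (RR_coef q).
Local Notation cq := (RR_coefq q).
Variable H : C -> C.
Hypothesis hH : is_RR_H q [set z : C | `|z| < 1] H.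

Lemma RR_H_near0 : exists2 e : R, 0 < e &
  forall z, cabs z < e -> psum cq z != 0 /\ H z * psum cq z = psum c z.
Proof.
have g0 : RR_G q (q * 0) != 0 by rewrite mulr0 (RR_G0 hq hA) oner_eq0.
have z1 : cabs (0 : C) < 1 by rewrite cabs0.
have [e e0 he] := G_q_near hq hA z1 g0; exists e; first exact: e0.
move=> z; rewrite -{1}[z]subr0 => /he[zz gz]; rewrite psum_coefq; split; first exact: gz.
by rewrite (RR_HE hq hA hH zz gz) -RR_GE; exact: divfK.
Qed.

Lemma RR_coefs_bounded : exists M M' : R, geo_bounded c M 2 /\ geo_bounded cq M' 2.
Proof.
have [M hM] := RR_subexp hq hA (ltr1n R 2 : 1 < 2).
have [M' hM'] := RR_coefq_subexp hq hA (ltr1n R 2 : 1 < 2).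
by exists M, M'.
Qed.

(** Whatever sequence h converges to H near 0, it is the formal quotient of
    G(z) by G(q z): the hypothesis on h is only pointwise convergence, whose
    terms tend to 0 at one real point, and this already bounds h geometrically. *)
Lemma taylor_RR_H h : taylor_at H 0 h -> conv h cq =1 c.
Proof.
move=> /near_cabs[e e0 he]; have [e1 e10 he1] := RR_H_near0.
have [M [M' [hc hcq]]] := RR_coefs_bounded.
have k0 : 0 < e / 2 by rewrite divr_gt0.
have [B hB] : exists B, geo_bounded h B (e / 2)^-1.
  apply: (geo_bounded_cvg k0 (l := H (e / 2)%:C)).
  have := he (e / 2)%:C; rewrite subr0 cabs_real gtr0_norm //; apply.
  by rewrite ltr_pdivrMr // ltr_pMr // ltr1n.
pose r := Num.max 2 (e / 2)^-1; have r2 : 2 <= r by rewrite le_max lexx.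
have re : (e / 2)^-1 <= r by rewrite le_max lexx orbT.
have r0 : 0 < r by apply: lt_le_trans r2.
have hB' := geo_bounded_mono (ltW _) re hB; rewrite invr_gt0 in hB'.
have e'0 : 0 < Num.min (Num.min e e1) r^-1 by rewrite !lt_min e0 e10 invr_gt0.
apply: (conv_of_quotient r0 e'0 (geo_bounded_mono _ r2 hc) (geo_bounded_mono _ r2 hcq) (hB' k0)) => // z.
rewrite !lt_min => /andP[/andP[ze ze1] zr].
have rz : r * cabs z < 1 by rewrite mulrC -ltr_pdivlMr // div1r.
have -> : psum h z = H z.
  apply: psum_lim; have := he z; rewrite subr0; exact.
by have [_ ->] := he1 z ze1.
Qed.

Lemma RR_H_analytic : analytic_at H 0.
Proof.
have [e e0 he] := RR_H_near0; have [M [M' [hc hcq]]] := RR_coefs_bounded.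
have cq0 : cq 0%N = 1 by rewrite /RR_coefq RR_coef0 mulr1.
pose B := Num.max M M'.
have mono (x : nat -> C) N N' : N <= N' -> geo_bounded x N 2 -> geo_bounded x N' 2.
  by move=> NN hx n; apply: le_trans (hx n) _; rewrite ler_wpM2r ?exprn_ge0.
have hcB : geo_bounded c B 2 by apply: mono hc; rewrite le_max lexx.
have hcqB : geo_bounded cq B 2 by apply: mono hcq; rewrite le_max lexx orbT.
have r0 : (0 : R) < 2 by [].
have hh := quo_geo_bounded r0 hcB hcqB.
set r := 2 * (B + 1) in hh.
have B0 := geo_bounded_ge0 hcB.
have r2 : 2 <= r by rewrite /r ler_peMr // lerDr.
have rpos : 0 < r by apply: lt_le_trans r2.
have hcq' := geo_bounded_mono (ltW r0) r2 hcqB.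
exists (quo c cq); apply/near_cabs.
exists (Num.min e (r + 1)^-1) => [|z].
  by rewrite lt_min e0 invr_gt0 ltr_wpDl // ltW.
rewrite subr0 lt_min => /andP[/he[gz hz] zr].
have rs : r < r + 1 by rewrite ltrDl.
have sz : (r + 1) * cabs z < 1.
  by rewrite mulrC -ltr_pdivlMr ?div1r // ltr_wpDl // ltW.
have rz : r * cabs z < 1.
  by apply: le_lt_trans sz; rewrite ler_wpM2r ?cabs_ge0 // ltW.
have <- : psum (quo c cq) z = H z.
  apply: (mulIf gz); rewrite hz -(psum_conv rpos rs hh hcq' sz).
  by congr (psum _ z); apply/funext; exact: conv_quo.
exact: (psum_cvg (ltW rpos) hh rz).
Qed.

End Continuation.
End Taylor.

(** * Convergents as truncated products *)

Section Convergents.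
Variable F : fieldType.
Variable q : F.

(** The continuants of 1 + q^k z / (1 + q^(k+1) z / ...): the fraction with n terms
    starting at q^k z is cf_poly n.+1 k / cf_poly n k.+1. *)
Fixpoint cf_poly (n k : nat) {struct n} : {poly F} :=
  match n with
  | n1.+1 => match n1 with
             | n2.+1 => cf_poly n1 k.+1 + q ^+ k *: 'X * cf_poly n2 k.+2
             | 0 => 1
             end
  | 0 => 1
  end.

Lemma cf_polySS n k :
  cf_poly n.+2 k = cf_poly n.+1 k.+1 + q ^+ k *: 'X * cf_poly n k.+2.
Proof. by []. Qed.

Lemma cf_poly_at0 n k : (cf_poly n k).[0] = 1.
Proof.
have [m] := ubnP n; elim: m => // m IH in n k *.
case: n => [|[|n]] nm; rewrite ?hornerC //.
by rewrite cf_polySS !hornerE ?(mulr0, mul0r, addr0) IH.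
Qed.

Lemma cf_poly_neq0 n k : cf_poly n k != 0.
Proof.
by apply/eqP => h; have := cf_poly_at0 n k; rewrite h horner0 => /esym/eqP; rewrite oner_eq0.
Qed.

Lemma contfrac_tail_cf_poly n k :
  1 + contfrac_tail (fun j => tofrac (q ^+ j *: 'X)) (fun=> 1) n k =
  tofrac (cf_poly n.+1 k) / tofrac (cf_poly n k.+1).
Proof.
elim: n k => [|n IH] k; first by rewrite /= addr0 rmorph1 divr1.
rewrite [contfrac_tail _ _ _ _]/= IH invf_div cf_polySS rmorphD rmorphM /=.
have h0 m j : tofrac (cf_poly m j) != 0 by rewrite tofrac_eq0 cf_poly_neq0.
by rewrite mulrDl divff ?mulrA //; exact: (h0 n.+1 k.+1).
Qed.

(** Numerators and denominators of a convergent have no common zero: descending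
    the recursion, a common zero would be one of the constant polynomial 1. *)
Lemma cf_poly_coprime n k x : q != 0 -> (cf_poly n k.+1).[x] = 0 -> (cf_poly n.+1 k).[x] != 0.
Proof.
move=> q0; elim: n k => [|n IH] k; first by rewrite hornerC => /eqP; rewrite oner_eq0.
move=> h; apply/eqP; rewrite cf_polySS !hornerE h add0r => /eqP.
rewrite mulf_eq0 => /orP[|/eqP h2]; last first.
  by have := IH k.+1 h2; rewrite h eqxx.
rewrite mulf_eq0 expf_eq0 (negPf q0) andbF /= => /eqP x0.
by move: h; rewrite x0 cf_poly_at0 => /eqP; rewrite oner_eq0.
Qed.

Section Truncation.
Variables c d : nat -> F.
Hypothesis q0 : q != 0.
Hypothesis q1 : forall k, (0 < k)%N -> 1 - q ^+ k != 0.
Hypotheses (c0 : c 0%N = 1) (d0 : d 0%N = 1).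
Hypothesis cS : forall n, c n.+1 * (1 - q ^+ n.+1) = q ^+ (2 * n).+1 * c n.
Hypothesis dS : forall n, d n.+1 * (q ^+ n.+1 - 1) * q ^+ n = d n.

(** The coefficient of z^i in G(z) D(w z), where G and D are the formal power
    series with coefficients c and d. *)
Definition prod_coef w i : F := \sum_(j < i.+1) c (i - j)%N * (d j * w ^+ j).

Lemma prod_coef0 w : prod_coef w 0 = 1.
Proof. by rewrite /prod_coef big_ord1 subnn c0 d0 expr0 !mulr1. Qed.

Lemma prod_coef_rec w i : prod_coef (q ^+ 2 * w) i.+1 =
  q ^+ i.+1 * prod_coef (q * w) i.+1 + q ^+ (2 * i).+1 * prod_coef w i.
Proof.
rewrite /prod_coef !mulr_sumr big_ord_recr [in RHS]big_ord_recr /= subnn.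
rewrite -addrA [_ + \sum_(_ < _) _]addrC addrA -big_split /=; congr (_ + _).
  apply: eq_bigr => j _; move: (nat_of_ord j) (ltn_ord j) => {}j ji.
  rewrite subSn //; have := cS (i - j); set m := (i - j)%N => hc.
  have -> : i = (m + j)%N by rewrite /m subnK.
  have e2 : q ^+ (2 * (m + j)).+1 = q ^+ (2 * m).+1 * q ^+ (2 * j).
    by rewrite -exprD; congr (_ ^+ _); lia.
  have e1 : q ^+ (m + j).+1 = q ^+ m.+1 * q ^+ j by rewrite -exprD.
  have e3 : q ^+ (2 * j) = q ^+ j * q ^+ j by rewrite -exprD; congr (_ ^+ _); lia.
  have e4 : (q ^+ 2 * w) ^+ j = q ^+ j * q ^+ j * w ^+ j by rewrite exprMn -exprM e3.
  rewrite e2 e1 e3 e4 exprMn.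
  have -> : q ^+ (2 * m).+1 * (q ^+ j * q ^+ j) * (c m * (d j * w ^+ j)) =
      (q ^+ (2 * m).+1 * c m) * (q ^+ j * q ^+ j) * (d j * w ^+ j) by ring.
  rewrite -hc; ring.
rewrite c0 !mul1r (_ : q ^+ 2 * w = q * (q * w)); last by ring.
by rewrite exprMn; ring.
Qed.

(** At w = q^k the sum is a terminating q-binomial series, whose partial sums
    telescope to a closed form; it vanishes at J = k. *)
Lemma prod_coef_partial k J : (J <= k)%N ->
  (\sum_(j < J.+1) c (k - j)%N * (d j * (q ^+ k) ^+ j)) * (q ^+ J * (q ^+ k - 1)) =
  c (k - J)%N * (d J * (q ^+ k) ^+ J) * (q ^+ k - q ^+ J).
Proof.
elim: J => [|J IH] Jk; first by rewrite big_ord1 !expr0 mul1r.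
rewrite big_ord_recr /= mulrDl.
have -> : q ^+ J.+1 * (q ^+ k - 1) = q * (q ^+ J * (q ^+ k - 1)) by rewrite exprS; ring.
rewrite [X in X + _]mulrCA IH; last exact: ltnW.
have := cS (k - J.+1); rewrite -subSn // subSS -(dS J).
set m := (k - J.+1)%N => hc.
have kE : k = (J.+1 + m)%N by rewrite /m subnKC.
have mE : (k - J = m.+1)%N by rewrite /m; lia.
have qk : q ^+ k = q ^+ J * q ^+ m.+1 by rewrite -exprD; congr (_ ^+ _); lia.
have q2m : q ^+ (2 * m).+1 = q ^+ m.+1 * q ^+ m by rewrite -exprD; congr (_ ^+ _); lia.
rewrite mE in hc *.
have e1 : c m.+1 * (q ^+ k - q ^+ J) = - q ^+ J * (q ^+ (2 * m).+1 * c m).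
  by rewrite -hc qk; ring.
have -> : q * (c m.+1 * (d J.+1 * (q ^+ J.+1 - 1) * q ^+ J * (q ^+ k) ^+ J) * (q ^+ k - q ^+ J)) =
   q * (c m.+1 * (q ^+ k - q ^+ J)) * (d J.+1 * (q ^+ J.+1 - 1) * q ^+ J * (q ^+ k) ^+ J) by ring.
rewrite e1 q2m [(q ^+ k) ^+ J.+1]exprS; move: ((q ^+ k) ^+ J) => Q.
rewrite qk !exprS; ring.
Qed.

Lemma prod_coef_vanish k : (0 < k)%N -> prod_coef (q ^+ k) k = 0.
Proof.
move=> k0; have /eqP := prod_coef_partial (leqnn k); rewrite subrr mulr0.
rewrite mulf_eq0 => /orP[/eqP //|]; rewrite mulf_eq0 expf_eq0 (negPf q0) andbF /=.
by rewrite -opprB oppr_eq0 (negPf (q1 k0)).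
Qed.

(** The polynomial is the truncation at degree n of G(z) D(q^n z), evaluated at
    q^k z. Both sides satisfy the same recursion in n, and the truncation is
    exact because the coefficient of degree n of G(z) D(q^n z) is 0 for n > 0 by
    [prod_coef_vanish]. *)
Lemma cf_poly_coef n k i : (cf_poly n k.+1)`_i =
  if (i <= n)%N then (q ^+ k) ^+ i * prod_coef (q ^+ n) i else 0.
Proof.
have [m] := ubnP n; elim: m => // m IH in n k i *.
case: n => [|[|n]] nm.
- rewrite coef1 leqn0; case: eqP => // ->.
  by rewrite expr0 mul1r prod_coef0.
- rewrite coef1; case: i => [|[|i]] //=; first by rewrite expr0 mul1r prod_coef0.
  by rewrite prod_coef_vanish // mulr0.
rewrite cf_polySS coefD -scalerAl coefZ coefXM IH; last by lia.
case: i => [|i]; first by rewrite /= !expr0 !prod_coef0 mulr0 addr0.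
rewrite IH; last by lia.
rewrite !ltnS [i.+1.-1]/=.
have qn2 : q ^+ n.+2 = q ^+ 2 * q ^+ n by rewrite -exprD.
have [ni|ni] := leqP i n.
  rewrite leqW // qn2 prod_coef_rec -exprS.
  have e1 : (q ^+ k.+1) ^+ i.+1 = (q ^+ k) ^+ i.+1 * q ^+ i.+1.
    by rewrite [q ^+ k.+1]exprSr exprMn.
  have e2 : q ^+ k.+1 * (q ^+ k.+2) ^+ i = (q ^+ k) ^+ i.+1 * q ^+ (2 * i).+1.
    by rewrite -!exprM -!exprD; congr (_ ^+ _); lia.
  by rewrite mulrA e1 e2; ring.
rewrite !mulr0 addr0; case: ifP => // hi.
have -> : i.+1 = n.+2 by lia.
by rewrite prod_coef_vanish // mulr0.
Qed.

End Truncation.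
End Convergents.

Lemma RR_convergent_cf_poly (K : numFieldType) (q : K) n :
  RR_convergent q n = ratfun (cf_poly q n.+1 1) (cf_poly q n 2).
Proof. exact: contfrac_tail_cf_poly. Qed.

(** * Pade approximants *)

Section Pade.
Variable R : realType.
Local Notation C := (R[i] : numFieldType).

(** P1 Q2 and P2 Q1 both agree with h Q1 Q2 up to degree m + n, which bounds the
    degrees of these products. *)
Lemma pade_unique (h : nat -> C) m n r s : is_pade h m n r -> is_pade h m n s -> r = s.
Proof.
move=> [P1 [Q1 [sP1 sQ1 Q10 e1 ->]]] [P2 [Q2 [sP2 sQ2 Q20 e2 ->]]].
have convE (P Q : {poly R[i]}) : (forall k, (k <= m + n)%N ->
    \sum_(i < k.+1) h i * Q`_(k - i) - P`_k = 0) ->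
    forall k, (k <= m + n)%N -> P`_k = conv h (fun i => Q`_i) k.
  by move=> e k /e /eqP; rewrite subr_eq0 => /eqP <-.
have coefM_conv (P Q : {poly R[i]}) k : (P * Q)`_k = conv (fun i => P`_i) (fun i => Q`_i) k.
  by rewrite coefM.
have cross : P1 * Q2 = P2 * Q1.
  apply/polyP => k; have [kmn|kmn] := leqP k (m + n); last first.
    have big (P Q : {poly R[i]}) : (size P <= m.+1)%N -> (size Q <= n.+1)%N -> (P * Q)`_k = 0.
      move=> sP sQ; apply: nth_default; apply: leq_trans (size_polyMleq _ _) _; lia.
    by rewrite !big.
  rewrite !coefM_conv.
  have step (P Q Q' : {poly R[i]}) : (forall k, (k <= m + n)%N ->
      \sum_(i < k.+1) h i * Q`_(k - i) - P`_k = 0) ->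
      conv (fun i => P`_i) (fun i => Q'`_i) k = conv h (conv (fun i => Q`_i) (fun i => Q'`_i)) k.
    move=> e; rewrite convA; apply: eq_conv => i ik //.
    by apply: (convE _ _ e); exact: leq_trans ik kmn.
  rewrite (step _ _ _ e1) (step _ _ _ e2); congr (conv h _ k).
  by apply/funext => i; exact: convC.
rewrite /ratfun; apply/eqP; rewrite eqr_div ?tofrac_eq0 // -!rmorphM /=.
by apply/eqP; rewrite cross.
Qed.

Lemma padeE (h : nat -> C) m n r : is_pade h m n r -> pade h m n = r.
Proof.
move=> hr; apply: (@pade_unique h m n _ _ _ hr).
exact: (@xgetPex _ 0 [set s | is_pade h m n s] (ex_intro _ r hr)).
Qed.

Section Convergents.
Variables (q : C) (A : R).
Hypotheses (hq : cabs q = 1) (hA : dioph q A).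
Local Notation c := (RR_coef q).
Local Notation cq := (RR_coefq q).

(** The coefficients of D(z) = conj (G (conj z)). As conj q = 1/q, this is the
    Rogers-Ramanujan series for 1/q. *)
Definition RR_coefJ n : C := (c n)^*.
Local Notation d := RR_coefJ.

Lemma q_conj : q^* * q = 1.
Proof.
by rewrite mulrC -sqr_normc cabsE hq expr1n.
Qed.

Lemma q_neq0 : q != 0.
Proof. by rewrite -cabs_eq0 hq oner_eq0. Qed.

Lemma RR_coefJ0 : d 0%N = 1.
Proof. by rewrite /RR_coefJ RR_coef0 rmorph1. Qed.

Lemma RR_coefJS n : d n.+1 * (q ^+ n.+1 - 1) * q ^+ n = d n.
Proof.
have conj_rec (x y : C) k l : x * (1 - q ^+ k) = q ^+ l * y ->
    x^* * (1 - q^* ^+ k) * q ^+ l = y^*.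
  move=> /(congr1 (@conjc R)); rewrite !rmorphM rmorphB rmorph1 !rmorphXn /= => ->.
  by rewrite mulrAC -exprMn q_conj expr1n mul1r.
rewrite -[RHS](conj_rec _ _ _ _ (RR_coefS hq hA n)) -/(RR_coefJ n.+1).
have e2 : q ^+ (2 * n).+1 = q ^+ n.+1 * q ^+ n by rewrite -exprD; congr (_ ^+ _); lia.
have e3 : q^* ^+ n.+1 * q ^+ n.+1 = 1 by rewrite -exprMn q_conj expr1n.
have -> : RR_coefJ n.+1 * (1 - q^* ^+ n.+1) * q ^+ (2 * n).+1 =
   RR_coefJ n.+1 * (q ^+ n.+1 - q^* ^+ n.+1 * q ^+ n.+1) * q ^+ n by rewrite e2; ring.
by rewrite e3.
Qed.

(** The coefficients of D(w z). *)
Definition twist (w : C) n : C := d n * w ^+ n.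

Lemma prod_coef_conv w i : prod_coef c d w i = conv (twist w) c i.
Proof. by apply: eq_bigr => j _; rewrite mulrC. Qed.

Lemma cf_poly1_coef n i : (i <= n)%N ->
  (cf_poly q n 1)`_i = conv (twist (q ^+ n)) c i.
Proof.
move=> i_n; rewrite (cf_poly_coef q_neq0 (dioph_neq0 hA) (RR_coef0 q) RR_coefJ0 (RR_coefS hq hA) RR_coefJS).
by rewrite i_n expr0 expr1n mul1r prod_coef_conv.
Qed.

Lemma cf_poly2_coef n i : (cf_poly q n 2)`_i = q ^+ i * (cf_poly q n 1)`_i.
Proof.
rewrite !(cf_poly_coef q_neq0 (dioph_neq0 hA) (RR_coef0 q) RR_coefJ0 (RR_coefS hq hA) RR_coefJS).
by case: ifP => _; rewrite ?mulr0 // expr0 expr1n mul1r expr1.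
Qed.

Lemma size_cf_poly n k : (size (cf_poly q n k) <= n./2.+1)%N.
Proof.
have [m] := ubnP n; elim: m => // m IH in n k *.
case: n => [|[|n]] nm; rewrite ?size_poly1 // cf_polySS.
apply: leq_trans (size_polyD _ _) _; rewrite geq_max; apply/andP; split.
  by apply: leq_trans (IH _ _ _) _; lia.
rewrite -scalerAl mulrC; apply: leq_trans (size_scale_leq _ _) _.
rewrite size_mulX ?cf_poly_neq0 //; have := IH n k.+2; lia.
Qed.

(** With w = q^(K+1), the numerator is the truncation of G(z) D(w z) and the
    denominator that of G(q z) D(w z), since q^K (q z) = w z. Multiplying the
    second series by h gives the first, so they match in the degrees up to K in
    which both truncations are exact. *)
Lemma convergent_is_pade h m n K : conv h cq =1 c -> (m + n = K)%N ->
  (K.+1./2 <= m)%N -> (K./2 <= n)%N -> is_pade h m n (RR_convergent q K).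
Proof.
move=> hh mnK Km Kn; exists (cf_poly q K.+1 1), (cf_poly q K 2); split.
- by apply: leq_trans (size_cf_poly _ _) _.
- by apply: leq_trans (size_cf_poly _ _) _.
- exact: cf_poly_neq0.
- move=> k; rewrite mnK => kK; apply/eqP; rewrite subr_eq0; apply/eqP.
  rewrite cf_poly1_coef ?leqW //.
  have -> : conv (twist (q ^+ K.+1)) c k = conv h (conv cq (twist (q ^+ K.+1))) k.
    by rewrite convA convC; apply: eq_conv => // i _; rewrite hh.
  apply: eq_bigr => i _; congr (_ * _).
  have kiK : (k - i <= K)%N := leq_trans (leq_subr _ _) kK.
  move: (k - i)%N kiK => j jK; rewrite cf_poly2_coef cf_poly1_coef // convC /conv mulr_sumr.
  apply: eq_bigr => l _; have lj : (l <= j)%N by rewrite -ltnS.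
  rewrite /RR_coefq /twist; move: (nat_of_ord l) lj => {}l lj.
  have -> : q ^+ j = q ^+ l * q ^+ (j - l) by rewrite -exprD subnKC.
  have -> : (q ^+ K.+1) ^+ (j - l) = q ^+ (j - l) * (q ^+ K) ^+ (j - l).
    by rewrite exprS exprMn.
  by ring.
- exact: RR_convergent_cf_poly.
Qed.

Lemma pade_diag h n : conv h cq =1 c -> pade h n n = RR_convergent q n.*2.
Proof. by move=> hh; apply/padeE/convergent_is_pade => //; lia. Qed.

Lemma pade_superdiag h n : conv h cq =1 c -> pade h n.+1 n = RR_convergent q n.*2.+1.
Proof. by move=> hh; apply/padeE/convergent_is_pade => //; lia. Qed.

End Convergents.
End Pade.

(** * The minimum modulus principle *)

Section MinimumModulus.
Variable R : realType.
Local Notation C := (R[i] : numFieldType).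

(** The minimum modulus principle for a polynomial without zeros in a closed disc.
    Let zeta run over the N-th roots of r^N. For a root w of p, the product of the
    |a + zeta - w| is |(w - a)^N - r^N|, at most 2 |a - w|^N as |a - w| > r. Hence
    the product of the |p (a + zeta)| is at most 2^deg p |p a|^N, and at least m^N;
    N-th roots and N to infinity give m <= |p a|. *)
Lemma min_modulus (p : {poly R[i]}) (a : C) (r m : R) : 0 < r -> 0 < m ->
  (forall z, cabs (z - a) <= r -> p.[z] != 0) ->
  (forall z, cabs (z - a) = r -> m <= cabs p.[z]) -> m <= cabs p.[a].
Proof.
move=> r0 m0 hp hm; rewrite leNgt; apply/negP => hlt.
have pa0 : p.[a] != 0 by apply: hp; rewrite subrr cabs0 ltW.
have [ws pE] := closed_field_poly_normal p.
have lc0 : lead_coef p != 0.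
  by rewrite lead_coef_eq0; apply: contraNneq pa0 => ->; rewrite horner0.
have pz z : cabs p.[z] = cabs (lead_coef p) * \prod_(w <- ws) cabs (z - w).
  rewrite {1}pE hornerZ cabsM horner_prod cabs_prod; congr (_ * _).
  by apply: eq_bigr => w _; rewrite !hornerE.
have wr w : w \in ws -> r < cabs (a - w).
  move=> wws; rewrite ltNge; apply/negP => h.
  have := hp w; rewrite cabsB => /(_ h); rewrite -cabs_eq0 pz (big_rem w wws) /=.
  by rewrite subrr cabs0 mul0r mulr0 eqxx.
have key N : (0 < N)%N -> m ^+ N <= 2 ^+ size ws * cabs p.[a] ^+ N.
  move=> N0; have [rs rsE] := closed_field_poly_normal ('X^N - ((r%:C : R[i]) ^+ N)%:P).
  rewrite lead_coefXnsubC // scale1r in rsE.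
  have rsN : size rs = N.
    have := congr1 (fun p : {poly R[i]} => size p) rsE.
    by rewrite size_XnsubC // size_prod_XsubC => -[].
  have rsr z : z \in rs -> cabs z = r.
    rewrite -root_prod_XsubC -rsE => /rootP; rewrite !hornerE => /eqP.
    rewrite subr_eq0 => /eqP /(congr1 (@cabs R)); rewrite !cabsX cabs_real gtr0_norm //.
    by move/eqP; rewrite eqrXn2 ?cabs_ge0 // ?ltW // => /eqP.
  have prs w : w \in ws -> \prod_(z <- rs) cabs (a + z - w) <= 2 * cabs (a - w) ^+ N.
    move=> /wr/ltW wN.
    have -> : \prod_(z <- rs) cabs (a + z - w) = cabs ((w - a) ^+ N - r%:C ^+ N).
      have := congr1 (fun p : {poly R[i]} => p.[w - a]) rsE.
      rewrite /= !hornerE => ->; rewrite horner_prod cabs_prod.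
      by apply: eq_bigr => z _; rewrite !hornerE cabsB; congr cabs; ring.
    apply: le_trans (cabsD _ _) _; rewrite cabsN !cabsX cabs_real gtr0_norm //.
    rewrite mulr_natl mulr2n cabsB lerD2l lerXn2r // nnegrE ?cabs_ge0 // ltW //.
  have lb : m ^+ N <= \prod_(z <- rs) cabs p.[a + z].
    rewrite -rsN; elim: (rs) rsr => [|z s IH] hs; first by rewrite big_nil expr0.
    rewrite big_cons exprS; apply: ler_pM; rewrite ?exprn_ge0 ?(ltW m0) //.
      by apply: hm; rewrite addrAC subrr add0r hs // mem_head.
    by apply: IH => w ws'; apply: hs; rewrite inE ws' orbT.
  apply: (le_trans lb); rewrite (eq_bigr _ (fun z _ => pz (a + z))) big_split /=.
  rewrite exchange_big /= [X in _ <= _ * X ^+ _]pz exprMn mulrCA.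
  have -> : \prod_(z <- rs) cabs (lead_coef p) = cabs (lead_coef p) ^+ N.
    by rewrite big_const_seq count_predT rsN; elim: (N) => [|k /= ->]; rewrite ?expr0 ?exprS.
  rewrite ler_wpM2l ?exprn_ge0 ?cabs_ge0 //.
  have -> : 2 ^+ size ws * (\prod_(w <- ws) cabs (a - w)) ^+ N = \prod_(w <- ws) (2 * cabs (a - w) ^+ N).
    rewrite big_split /= -prodrXl; congr (_ * _).
    by rewrite big_const_seq count_predT; elim: (size ws) => [|k /= <-]; rewrite ?expr0 ?exprS.
  rewrite big_seq [leRHS]big_seq; apply: ler_prod => w wws.
  by rewrite prs // andbT prodr_ge0 // => z _; exact: cabs_ge0.
have x0 : 0 <= cabs p.[a] / m by rewrite divr_ge0 ?cabs_ge0 // ltW.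
have x1 : cabs p.[a] / m < 1 by rewrite ltr_pdivrMr // mul1r.
have [|N hN] := @geo_small _ _ (2 ^+ size ws) x0 x1 (1 / 2); first by rewrite divr_gt0.
have := hN N.+1 (leqnSn N); have := key N.+1 isT.
have mN : 0 < m ^+ N.+1 by rewrite exprn_gt0.
rewrite expr_div_n mulrA ler_pdivrMr //; lra.
Qed.

End MinimumModulus.

(** * Taylor polynomials of the exponential *)

Section ExpTaylor.
Variable R : realType.
Local Notation C := (R[i] : numFieldType).

Definition exp_coef n : C := n`!%:R^-1.

Lemma exp_term (x : R) n : exp_coef n * ('i * x%:C) ^+ n = cos_coeff x n +i* sin_coeff x n.
Proof.
rewrite exprMn /exp_coef /cos_coeff /sin_coeff /=.
have -> : (n`!%:R : C) = (n`!%:R : R)%:C by rewrite rmorph_nat.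
rewrite -fmorphV -rmorphXn /= mulrCA -rmorphM /=.
have -> : ('i : C) ^+ n = ((~~ odd n)%:R * (-1) ^+ n./2) +i* ((odd n)%:R * (-1) ^+ n.-1./2).
  rewrite -[in LHS](odd_double_half n) exprD -mul2n exprM sqr_i.
  have -> : (-1 : C) ^+ n./2 = ((-1) ^+ n./2)%:C by rewrite rmorphXn rmorphN rmorph1.
  case: (boolP (odd n)) => on /=; last by rewrite expr0 !mul1r mul0r.
  rewrite expr1 mul0r mul1r; simpc; congr (_ +i* _); congr (_ ^+ _).
  by rewrite -[in RHS](odd_double_half n) on add1n /= doubleK.
by simpc; congr (_ +i* _); rewrite -?exprnP; ring.
Qed.

Lemma cvg_expi (x : R) : power_series exp_coef ('i * x%:C) @ \oo --> (expi x : C).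
Proof.
have e n : power_series exp_coef ('i * x%:C) n = series (cos_coeff x) n +i* series (sin_coeff x) n.
  elim: n => [|n IH]; first by rewrite /power_series /series /= !big_geq.
  have sE (V : zmodType) (v : nat -> V) : series v n.+1 = series v n + v n.
    by rewrite /series /= big_nat_recr.
  by rewrite /power_series !sE [series _ n]IH exp_term.
rewrite /expi; apply: cvg_ReIm.
  rewrite (_ : (fun n => _) = series (cos_coeff x)); last by apply/funext => n; rewrite e.
  by rewrite unlock; exact: is_cvg_series_cos_coeff.
rewrite (_ : (fun n => _) = series (sin_coeff x)); last by apply/funext => n; rewrite e.
by rewrite unlock; exact: is_cvg_series_sin_coeff.
Qed.

(** As |x| <= 2 and the index is at least 3, consecutive terms have ratio at most
    1/2. *)
Lemma expi_taylor (x : R) N : (2 < N)%N -> `|x| <= 2 ->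
  cabs (expi x - power_series exp_coef ('i * x%:C) N) <= 2 * (2 ^+ N / N`!%:R).
Proof.
move=> N2 x2; have -> : (expi x : C) = limn (power_series exp_coef ('i * x%:C)).
  by rewrite (cvg_limC (@cvg_expi x)).
have hi : cabs ('i * x%:C) = `|x|.
  by rewrite cabsM cabs_real /cabs normc_def /= expr0n /= expr1n add0r sqrtr1 mul1r.
have t0 : (0 : R) <= 1 / 2 by lra.
have t1 : 1 / 2 < 1 :> R by lra.
have tE : 1 - 1 / 2 = 2^-1 :> R by lra.
suff hterm k : cabs (exp_coef (N + k) * ('i * x%:C) ^+ (N + k)) <= 2 ^+ N / N`!%:R * (1 / 2) ^+ k.
  have [_] := @series_geo R (fun j => exp_coef j * ('i * x%:C) ^+ j) N _ _ t0 t1 hterm.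
  by rewrite tE invrK [_ * 2]mulrC.
rewrite cabsM cabsX hi /exp_coef cabsV cabs_nat.
elim: k => [|k IH].
  rewrite addn0 expr0 mulr1 mulrC ler_wpM2r ?invr_ge0 // lerXn2r // nnegrE //.
rewrite addnS factS exprS natrM invfM.
have h1 : (N + k).+1%:R^-1 * `|x| <= 1 / 2.
  rewrite mulrC ler_pdivrMr ?ltr0n //; apply: le_trans x2 _.
  have : (4 : R) <= (N + k).+1%:R by rewrite ler_nat; lia.
  by lra.
have -> : (N + k).+1%:R^-1 * (N + k)`!%:R^-1 * (`|x| * `|x| ^+ (N + k)) =
  ((N + k)`!%:R^-1 * `|x| ^+ (N + k)) * ((N + k).+1%:R^-1 * `|x|) by ring.
rewrite [(1 / 2) ^+ k.+1]exprSr [leRHS]mulrA; apply: ler_pM => //; rewrite ?mulr_ge0 ?invr_ge0 ?exprn_ge0 //.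
Qed.

(** A certificate for a decimal approximation x of pi/2: its cosine, computed from
    the Taylor series, is small. The converse estimate is Jordan's inequality. *)
Lemma halfpi_near (x e : R) : 1 <= x <= 2 -> `|cos x| <= e -> `|pi / 2 - x| <= 2 * e.
Proof.
move=> /andP[x1 x2] hc.
have p1 : (1 : R) <= pi / 2 := pihalf_ge1 R; have p2 : pi / 2 < 2 := pihalf_lt2 R.
have h : `|pi / 2 - x| <= pi / 2 by rewrite ler_norml; lra.
apply: le_trans (jordan_norm h) _.
rewrite sinB cos_pihalf sin_pihalf mul1r mul0r subr0.
by apply: ler_pM => //; [lra | exact: ltW].
Qed.

End ExpTaylor.

(** * Ball arithmetic *)

Delimit Scope Z_scope with ZZ.

Section Embedding.
Variable R : realType.
Local Notation C := (R[i] : numFieldType).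

(** Binary integers as reals. *)
Definition zr (n : Z) : R := (int_of_Z n)%:~R.

Lemma zrD m n : zr (m + n)%ZZ = zr m + zr n.
Proof. by rewrite /zr -rmorphD -raddfD. Qed.

Lemma zrN n : zr (- n)%ZZ = - zr n.
Proof. by rewrite /zr -rmorphN -raddfN. Qed.

Lemma zrB m n : zr (m - n)%ZZ = zr m - zr n.
Proof. by rewrite -zrN -zrD. Qed.

Lemma zrM m n : zr (m * n)%ZZ = zr m * zr n.
Proof. by rewrite /zr -rmorphM -rmorphM. Qed.

Lemma zr0 : zr 0%ZZ = 0. Proof. by []. Qed.
Lemma zr1 : zr 1%ZZ = 1. Proof. by []. Qed.

Lemma zr_nat n : zr (Z.of_nat n) = n%:R.
Proof. by rewrite /zr -[RHS]mulrz_nat; congr (_ %:~R); lia. Qed.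

Lemma zr_le m n : (m <= n)%ZZ -> zr m <= zr n.
Proof. by move=> h; rewrite /zr ler_int; lia. Qed.

Lemma zr_lt m n : (m < n)%ZZ -> zr m < zr n.
Proof. by move=> h; rewrite /zr ltr_int; lia. Qed.

Lemma zr_gt0 n : (0 < n)%ZZ -> 0 < zr n.
Proof. exact: zr_lt. Qed.

Lemma zr_norm n : `|zr n| = zr (Z.abs n).
Proof. by rewrite /zr -intr_norm; congr (_ %:~R); lia. Qed.

Lemma zr_div m n : (0 < n)%ZZ -> zr (m / n)%ZZ <= zr m / zr n < zr (m / n)%ZZ + 1.
Proof.
move=> n0; have n0' := zr_lt n0; rewrite zr0 in n0'.
rewrite ler_pdivlMr // ltr_pdivrMr // -zr1 -zrD -!zrM.
have h := Z.div_mod m n; have h2 := Z.mod_pos_bound m n n0.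
by apply/andP; split; [apply: zr_le | apply: zr_lt]; nia.
Qed.

Definition zc (x y : Z) : C := zr x +i* zr y.

Lemma cabs_zc x y : cabs (zc x y) <= zr (Z.abs x + Z.abs y)%ZZ.
Proof. by rewrite zrD -!zr_norm; exact: cabs_ReIm. Qed.

Lemma zcD x y x' y' : zc x y + zc x' y' = zc (x + x')%ZZ (y + y')%ZZ.
Proof. by rewrite /zc !zrD. Qed.

Lemma zcN x y : - zc x y = zc (- x)%ZZ (- y)%ZZ.
Proof. by rewrite /zc !zrN. Qed.

Lemma zcM x y x' y' : zc x y * zc x' y' = zc (x * x' - y * y')%ZZ (x * y' + y * x')%ZZ.
Proof. by rewrite /zc zrB zrD !zrM; simpc. Qed.

Lemma zc_real x : zc x 0%ZZ = (zr x)%:C.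
Proof. by []. Qed.

End Embedding.

(** A complex ball in fixed-point arithmetic: at scale s, the integers x, y, r
    stand for the set of all z with |s z - (x + i y)| <= r. *)
Record cball := Ball { bre : Z; bim : Z; brad : Z }.

Section Operations.
Variable prec : Z.
Local Notation SC := (2 ^ prec)%ZZ.
Local Notation "x >> n" := (Z.shiftr x n) (at level 40) : Z_scope.

Definition bconst x y := Ball x y 0%ZZ.

Definition badd a b :=
  Ball (bre a + bre b)%ZZ (bim a + bim b)%ZZ (brad a + brad b)%ZZ.

Definition bopp a := Ball (- bre a)%ZZ (- bim a)%ZZ (brad a).

(** An upper bound of s |z| for z in the ball. *)
Definition bub a := (Z.abs (bre a) + Z.abs (bim a) + brad a)%ZZ.

(** The 3 makes up for three roundings: of the two coordinates of the centre and of
    the radius. *)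
Definition bmul a b :=
  Ball ((bre a * bre b - bim a * bim b) >> prec)%ZZ
       ((bre a * bim b + bim a * bre b) >> prec)%ZZ
       ((brad a * bub b + (Z.abs (bre a) + Z.abs (bim a)) * brad b) >> prec + 3)%ZZ.

Definition bdivn a n := Ball (bre a / n)%ZZ (bim a / n)%ZZ (brad a / n + 3)%ZZ.

(** Enclosure of 1/v by a residual: t approximates the inverse of the centre, and
    1/v - t = (1 - t v) / v is bounded by means of an a priori bound K of 1/|v|. *)
Definition binv K v :=
  let n := (bre v * bre v + bim v * bim v)%ZZ in
  let tx := (bre v * (SC * SC) / n)%ZZ in
  let ty := (- (bim v * (SC * SC)) / n)%ZZ in
  let ex := (SC * SC - (tx * bre v - ty * bim v))%ZZ in
  let ey := (tx * bim v + ty * bre v)%ZZ in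
  Ball tx ty ((Z.abs ex + Z.abs ey + (Z.abs tx + Z.abs ty) * brad v) * K >> prec + 1)%ZZ.

End Operations.

Section BallSound.
Variable R : realType.
Variable prec : Z.
Hypothesis prec0 : (0 <= prec)%ZZ.
Local Notation SC := (2 ^ prec)%ZZ.
Let SC0 : (0 < SC)%ZZ. Proof. by apply: Z.pow_pos_nonneg. Qed.
Local Notation C := (R[i] : numFieldType).
Local Notation u := (zr R SC).
Local Notation zr := (zr R).
Local Notation zc := (zc R).

Definition in_ball b (z : C) := cabs (z * u%:C - zc (bre b) (bim b)) <= zr (brad b).

Lemma u_gt0 : 0 < u. Proof. exact: zr_gt0. Qed.
Let uC0 : u%:C != 0 :> C.
Proof. by rewrite -cabs_eq0 cabs_real normr_eq0 gt_eqF // u_gt0. Qed.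

Lemma brad_ge0 b z : in_ball b z -> 0 <= zr (brad b).
Proof. exact: le_trans (cabs_ge0 _). Qed.

Lemma bconst_sound x y : in_ball (bconst x y) (zc x y / u%:C).
Proof. by rewrite /in_ball divfK // subrr cabs0 lexx. Qed.

Lemma bub_sound b z : in_ball b z -> cabs z * u <= zr (bub b).
Proof.
move=> h; rewrite -[u in cabs z * u]gtr0_norm ?u_gt0 // -cabs_real -cabsM.
rewrite -[z * _](subrK (zc (bre b) (bim b))); apply: le_trans (cabsD _ _) _.
by rewrite /bub (zrD R (Z.abs _ + _)%ZZ) addrC; apply: lerD => //; exact: cabs_zc.
Qed.

Lemma badd_sound a b z w : in_ball a z -> in_ball b w -> in_ball (badd a b) (z + w).
Proof.
move=> ha hb; rewrite /in_ball /= -zcD (zrD R (brad a)) mulrDl opprD addrACA.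
by apply: le_trans (cabsD _ _) _; exact: lerD.
Qed.

Lemma bopp_sound a z : in_ball a z -> in_ball (bopp a) (- z).
Proof. by rewrite /in_ball /= -zcN mulNr -opprD cabsN. Qed.

Lemma zc_div x y n : (0 < n)%ZZ ->
  cabs (zc x y / (zr n)%:C - zc (x / n)%ZZ (y / n)%ZZ) <= 2.
Proof.
move=> n0; apply: le_trans (cabs_ReIm _) _.
have -> : zc x y / (zr n)%:C = (zr x / zr n) +i* (zr y / zr n).
  rewrite -fmorphV /zc; by simpc.
have /andP[h1 h2] := zr_div R x n0; have /andP[h3 h4] := zr_div R y n0.
by rewrite /= !ger0_norm ?subr_ge0 //; lra.
Qed.

Lemma bmul_sound a b z w : in_ball a z -> in_ball b w -> in_ball (bmul prec a b) (z * w).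
Proof.
move=> ha hb; have hbw := bub_sound hb; rewrite /in_ball /= !Z.shiftr_div_pow2 // [zr (_ + _)%ZZ]zrD.
have ra := brad_ge0 ha; have rb := brad_ge0 hb.
set x := (bre a * _ - _)%ZZ; set y := (bre a * _ + _)%ZZ.
have gen (U B D : C) : U != 0 -> z * w * U - D = (z * U * (w * U) - B) / U + (B / U - D).
  by move=> U0; field.
rewrite (gen _ (zc x y) _ uC0).
apply: le_trans (cabsD _ _) _.
have h1 := @zc_div x y SC SC0.
set t := (_ * bub b + _)%ZZ.
suff h2 : cabs ((z * u%:C * (w * u%:C) - zc x y) / u%:C) <= zr (t / SC)%ZZ + 1.
  have := lerD h2 h1; rewrite (_ : zr 3%ZZ = 3) //; lra.
have /andP[_ h3] := @zr_div R t SC SC0.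
rewrite cabs_div cabs_real gtr0_norm ?u_gt0 //.
apply: le_trans (ltW h3); rewrite ler_pdivrMr ?u_gt0 // divfK ?gt_eqF ?u_gt0 //.
rewrite /x /y -zcM.
set W1 := zc _ _; set W2 := zc _ _.
have gen2 (Z1 W A B : C) : Z1 * W - A * B = (Z1 - A) * W + A * (W - B) by ring.
rewrite gen2.
apply: le_trans (cabsD _ _) _; rewrite /t (zrD R (brad a * _)) 2!zrM !cabsM; apply: lerD.
  apply: ler_pM => //; rewrite ?mulr_ge0 ?cabs_ge0 //.
  by rewrite cabs_real gtr0_norm ?u_gt0.
by apply: ler_pM => //; rewrite ?cabs_ge0 // cabs_zc.
Qed.

Lemma bdivn_sound a z n : (0 < n)%N -> in_ball a z ->
  in_ball (bdivn a (Z.of_nat n)) (z / n%:R).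
Proof.
move=> n0 ha; set m := Z.of_nat n; have m0 : (0 < m)%ZZ by rewrite /m; lia.
have mE : (zr m)%:C = n%:R :> C by rewrite zr_nat rmorph_nat.
have nR : (n%:R : C) != 0 by rewrite pnatr_eq0 -lt0n.
rewrite /in_ball /= [zr (_ + _)%ZZ]zrD.
have gen (U N B D : C) : N != 0 -> z / N * U - D = (z * U - B) / N + (B / N - D).
  by move=> N0; field.
rewrite (gen _ _ (zc (bre a) (bim a)) _ nR) -{2}mE.
apply: le_trans (cabsD _ _) _.
have h1 := @zc_div (bre a) (bim a) m m0.
suff h2 : cabs ((z * u%:C - zc (bre a) (bim a)) / n%:R) <= zr (brad a / m)%ZZ + 1.
  have := lerD h2 h1; rewrite (_ : zr 3%ZZ = 3) //; lra.
have /andP[_ h3] := @zr_div R (brad a) m m0.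
apply: le_trans (ltW h3); rewrite cabs_div cabs_nat zr_nat.
by rewrite ler_wpM2r // invr_ge0.
Qed.

Lemma binv_sound K v z : in_ball v z -> (0 < K)%ZZ -> 1 <= zr K * cabs z -> in_ball (binv prec K v) z^-1.
Proof.
move=> hv K0 hK; rewrite /in_ball /binv /= !Z.shiftr_div_pow2 //.
set n := (_ * _ + _ * _)%ZZ; set tx := (_ / n)%ZZ; set ty := (_ / n)%ZZ.
set ex := (_ - (_ - _))%ZZ; set ey := (tx * bim v + ty * bre v)%ZZ.
have K0' : 0 < zr K by exact: zr_gt0.
have z0 : z != 0.
  by apply/eqP => z0; move: hK; rewrite z0 cabs0 mulr0 ler10.
have gen (U D : C) : U != 0 -> z^-1 * U - D = (U * U - D * (z * U)) / (z * U).
  by move=> U0; field; exact/andP.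
rewrite (gen _ _ uC0).
rewrite cabs_div [cabs (z * _)]cabsM cabs_real gtr0_norm ?u_gt0 // [zr (_ + 1)%ZZ]zrD.
set E := (_ * K)%ZZ; have /andP[_ h3] := @zr_div R E SC SC0.
apply: le_trans (ltW h3).
have zi : (cabs z * u)^-1 <= zr K / u.
  by rewrite invfM ler_wpM2r ?invr_ge0 ?(ltW u_gt0) // -[leLHS]mul1r ler_pdivrMr ?cabs_gt0.
rewrite /E zrM -mulrA; apply: ler_pM => //; rewrite ?cabs_ge0 ?invr_ge0 ?mulr_ge0 ?cabs_ge0 ?(ltW u_gt0) //.
have gen2 (U T W B : C) : U - T * W = (U - T * B) - T * (W - B) by ring.
rewrite (gen2 _ _ _ (zc (bre v) (bim v))).
apply: le_trans (cabsD _ _) _; rewrite (zrD R (Z.abs ex + Z.abs ey)); apply: lerD.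
  have -> : u%:C * u%:C - zc tx ty * zc (bre v) (bim v) = zc ex (- ey)%ZZ :> C.
    by rewrite -!zc_real !zcM zcN zcD /ex /ey; congr zc; lia.
  by have := cabs_zc R ex (- ey)%ZZ; rewrite Z.abs_opp.
rewrite cabsN cabsM zrM; apply: ler_pM => //; rewrite ?cabs_ge0 // cabs_zc //.
Qed.

End BallSound.

(** * Polynomials with ball coefficients *)

Local Notation b0 := (bconst 0%ZZ 0%ZZ).

(** Polynomials are lists of balls for the coefficients, constant term first. *)
Fixpoint ladd (l m : seq cball) : seq cball :=
  match l, m with
  | a :: l', b :: m' => badd a b :: ladd l' m'
  | [::], _ => m
  | _, [::] => l
  end.

Definition bmid b := bconst (bre b) (bim b).

Section ListOps.
Variable prec : Z.
Local Notation SC := (2 ^ prec)%ZZ.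

Fixpoint lmul (l m : seq cball) : seq cball :=
  if l is a :: l' then ladd (map (bmul prec a) m) (b0 :: lmul l' m) else [::].

Fixpoint heval (l : seq cball) (x : cball) : cball :=
  if l is a :: l' then badd a (bmul prec x (heval l' x)) else b0.

(** Horner's scheme for moduli: s times a bound of |p x| for s |x| <= r. *)
Fixpoint hbound (l : seq cball) (r : Z) : Z :=
  if l is a :: l' then (bub a + (Z.shiftr (hbound l' r * r) prec + 1))%ZZ else 0%ZZ.

Fixpoint bdot (l m : seq cball) : cball :=
  match l, m with
  | a :: l', b :: m' => badd (bmul prec a b) (bdot l' m')
  | _, _ => b0
  end.

(** The first n coefficients of the power series r / (1 + X c), with the earlier
    ones in acc, latest first. The radii are dropped: any list of numbers may serve
    as the multiplier in the certificate below. *)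
Fixpoint lquo n (r c acc : seq cball) : seq cball :=
  if n is n'.+1
  then lquo n' (behead r) c (bmid (badd (head b0 r) (bopp (bdot c acc))) :: acc)
  else rev acc.

Fixpoint exp_balls n k (b : cball) : seq cball :=
  if n is n'.+1 then b :: exp_balls n' k.+1 (bdivn b (Z.of_nat k.+1)) else [::].

(** The recursion c_(k+1) = c_k q^(2k+1) / (1 - q^(k+1)), where qk and ck enclose q^k
    and c_k. The divisor has modulus at least 1 / (18 (k + 1)) by [dioph_tau]. *)
Fixpoint RR_balls (q : cball) n k (qk ck : cball) : seq cball :=
  if n is n'.+1 then
    let qk1 := bmul prec qk q in
    let d := binv prec (18 * Z.of_nat k.+1) (badd (bconst SC 0) (bopp qk1)) in
    ck :: RR_balls q n' k.+1 qk1 (bmul prec (bmul prec ck (bmul prec qk qk1)) d)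
  else [::].

End ListOps.

Local Arguments Z.of_nat : simpl never.
Local Arguments Z.mul : simpl never.

Section ListSound.
Variable R : realType.
Variable prec : Z.
Hypothesis prec0 : (0 <= prec)%ZZ.
Local Notation SC := (2 ^ prec)%ZZ.
Let SC0 : (0 < SC)%ZZ. Proof. by apply: Z.pow_pos_nonneg. Qed.
Local Notation C := (R[i] : numFieldType).
Local Notation u := (zr R SC).
Local Notation inb b z := (@in_ball R prec b z).

Lemma b0_sound : inb b0 0.
Proof. by rewrite /in_ball /= mul0r sub0r cabsN cabs0. Qed.

Fixpoint encloses (l : seq cball) (p : {poly R[i]}) : Prop :=
  if l is a :: l' then
    exists z p', [/\ inb a z, encloses l' p' & p = p' * 'X + z%:P]
  else p = 0.

Lemma ladd_sound l m p g : encloses l p -> encloses m g -> encloses (ladd l m) (p + g).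
Proof.
elim: l m p g => [|a l IH] [|b m] p g //=.
- by move=> -> ->; rewrite addr0.
- by move=> ->; rewrite add0r.
- by move=> h ->; rewrite addr0.
move=> [z [p' [hz hp ->]]] [w [g' [hw hg ->]]].
exists (z + w), (p' + g'); split; [exact: badd_sound|exact: IH|].
by rewrite polyCD; ring.
Qed.

Lemma lscale_sound a l x p : inb a x -> encloses l p ->
  encloses (map (bmul prec a) l) (x%:P * p).
Proof.
move=> ha; elim: l p => [|b l IH] p /=; first by move=> ->; rewrite mulr0.
move=> [z [p' [hz hp ->]]]; exists (x * z), (x%:P * p'); split.
- exact: bmul_sound.
- exact: IH.
- by rewrite polyCM; ring.
Qed.

Lemma lopp_sound l p : encloses l p -> encloses (map bopp l) (- p).
Proof.
elim: l p => [|b l IH] p /=; first by move=> ->; rewrite oppr0.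
move=> [z [p' [hz hp ->]]]; exists (- z), (- p'); split.
- exact: bopp_sound.
- exact: IH.
- by rewrite polyCN; ring.
Qed.

Lemma lshift_sound l p : encloses l p -> encloses (b0 :: l) (p * 'X).
Proof. by move=> h; exists 0, p; split=> //; [exact: b0_sound|rewrite addr0]. Qed.

Lemma lmul_sound l m p g : encloses l p -> encloses m g -> encloses (lmul prec l m) (p * g).
Proof.
move=> + hg; elim: l p => [|b l IH] p /=; first by move=> ->; rewrite mul0r.
move=> [z [p' [hz hp ->]]].
have -> : (p' * 'X + z%:P) * g = z%:P * g + (p' * g) * 'X by ring.
by apply: ladd_sound; [exact: lscale_sound|apply: lshift_sound; exact: IH].
Qed.

Lemma heval_sound l a p x : inb a x -> encloses l p -> inb (heval prec l a) p.[x].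
Proof.
move=> ha; elim: l p => [|b l IH] p /=; first by move=> ->; rewrite horner0; exact: b0_sound.
move=> [z [p' [hz hp ->]]]; rewrite hornerD hornerC hornerMX addrC mulrC.
by apply: badd_sound => //; apply: bmul_sound => //; exact: IH.
Qed.

Lemma hbound_sound l r p x : cabs x * u <= zr R r -> encloses l p ->
  cabs p.[x] * u <= zr R (hbound prec l r).
Proof.
move=> hx; have u0 := u_gt0 R prec0.
elim: l p => [|b l IH] p /=; first by move=> ->; rewrite horner0 cabs0 mul0r.
move=> [z [p' [hz hp ->]]]; rewrite hornerD hornerC hornerMX addrC.
rewrite Z.shiftr_div_pow2 // (zrD R (bub b)) (zrD R (_ / _)%ZZ).
apply: (@le_trans _ _ ((cabs z + cabs (p'.[x] * x)) * u)).
  by rewrite ler_wpM2r ?cabsD // ltW.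
rewrite mulrDl; apply: lerD; first exact: bub_sound.
have /andP[_ h3] := @zr_div R (hbound prec l r * r) SC SC0.
apply: le_trans (ltW h3); rewrite ler_pdivlMr // cabsM zrM.
have -> : cabs p'.[x] * cabs x * u * u = (cabs p'.[x] * u) * (cabs x * u) by ring.
by apply: ler_pM; rewrite ?mulr_ge0 ?cabs_ge0 ?(ltW u0) //; exact: IH.
Qed.

Lemma bmid_sound b : inb (bmid b) (zc R (bre b) (bim b) / u%:C).
Proof. exact: bconst_sound. Qed.

Definition bcenter b : C := zc R (bre b) (bim b) / u%:C.

Lemma encloses_mid l : encloses (map bmid l) (Poly (map bcenter l)).
Proof.
elim: l => [|b l IH] //=.
exists (bcenter b), (Poly (map bcenter l)); split=> //; first exact: bmid_sound.
by rewrite cons_poly_def.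
Qed.

Lemma encloses_Poly (l : seq cball) (c : nat -> C) k :
  (forall i, (i < size l)%N -> inb (nth b0 l i) (c (k + i)%N)) ->
  encloses l (Poly [seq c j | j <- iota k (size l)]).
Proof.
elim: l k => [|b l IH] k h //=.
exists (c k), (Poly [seq c j | j <- iota k.+1 (size l)]); split.
- by have := h 0%N isT; rewrite addn0.
- by apply: IH => i il; rewrite addSnnS; exact: (h i.+1).
- by rewrite cons_poly_def.
Qed.

Lemma Poly_power_series (c : nat -> C) n z :
  (Poly [seq c j | j <- iota 0 n]).[z] = power_series c z n.
Proof.
rewrite /power_series /series /= big_mkord (@horner_coef_wide _ n); last first.
  by rewrite (leq_trans (size_Poly _)) // size_map size_iota.
apply: eq_bigr => i _.
by rewrite coef_Poly (nth_map 0%N) ?size_iota // nth_iota.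
Qed.

Lemma RR_balls_size qb n k qk ck : size (RR_balls prec qb n k qk ck) = n.
Proof. by elim: n k qk ck => //= n IH k qk ck; rewrite IH. Qed.

Lemma RR_balls_sound (q : C) (c : nat -> C) qb n k qk ck i :
  (forall j, (0 < j)%N -> 1 <= 18 * j%:R * cabs (1 - q ^+ j)) ->
  (forall j, c j.+1 = c j * (q ^+ j * q ^+ j.+1) * (1 - q ^+ j.+1)^-1) ->
  inb qb q -> inb qk (q ^+ k) -> inb ck (c k) -> (i < n)%N ->
  inb (nth b0 (RR_balls prec qb n k qk ck) i) (c (k + i)%N).
Proof.
move=> hd hc hq; elim: n k qk ck i => // n IH k qk ck [|i] hqk hck il /=.
  by rewrite addn0.
rewrite -addSnnS; have hq1 : inb (bmul prec qk qb) (q ^+ k.+1).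
  by rewrite exprSr; exact: bmul_sound.
apply: IH => //; rewrite hc; apply: bmul_sound => //.
  by apply: bmul_sound => //; exact: bmul_sound.
apply: binv_sound; [exact: prec0| |lia|by rewrite zrM zr_nat; exact: hd].
apply: badd_sound; last exact: bopp_sound.
have := @bconst_sound R prec prec0 SC 0; rewrite zc_real divff //.
by rewrite -cabs_eq0 cabs_real normr_eq0 gt_eqF // u_gt0.
Qed.

Lemma exp_balls_size n k b : size (exp_balls n k b) = n.
Proof. by elim: n k b => //= n IH k b; rewrite IH. Qed.

Lemma exp_balls_sound n k b i : inb b (k`!%:R^-1) -> (i < n)%N ->
  inb (nth b0 (exp_balls n k b) i) ((k + i)`!%:R^-1).
Proof.
elim: n k b i => // n IH k b [|i] hb il /=; first by rewrite addn0.
rewrite -addSnnS; apply: IH => //.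
have -> : ((k.+1)`!%:R : C)^-1 = k`!%:R^-1 / k.+1%:R by rewrite factS natrM invfM mulrC.
exact: bdivn_sound.
Qed.

End ListSound.

(** * The numerical certificate *)

Section Certificate.
Variable prec : Z.
Local Notation scale := (2 ^ prec)%ZZ.

Fixpoint Zfact n : Z := if n is n'.+1 then (Z.of_nat n * Zfact n')%ZZ else 1%ZZ.

(** In units of 2^-prec; exceeds the error 2 2^30 / 30! of the Taylor polynomial of
    degree 29 for prec = 84. *)
Definition taylor_err : Z := 200.
Definition bone := bconst scale 0.
Definition exp_list := exp_balls 30 0 bone.
Definition bexp b :=
  let e := heval prec exp_list b in Ball (bre e) (bim e) (brad e + taylor_err).

(** An untrusted decimal approximation of pi/2; its error is measured by its
    cosine, the real part of exp (i x), as in [halfpi_near]. *)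
Definition halfpi : Z := (scale * 1570796326794896619231321691639751 / 10 ^ 33)%ZZ.
Definition halfpi_err : Z :=
  let e := bexp (bconst 0 halfpi) in (2 * (Z.abs (bre e) + brad e))%ZZ.
Definition bhalfpi := Ball halfpi 0 halfpi_err.
Definition bsqrt5 := Ball (Z.sqrt (5 * (scale * scale))) 0 1.
Definition btheta :=
  bmul prec (bmul prec (bconst (8 * scale) 0) bhalfpi)
    (binv prec 1 (badd (bconst (99 * scale) 0) bsqrt5)).
Definition bq := bexp (bmul prec (bconst 0 scale) btheta).

Definition RR_list := RR_balls prec bq 100 0 bone bone.
(** Coefficients from 26 on are so small on the disc that their contribution is
   bounded in modulus only, without multiplying out. *)
Definition RR_low := take 26 RR_list.
Definition RR_high := nseq 26 (bconst 0 0) ++ drop 26 RR_list.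

(** Approximations of four zeros of G_q to 25 decimals. The first two lie in the
    disc |w| <= 0.44. The other two, of moduli about 0.48 and 0.55, are divided out
    because they limit the convergence of 1/G_q on that disc. *)
Definition decimal (n : Z) : Z := (scale * n / 10 ^ 25)%ZZ.
Definition root1 := bconst (decimal (-2990759815584495551199495)) (decimal 1450520873883277828131355).
Definition root2 := bconst (decimal (-2695270309223379290308742)) (decimal 3060355020532657399634502).
Definition root3 := bconst (decimal (-1815942957850855410395496)) (decimal 4433033483681012021371259).
Definition root4 := bconst (decimal (-483982245067014898998181)) (decimal 5472979420737381639483488).

Definition linear_list z := [:: bopp z; bone].
Definition target := foldr (fun z l => lmul prec (linear_list z) l) [:: bone]
  [:: root1; root2; root3; root4].
(** The power series of target / G_q up to degree 39. Its truncation and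
    rounding need no analysis, as multiplier * G_q - target is bounded directly. *)
Definition multiplier := lquo prec 40 target (behead RR_list) [::].
Definition defect := ladd (lmul prec (map bmid multiplier) RR_low) (map bopp target).
Definition disc_radius : Z := (scale * 44 / 100 + 1)%ZZ.

Definition norm2 b := (bre b * bre b + bim b * bim b)%ZZ.
Definition norm_le b n m := Z.leb (n * n * norm2 b) (m * m * (scale * scale)).
Definition norm_ge b n m := Z.leb (m * m * (scale * scale)) (n * n * norm2 b).
(** |c_n| <= 45 (8/5)^n for n < 100, the finite part of [qpochV_bounded] for A = 18
    and r = 8/5, where A r / (r - 1)^2 = 80. *)
Definition growth_ok :=
  all (fun p => Z.leb (bub p.1 * 5 ^ Z.of_nat p.2) (45 * scale * 8 ^ Z.of_nat p.2))
    (zip RR_list (iota 0 100)).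

Definition expi_ok :=
  [&& Z.leb (2 * 2 ^ 30 * scale) (taylor_err * Zfact 30),
      Z.leb scale halfpi & Z.leb halfpi (2 * scale)].
Definition multiplier_ok d k h l :=
  [&& Z.leb (1000 * (1000 * d)) (2 * scale), Z.leb k scale,
      Z.leb (1000 * (1000 * (1000 * h))) scale & Z.leb l (49 * scale)].
Definition residual_ok x :=
  Z.leb (5 * (1000 * (1000 * (1000 * (1000 * x))))) scale.
Definition moduli_ok :=
  [&& norm_ge root1 1000 330, norm_le root1 1000 335,
      norm_ge root2 1000 405 & norm_le root2 1000 410].
Definition separation_ok :=
  [&& norm_ge root3 1000 479, norm_ge root4 1000 549,
      norm_ge (badd root1 (bopp root2)) 1000 160 &
      Z.leb (50 * (scale * scale)) (1000 * (bim root1 * bre root2 - bre root1 * bim root2))].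

(** One boolean over the integers that implies all numerical facts used about G_q.
    The big quantities are passed as arguments to the tests so that they occur
    once, and stay abstract in the soundness proofs. *)
Definition certificate :=
  [&& [&& expi_ok, growth_ok & multiplier_ok (hbound prec defect disc_radius)
         (hbound prec (map bmid multiplier) disc_radius) (hbound prec RR_high disc_radius)
         (hbound prec RR_list disc_radius)],
      [&& residual_ok (bub (heval prec RR_list root1)) &
          residual_ok (bub (heval prec RR_list root2))], moduli_ok & separation_ok].

End Certificate.

Lemma certificate_ok : certificate 84.
Proof. by vm_compute. Qed.

(** * Soundness of the certificate *)

Local Arguments Z.pow : simpl never.

Lemma growth_constants (R : realType) : (1 : R) < 8 / 5 /\ 18 * (8 / 5) / (8 / 5 - 1) ^+ 2 <= 100%:R :> R.
Proof.
split; first by lra.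
have d0 : 0 < 8 / 5 - 1 :> R by lra.
by rewrite ler_pdivrMr ?exprn_gt0 //; lra.
Qed.

Section Numerics.
Variable R : realType.
Variable prec : Z.
Hypothesis prec0 : (0 <= prec)%ZZ.
Hypothesis cert : certificate prec.
Local Notation scale := (2 ^ prec)%ZZ.
Local Notation C := (R[i] : numFieldType).
Local Notation u := (zr R scale).
Local Notation inb b z := (@in_ball R prec b z).
Local Notation tau := (2 / (99 + Num.sqrt 5) : R).
Local Notation q := (expi (2 * pi * tau) : C).
Local Notation c := (RR_coef q).
Local Notation b0 := (bconst 0%ZZ 0%ZZ).

Lemma scale_gt0 : (0 < scale)%ZZ.
Proof. exact: Z.pow_pos_nonneg. Qed.

Lemma unit_gt0 : 0 < u.
Proof. exact: zr_gt0 scale_gt0. Qed.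

Lemma unit_neq0 : u%:C != 0 :> C.
Proof. by rewrite -cabs_eq0 cabs_real normr_eq0 gt_eqF // unit_gt0. Qed.

Lemma bone_sound : inb (bone prec) 1.
Proof.
have := @bconst_sound R prec prec0 scale 0; rewrite zc_real divff //.
exact: unit_neq0.
Qed.

Lemma zr_fact n : zr R (Zfact n) = n`!%:R.
Proof. by elim: n => [|n IH] //; rewrite [Zfact _]/= zrM zr_nat IH factS natrM. Qed.

Lemma zr_pow (a : nat) n : zr R (Z.of_nat a ^ Z.of_nat n)%ZZ = a%:R ^+ n.
Proof.
elim: n => [|n IH] //.
by rewrite Nat2Z.inj_succ Z.pow_succ_r ?zrM ?IH ?zr_nat ?exprS //; lia.
Qed.

Lemma zr_leb m n : Z.leb m n -> zr R m <= zr R n.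
Proof. by move=> h; apply: zr_le; exact: (elimT (Z.leb_spec0 _ _) h). Qed.

Lemma zr_num (n : nat) (m : Z) : m = Z.of_nat n -> zr R m = n%:R.
Proof. by move=> ->; exact: zr_nat. Qed.

Lemma taylor_check : 2 * (2 ^+ 30 / 30`!%:R) * u <= zr R taylor_err.
Proof.
have /and4P[/and3P[/and3P[/zr_leb h _ _] _ _] _ _ _] := cert; move: h.
rewrite (zrM R taylor_err) zr_fact (zrM R (2 * _)%ZZ) (zrM R 2) (zr_pow 2 30) (@zr_num 2) // => h1.
have f0 : (0 : R) < 30`!%:R by rewrite ltr0n fact_gt0.
move: (30`!%:R) f0 h1 => f f0 h1.
by rewrite mulrA mulrAC ler_pdivrMr.
Qed.

Lemma exp_list_sound : @encloses R prec (exp_list prec) (Poly [seq exp_coef R j | j <- iota 0 30]).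
Proof.
have := @encloses_Poly R prec (exp_list prec) (exp_coef R) 0.
rewrite exp_balls_size; apply => i i30; apply: exp_balls_sound => //.
by rewrite fact0 invr1; exact: bone_sound.
Qed.

(** How a truncation error enters the radius. *)
Lemma in_ball_widen x y (r r' : Z) z w : inb (Ball x y r) z ->
  cabs (w - z) * u <= zr R r' -> inb (Ball x y (r + r')%ZZ) w.
Proof.
rewrite /in_ball /= zrD => h1 h2.
have gen (U D : C) : w * U - D = (z * U - D) + (w - z) * U by ring.
rewrite (gen _ (zc R x y)); apply: le_trans (cabsD _ _) _; apply: lerD => //.
by rewrite cabsM cabs_real gtr0_norm ?unit_gt0.
Qed.

Lemma bexp_sound b (x : R) : `|x| <= 2 -> inb b ('i * x%:C) -> inb (bexp prec b) (expi x).
Proof.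
move=> x2 hb; have := heval_sound prec0 hb exp_list_sound.
rewrite Poly_power_series /bexp; case: (heval _ _ _) => X Y r /= h.
apply: in_ball_widen h _; apply: le_trans taylor_check.
by rewrite ler_wpM2r ?(ltW unit_gt0) //; exact: expi_taylor.
Qed.

Lemma bhalfpi_sound : inb (bhalfpi prec) ((pi / 2)%:C).
Proof.
have /and4P[/and3P[/and3P[_ /zr_leb h1 /zr_leb h2] _ _] _ _ _] := cert.
move: h2; rewrite zrM (_ : zr R 2 = 2) // => h2.
set h := zr R (halfpi prec) in h1 h2.
have u0 := unit_gt0.
have x12 : 1 <= h / u <= 2.
  by rewrite ler_pdivlMr // ler_pdivrMr // mul1r h1.
have hb : inb (bconst 0 (halfpi prec)) ('i * (h / u)%:C).
  have := @bconst_sound R prec prec0 0 (halfpi prec).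
  have -> : zc R 0 (halfpi prec) / u%:C = 'i * (h / u)%:C :> C.
    by rewrite rmorphM fmorphV mulrA /zc; congr (_ / _); simpc.
  by [].
have := bexp_sound _ hb; rewrite ger0_norm; last by case/andP: x12 => ? _; lra.
case/andP: (x12) => _ x2 /(_ x2); rewrite /bhalfpi /halfpi_err.
case: (bexp _ _) => X Y r; rewrite /in_ball /= => hc.
have hcos : `|cos (h / u)| <= zr R (Z.abs X + r)%ZZ / u.
  rewrite ler_pdivlMr // zrD -zr_norm.
  have := le_trans (cabs_Re _) hc; rewrite /expi /zc; simpc => /= hre.
  rewrite -[u in _ * u]gtr0_norm // -normrM.
  have -> : cos (h / u) * u = (cos (h / u) * u - zr R X) + zr R X by rewrite subrK.
  by apply: le_trans (ler_normD _ _) _; rewrite addrC lerD2l.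
have := halfpi_near x12 hcos; rewrite zc_real -rmorphM -rmorphB cabs_real.
rewrite (zrM R 2) (_ : zr R 2 = 2) // => hn.
have -> : pi / 2 * u - zr R (halfpi prec) = (pi / 2 - h / u) * u.
  by rewrite mulrBl divfK // gt_eqF.
rewrite normrM (gtr0_norm u0) -ler_pdivlMr //; apply: le_trans hn _.
by rewrite mulrA.
Qed.

Lemma bsqrt5_sound : inb (bsqrt5 prec) ((Num.sqrt 5)%:C).
Proof.
rewrite /in_ball /= zc_real -rmorphM -rmorphB cabs_real zr1.
have S0 := scale_gt0; have u0 := unit_gt0.
have h := Z.sqrt_spec (5 * (scale * scale)); set s := Z.sqrt _ in h *.
have [h1 h2] := h ltac:(nia); have s0 : (0 <= s)%ZZ := Z.sqrt_nonneg _.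
have {}h1 := zr_le R h1; have {}h2 := zr_lt R h2.
rewrite /Z.succ !zrM !zrD zr1 in h1 h2; rewrite (_ : zr R 5 = 5) // in h1 h2.
have {}s0 := zr_le R s0; rewrite zr0 in s0.
have v0 : 0 <= Num.sqrt 5 * u by rewrite mulr_ge0 ?sqrtr_ge0 // ltW.
have vE : (Num.sqrt 5 * u) * (Num.sqrt 5 * u) = 5 * (u * u).
  by rewrite mulrACA -expr2 sqr_sqrtr.
rewrite -vE in h1 h2; move: (Num.sqrt 5 * u) (zr R s) v0 s0 h1 h2 => v w v0 w0 h1 h2.
have l1 : w <= v by rewrite -(ler_pXn2r (n := 2)) ?nnegrE // !expr2.
have l2 : v < w + 1 by rewrite -(ltr_pXn2r (n := 2)) ?nnegrE ?addr_ge0 // !expr2.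
by rewrite ler_norml; lra.
Qed.

Lemma int_ball_sound (n : nat) (m : Z) : m = Z.of_nat n ->
  inb (bconst (m * scale) 0) (n%:R).
Proof.
move=> ->; have := @bconst_sound R prec prec0 (Z.of_nat n * scale) 0.
rewrite zc_real zrM zr_nat rmorphM /= mulfK ?rmorph_nat //.
exact: unit_neq0.
Qed.

Lemma btheta_sound : inb (btheta prec) ((2 * pi * tau)%:C).
Proof.
have -> : (2 * pi * tau)%:C = (8%:R * (pi / 2)%:C) * (99%:R + (Num.sqrt 5)%:C)^-1 :> C.
  have s0 : (0 : R) <= Num.sqrt 5 by rewrite sqrtr_ge0.
  have d0 : 99 + Num.sqrt 5 != 0 :> R by rewrite gt_eqF // ltr_wpDr.
  rewrite -!(rmorph_nat (real_complex R)) -rmorphD -fmorphV -!rmorphM /=.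
  by congr (_%:C); move: (Num.sqrt 5) d0 pi => s d0 p; field.
have h99 : inb (badd (bconst (99 * scale) 0) (bsqrt5 prec)) (99%:R + (Num.sqrt 5)%:C).
  by apply: badd_sound; [exact: int_ball_sound | exact: bsqrt5_sound].
apply: bmul_sound => //.
  by apply: bmul_sound => //; [exact: int_ball_sound | exact: bhalfpi_sound].
apply: binv_sound => //; rewrite zr1 mul1r.
rewrite -(rmorph_nat (real_complex R)) -rmorphD cabs_real.
have s0 : (0 : R) <= Num.sqrt 5 by rewrite sqrtr_ge0.
by rewrite ger0_norm; lra.
Qed.

Lemma theta_le2 : `|2 * pi * tau| <= 2.
Proof.
have s0 : (0 : R) <= Num.sqrt 5 by rewrite sqrtr_ge0.
have p0 := pi_gt0 R; have p2 : pi / 2 < 2 :> R := pihalf_lt2 R.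
have d0 : 0 < 99 + Num.sqrt 5 :> R by rewrite ltr_wpDr.
rewrite ger0_norm; last by rewrite !mulr_ge0 ?divr_ge0 // ltW.
rewrite mulrA ler_pdivrMr //; move: (Num.sqrt 5) s0 pi p0 p2 d0 => s s0 p p0 p2 d0; lra.
Qed.

Lemma bq_sound : inb (bq prec) q.
Proof.
apply: bexp_sound theta_le2 _; apply: bmul_sound btheta_sound => //.
have := @bconst_sound R prec prec0 0 scale.
have -> : zc R 0 scale / u%:C = 'i :> C.
  apply: (canLR (mulfK unit_neq0)); rewrite /zc; by simpc.
by [].
Qed.

Let q_unit : cabs q = 1. Proof. exact: cabs_expi. Qed.

Lemma RR_list_sound i : (i < 100)%N -> inb (nth b0 (RR_list prec) i) (c i).
Proof.
move=> i100; have hd := @dioph_tau R.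
apply: (@RR_balls_sound R prec prec0 q c (bq prec) 100 0) => //.
- move=> j; have d0 := dioph_neq0 hd (ltn0Sn j).
  apply: (mulIf d0); rewrite divfK // (RR_coefS q_unit hd) mulrC; congr (_ * _).
  by rewrite -exprD; congr (_ ^+ _); lia.
- exact: bq_sound.
- exact: bone_sound.
- by rewrite RR_coef0; exact: bone_sound.
Qed.

Lemma RR_list_size : size (RR_list prec) = 100%N.
Proof. exact: RR_balls_size. Qed.

Lemma RR_bounded : geo_bounded c 45 (8 / 5).
Proof.
have hd := @dioph_tau R; have [g1 g2] := growth_constants R.
have hcE n : cabs (c n) = cabs (qpoch q n)^-1 by exact: (cabs_RR_coef q_unit).
have h : geo_bounded (fun n => (qpoch q n)^-1) (45 : R) (8 / 5).
  apply: (qpochV_bounded hd g1 (ler0n _ 45) g2) => n n100.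
  rewrite -hcE; have /bub_sound := RR_list_sound n100.
  move=> /(_ prec0) hb.
  have /and4P[/and3P[_ /(all_nthP (b0, 0%N))/(_ n) hg _] _ _ _] := cert; move: hg.
  rewrite size_zip RR_list_size size_iota minnn => /(_ n100).
  rewrite nth_zip ?nth_iota ?RR_list_size ?size_iota //= => /zr_leb.
  rewrite add0n !zrM (zr_pow 5) (zr_pow 8) (@zr_num 45 45) // => h2.
  have u0 := unit_gt0.
  have p5 : (0 : R) < 5 ^+ n by rewrite exprn_gt0.
  rewrite expr_div_n [leRHS]mulrA ler_pdivlMr // -(ler_pM2r u0).
  have -> : cabs (c n) * 5 ^+ n * u = cabs (c n) * u * 5 ^+ n by ring.
  have -> : 45 * 8 ^+ n * u = 45 * u * 8 ^+ n :> R by ring.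
  by apply: le_trans h2; rewrite ler_wpM2r // ltW.
by move=> n; rewrite hcE; exact: h.
Qed.

End Numerics.

(** * Zeros and lower bounds of the Rogers-Ramanujan function *)

(** The lower bound of |target| off the discs about z1 and z2: with t = 1/1000, the
    x_i are the distances of w to the z_i. As |z1 - z2| >= 0.16, one of the first two
    is at least 0.08. *)
Lemma lower_aux (R : realType) (t x1 x2 x3 x4 s : R) : 1000 * t = 1 ->
  30 * t <= x1 -> 30 * t <= x2 -> 160 * t <= s ->
  s <= x1 + x2 -> 39 * t <= x3 -> 109 * t <= x4 ->
  10 * t ^+ 2 <= x1 * (x2 * (x3 * x4)).
Proof.
move=> tE h1 h2 hs h12 h3 h4; have t0 : 0 <= t by lra.
have mul_ge (a b x y : R) : 0 <= a -> 0 <= b -> a <= x -> b <= y -> a * b <= x * y.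
  by move=> a0 b0 ax bx; exact: ler_pM.
have tn (k : nat) : 0 <= k%:R * t by rewrite mulr_ge0.
have p12 : 30 * t * (80 * t) <= x1 * x2.
  have [l|l] := leP (80 * t) x2; first exact: (mul_ge _ _ _ _ (tn 30) (tn 80)).
  have l' : 80 * t <= x1 by lra.
  by rewrite mulrC; exact: (mul_ge _ _ _ _ (tn 80) (tn 30)).
have p34 := mul_ge _ _ _ _ (tn 39) (tn 109) h3 h4.
rewrite mulrA; have := mul_ge _ _ _ _ _ _ p12 p34; rewrite !mulr_ge0 // => /(_ isT isT).
apply: le_trans.
have -> : 30 * t * (80 * t) * (39 * t * (109 * t)) = (1000 * t) * (1000 * t) * (t ^+ 2) * (10 + 2024 / 10000) by field.
by rewrite tE !mul1r mulrC ler_wpM2l ?exprn_ge0 // lerDl divr_ge0 ?ler0n.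
Qed.

Section GBounds.
Variable R : realType.
Variable prec : Z.
Hypothesis prec0 : (0 <= prec)%ZZ.
Hypothesis cert : certificate prec.
Local Notation scale := (2 ^ prec)%ZZ.
Local Notation C := (R[i] : numFieldType).
Local Notation u := (zr R scale).
Local Notation inb b z := (@in_ball R prec b z).
Local Notation encl l p := (@encloses R prec l p).
Local Notation tau := (2 / (99 + Num.sqrt 5) : R).
Local Notation q := (expi (2 * pi * tau) : C).
Local Notation c := (RR_coef q).
Local Notation b0 := (bconst 0%ZZ 0%ZZ).
Local Notation G := (RR_G q).
(* A variable for 1/1000: powers of t are atoms for linear arithmetic and
   avoid large unary numerals. *)
Variable t : R.
Hypothesis tE : 1000 * t = 1.
Local Notation bcen b := (@bcenter R prec b).
Local Notation z1 := (@bcenter R prec (root1 prec)).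
Local Notation z2 := (@bcenter R prec (root2 prec)).
Local Notation z3 := (@bcenter R prec (root3 prec)).
Local Notation z4 := (@bcenter R prec (root4 prec)).

Let u0 : 0 < u. Proof. exact: unit_gt0. Qed.
Let t0 : 0 < t. Proof. by have := tE; lra. Qed.

(** With r = 8/5 and |w| <= 11/25 the ratio is 88/125, and (88/125)^2 < 1/2 as well as
    2^-10 < 1/1000 bound its 100th power by 10^-15. *)
Lemma G_tail w : cabs w <= 11 / 25 -> cabs (G w - power_series c w 100) <= t ^+ 4 / 5.
Proof.
move=> hw; have hb := @RR_bounded R prec prec0 cert.
have r0 : (0 : R) <= 8 / 5 by lra.
have x1 : 88 / 125 < 1 :> R by lra.
have rw : 8 / 5 * cabs w <= 88 / 125 by lra.
apply: le_trans (psum_tail_le r0 hb 100 rw x1) _.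
have h2 : (88 / 125 : R) ^+ 2 <= 1 / 2 by rewrite expr2; lra.
have h10 : (1 / 2 : R) ^+ 10 <= t.
  have h5 : (1 / 2 : R) ^+ 5 = 1 / 32 by rewrite !exprS expr0; lra.
  by rewrite (_ : 10 = 5 * 2)%N // exprM h5 expr2; have := tE; lra.
have h50 : (88 / 125 : R) ^+ 100 <= t ^+ 5.
  rewrite -[100%N]/(2 * (10 * 5))%N exprM; move: ((88 / 125 : R) ^+ 2) (sqr_ge0 (88 / 125 : R)) h2 => x x0 h2.
  apply: (@le_trans _ _ ((1 / 2) ^+ (10 * 5))).
    by apply: lerXn2r => //; rewrite nnegrE //; lra.
  have y0 : (0 : R) <= (1 / 2) ^+ 10 by rewrite exprn_ge0 //; lra.
  by rewrite exprM; apply: lerXn2r; rewrite ?nnegrE ?(ltW t0).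
have t4 : 0 <= t ^+ 4 by rewrite exprn_ge0 // ltW.
have -> : 1 - 88 / 125 = 37 / 125 :> R by lra.
rewrite ler_pdivrMr; last by lra.
move: h50; rewrite [t ^+ 5]exprSr.
move: (t ^+ 4) ((88 / 125) ^+ 100) t4 => T X T0 h50.
have : T * (1000 * t) = T by rewrite tE mulr1.
lra.
Qed.

Lemma radius_le w : cabs w <= 11 / 25 -> cabs w * u <= zr R (disc_radius prec).
Proof.
move=> hw; rewrite /disc_radius zrD zr1.
have /andP[_ h] := @zr_div R (scale * 44) 100 erefl.
apply: le_trans (ltW h); rewrite zrM (@zr_num R 44 44) // (@zr_num R 100 100) //.
have : cabs w * u <= 11 / 25 * u by rewrite ler_wpM2r // ltW.
lra.
Qed.

Lemma center_sound b : brad b = 0%ZZ -> inb b (bcen b).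
Proof. by case: b => x y r /= ->; exact: bconst_sound. Qed.

Lemma linear_list_sound b : brad b = 0%ZZ -> encl (linear_list prec b) ('X - (bcen b)%:P).
Proof.
move=> hb; exists (- bcen b), 1; split.
- by apply: bopp_sound; exact: center_sound.
- exists 1, 0; split=> //; first exact: bone_sound.
  by rewrite mul0r add0r.
- by rewrite mul1r polyCN.
Qed.

Lemma linear_prod_sound l : all (fun b => brad b == 0%ZZ) l ->
  encl (foldr (fun z l => lmul prec (linear_list prec z) l) [:: bone prec] l)
    (\prod_(b <- l) ('X - (bcen b)%:P)).
Proof.
elim: l => [_|b l IH /= /andP[/eqP hb /IH hl]].
  rewrite big_nil; exists 1, 0; split=> //; first exact: bone_sound.
  by rewrite mul0r add0r.
rewrite big_cons; exact: (lmul_sound prec0 (linear_list_sound hb) hl).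
Qed.

Definition target_poly : {poly R[i]} :=
  \prod_(b <- [:: root1 prec; root2 prec; root3 prec; root4 prec]) ('X - (bcen b)%:P).

Lemma target_sound : encl (target prec) target_poly.
Proof. exact: linear_prod_sound. Qed.

Definition multiplier_poly : {poly R[i]} := Poly (map (@bcenter R prec) (multiplier prec)).
Definition low_poly : {poly R[i]} := Poly [seq c j | j <- iota 0 26].
Definition high_coef j : C := if (j < 26)%N then 0 else c j.

Lemma low_sound : encl (RR_low prec) low_poly.
Proof.
have sz : size (RR_low prec) = 26%N by rewrite size_takel // RR_list_size.
have := @encloses_Poly R prec (RR_low prec) c 0; rewrite sz; apply => i i26.
rewrite nth_take // add0n; apply: RR_list_sound => //; exact: ltn_trans i26 _.
Qed.

Lemma defect_sound : encl (defect prec) (multiplier_poly * low_poly - target_poly).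
Proof.
have h1 : encl (map bmid (multiplier prec)) multiplier_poly.
  by rewrite /multiplier_poly; move: (multiplier prec) => l; exact: encloses_mid.
rewrite /defect; move: (map bmid _) multiplier_poly h1 => l p h1.
move: (RR_low prec) low_poly low_sound (target prec) target_poly target_sound.
move=> m g h2 l' p' h3; apply: ladd_sound; last exact: lopp_sound.
exact: lmul_sound.
Qed.

Lemma high_sound : encl (RR_high prec) (Poly [seq high_coef j | j <- iota 0 100]).
Proof.
have sz : size (RR_high prec) = 100%N.
  by rewrite size_cat size_nseq size_drop RR_list_size.
have := @encloses_Poly R prec (RR_high prec) high_coef 0; rewrite sz; apply => i i100.
rewrite add0n /high_coef nth_cat size_nseq; case: ltnP => i26.
  by rewrite nth_nseq i26; exact: b0_sound.
by rewrite nth_drop subnKC //; apply: RR_list_sound.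
Qed.

Lemma low_high w : power_series c w 100 = low_poly.[w] + power_series high_coef w 100.
Proof.
rewrite Poly_power_series.
have lo k : (k <= 26)%N -> power_series high_coef w k = 0.
  elim: k => [|k IH] k26; first by rewrite /power_series /series /= big_geq.
  by rewrite power_seriesS (IH (ltnW k26)) add0r /high_coef k26 mul0r.
have hi k : power_series c w (26 + k) = power_series c w 26 + power_series high_coef w (26 + k).
  elim: k => [|k IH]; first by rewrite addn0 (lo _ (leqnn _)) addr0.
  have hk : high_coef (26 + k) = c (26 + k)%N by rewrite /high_coef ltnNge leq_addr.
  by rewrite addnS (power_seriesS c) (power_seriesS high_coef) IH hk addrA.
exact: (hi 74).
Qed.

Lemma multiplier_okP d k h l : multiplier_ok prec d k h l ->
  [/\ 1000 * (1000 * zr R d) <= 2 * u, zr R k <= u,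
      1000 * (1000 * (1000 * zr R h)) <= u & zr R l <= 49 * u].
Proof.
have hm : zr R 1000 = 1000 by exact: (zr_num R (n := 1000)).
have h2 : zr R 2 = 2 by exact: (zr_num R (n := 2)).
have h49 : zr R 49 = 49 by exact: (zr_num R (n := 49)).
move=> /and4P[/(zr_leb R) a1 /(zr_leb R) a2 /(zr_leb R) a3 /(zr_leb R) a4].
by move: a1 a3 a4; rewrite !zrM hm h2 h49 => a1 a3 a4; split.
Qed.

Lemma residual_okP x : residual_ok prec x ->
  5 * (1000 * (1000 * (1000 * (1000 * zr R x)))) <= u.
Proof.
have hm : zr R 1000 = 1000 by exact: (zr_num R (n := 1000)).
have h5 : zr R 5 = 5 by exact: (zr_num R (n := 5)).
by move=> /(zr_leb R); rewrite !zrM hm h5.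
Qed.

Lemma multiplier_le w : cabs w <= 11 / 25 -> cabs multiplier_poly.[w] <= 1.
Proof.
move=> hw; have /and4P[/and3P[_ _ /multiplier_okP[_ h _ _]] _ _ _] := cert.
have := hbound_sound prec0 (radius_le hw) (encloses_mid R prec0 (multiplier prec)).
move=> /le_trans /(_ h).
by rewrite -{2}[u]mul1r ler_pM2r.
Qed.

Lemma factor_split (p l g : {poly R[i]}) (h x s w : C) : s = l.[w] + h ->
  p.[w] * x - g.[w] = (p * l - g).[w] + p.[w] * h + p.[w] * (x - s).
Proof. by move=> ->; rewrite hornerD hornerN hornerM; ring. Qed.

Lemma fifth_le (x : R) : 0 <= x -> x / 5 <= x.
Proof. by move=> x0; lra. Qed.

(** The three terms are the exact defect of the low-degree part, the coefficients of
    degree 26 to 99, and the tail from 100 on. *)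
Lemma G_factor w : cabs w <= 11 / 25 ->
  cabs (multiplier_poly.[w] * G w - target_poly.[w]) <= 2 * t ^+ 2 + t ^+ 3 + t ^+ 4.
Proof.
move=> hw; have rw := radius_le hw; have ht := G_tail hw.
have /and4P[/and3P[_ _ /multiplier_okP[h1 _ h3 _]] _ _ _] := cert.
have tt : t * 1000 = 1 by rewrite mulrC.
have hd := hbound_sound prec0 rw defect_sound.
have hh := hbound_sound prec0 rw high_sound.
rewrite Poly_power_series in hh.
have {h1 hd}d1 : cabs (multiplier_poly * low_poly - target_poly).[w] <= 2 * t ^+ 2.
  rewrite -(ler_pM2r u0); apply: le_trans hd _.
  have gen (x : R) : x = t ^+ 2 * (1000 * (1000 * x)).
    by transitivity ((1000 * t) ^+ 2 * x); [rewrite tE expr1n mul1r|ring].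
  rewrite [leLHS]gen.
  have -> : 2 * t ^+ 2 * u = t ^+ 2 * (2 * u) by ring.
  by rewrite ler_wpM2l // exprn_ge0 // ltW.
have {h3 hh}d2 : cabs (power_series high_coef w 100) <= t ^+ 3.
  rewrite -(ler_pM2r u0); apply: le_trans hh _.
  have gen (x : R) : x = t ^+ 3 * (1000 * (1000 * (1000 * x))).
    by transitivity ((1000 * t) ^+ 3 * x); [rewrite tE expr1n mul1r|ring].
  by rewrite [leLHS]gen ler_wpM2l // exprn_ge0 // ltW.
have cl := multiplier_le hw.
rewrite (@factor_split multiplier_poly low_poly target_poly _ (G w) _ w (low_high w)).
have small (x : C) (e : R) : cabs x <= e -> cabs (multiplier_poly.[w] * x) <= e.
  by move=> h; rewrite cabsM; apply: le_trans h; rewrite ler_piMl ?cabs_ge0.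
apply: le_trans (cabsD _ _) _; apply: lerD; last first.
  by apply: small; apply: le_trans ht _; apply: fifth_le; rewrite exprn_ge0 // ltW.
exact: (le_trans (cabsD _ _) (lerD d1 (small _ _ d2))).
Qed.

Lemma linear_prod4 (f : cball -> C) b1 b2 b3 b4 (w : C) :
  (\prod_(b <- [:: b1; b2; b3; b4]) ('X - (f b)%:P)).[w] =
  (w - f b1) * ((w - f b2) * ((w - f b3) * (w - f b4))).
Proof. by rewrite !big_cons big_nil mulr1 !hornerM !hornerXsubC. Qed.

Lemma center_norm b : (cabs (bcen b) * u) ^+ 2 = zr R (norm2 b).
Proof.
have e : cabs (bcen b) * u = cabs (zc R (bre b) (bim b)).
  have un := unit_neq0 R prec0.
  by rewrite -[u in LHS]gtr0_norm // -cabs_real -cabsM divfK.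
by rewrite e cabs_sqr /zc /norm2 zrD !zrM !expr2.
Qed.

Lemma norm_geP b (n m : nat) (zn zm : Z) : zn = Z.of_nat n -> zm = Z.of_nat m -> norm_ge prec b zn zm ->
  m%:R <= n%:R * cabs (bcen b).
Proof.
move=> -> -> /(zr_leb R); rewrite !zrM !zr_nat -center_norm => h.
rewrite -(ler_pM2r u0) -(ler_pXn2r (n := 2)) ?nnegrE ?mulr_ge0 ?cabs_ge0 ?(ltW u0) //.
have -> : (m%:R * u) ^+ 2 = m%:R * m%:R * (u * u) by ring.
by apply: le_trans h _; rewrite le_eqVlt; apply/orP; left; apply/eqP; ring.
Qed.

Lemma norm_leP b (n m : nat) (zn zm : Z) : zn = Z.of_nat n -> zm = Z.of_nat m -> norm_le prec b zn zm ->
  n%:R * cabs (bcen b) <= m%:R.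
Proof.
move=> -> -> /(zr_leb R); rewrite !zrM !zr_nat -center_norm => h.
rewrite -(ler_pM2r u0) -(ler_pXn2r (n := 2)) ?nnegrE ?mulr_ge0 ?cabs_ge0 ?(ltW u0) //.
have -> : (m%:R * u) ^+ 2 = m%:R * m%:R * (u * u) by ring.
by apply: le_trans h; rewrite le_eqVlt; apply/orP; left; apply/eqP; ring.
Qed.

Lemma centerB a b : bcen (badd a (bopp b)) = bcen a - bcen b.
Proof. by rewrite /bcenter /= -zcD -zcN mulrBl. Qed.

Lemma moduli : [/\ 330 <= 1000 * cabs z1, 1000 * cabs z1 <= 335,
  405 <= 1000 * cabs z2 & 1000 * cabs z2 <= 410].
Proof.
have /and4P[_ _ /and4P[h1 h2 h3 h4] _] := cert.
by split; [apply: norm_geP h1|apply: norm_leP h2|apply: norm_geP h3|apply: norm_leP h4].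
Qed.

Lemma separation : [/\ 479 <= 1000 * cabs z3, 549 <= 1000 * cabs z4 &
  160 <= 1000 * cabs (z1 - z2)].
Proof.
have /and4P[_ _ _ /and4P[h1 h2 h3 _]] := cert.
by split; [apply: norm_geP h1|apply: norm_geP h2|rewrite -centerB; apply: norm_geP h3].
Qed.

Lemma center_cross a b : Z.leb (50 * (scale * scale)) (1000 * (bim a * bre b - bre a * bim b)) ->
  100 <= 1000 * cabs (bcen a * (bcen b)^* - bcen b * (bcen a)^*).
Proof.
have aux (Q U : R) : 50 * U <= 1000 * Q -> 100 * U <= 1000 * (2 * Q) by lra.
have hm : zr R 1000 = 1000 by exact: (zr_num R (n := 1000)).
have h50 : zr R 50 = 50 by exact: (zr_num R (n := 50)).
move=> /(zr_leb R); rewrite 3!zrM hm h50 zrB !zrM => h.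
have cE x : bcen x = (zr R (bre x) / u) +i* (zr R (bim x) / u).
  by rewrite /bcenter -fmorphV /zc; simpc.
set v := _ - _; have vI : complex.Im v = 2 * (zr R (bim a) * zr R (bre b) - zr R (bre a) * zr R (bim b)) / (u * u).
  rewrite /v !cE /=; simpc => /=; have un : u != 0 by rewrite gt_eqF.
  by field.
have := cabs_Im v; rewrite vI => /(le_trans (ler_norm _)) hv.
have : 100 <= 1000 * (2 * (zr R (bim a) * zr R (bre b) - zr R (bre a) * zr R (bim b)) / (u * u)).
  by rewrite mulrA ler_pdivlMr ?mulr_gt0 //; exact: aux.
by move=> h100; exact: (le_trans h100 (ler_wpM2l (ler0n _ 1000) hv)).
Qed.

Lemma G_upper w : cabs w <= 11 / 25 -> cabs (G w) <= 50.
Proof.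
have t1 : t <= 1 by have := tE; lra.
have aux (x y z T : R) : z <= 49 -> y <= T / 5 -> T <= 1 -> x <= y + z -> x <= 50 by lra.
move=> hw; have ht := G_tail hw; have rw := radius_le hw.
have /and4P[/and3P[_ _ /multiplier_okP[_ _ _ h]] _ _ _] := cert.
have enc : encl (RR_list prec) (Poly [seq c j | j <- iota 0 100]).
  have := @encloses_Poly R prec (RR_list prec) c 0; rewrite RR_list_size; apply => i i100.
  by rewrite add0n; exact: RR_list_sound.
have := hbound_sound prec0 rw enc; rewrite Poly_power_series => /le_trans /(_ h).
rewrite ler_pM2r // => hp.
have : cabs (G w) <= cabs (G w - power_series c w 100) + cabs (power_series c w 100).
  by rewrite -{1}[G w](subrK (power_series c w 100)) cabsD.
have t41 : t ^+ 4 <= 1 by rewrite exprn_ile1 ?(ltW t0).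
exact: (aux _ _ _ _ hp ht t41).
Qed.

Lemma G_residual b : brad b = 0%ZZ -> cabs (bcen b) <= 11 / 25 ->
  residual_ok prec (bub (heval prec (RR_list prec) b)) -> cabs (G (bcen b)) <= 2 / 5 * t ^+ 4.
Proof.
have aux (x y z T : R) : z <= T / 5 -> y <= T / 5 -> x <= y + z -> x <= 2 / 5 * T by lra.
move=> rb hw /residual_okP h; have ht := G_tail hw.
have enc : encl (RR_list prec) (Poly [seq c j | j <- iota 0 100]).
  have := @encloses_Poly R prec (RR_list prec) c 0; rewrite RR_list_size; apply => i i100.
  by rewrite add0n; exact: RR_list_sound.
have := bub_sound prec0 (heval_sound prec0 (center_sound rb) enc).
rewrite Poly_power_series; set p := power_series _ _ _ in ht * => hp.
have {h}hp2 : cabs p <= t ^+ 4 / 5.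
  rewrite ler_pdivlMr // -(ler_pM2r u0).
  have -> : cabs p * 5 * u = t ^+ 4 * (5 * (1000 * (1000 * (1000 * (1000 * (cabs p * u)))))).
    by transitivity ((1000 * t) ^+ 4 * (cabs p * 5 * u)); [rewrite tE expr1n mul1r|ring].
  rewrite ler_wpM2l ?exprn_ge0 ?(ltW t0) //; apply: le_trans h.
  by do 5! (apply: ler_wpM2l; first exact: ler0n); exact: hp.
have : cabs (G (bcen b)) <= cabs (G (bcen b) - p) + cabs p.
  by rewrite -{1}[G (bcen b)](subrK p) cabsD.
exact: (aux _ _ _ _ hp2 ht).
Qed.

(** As the multiplier has modulus at most 1 on the disc, |G w| is at least the modulus
    of multiplier * G_q, which is close to the product of the w - z_i. *)
Lemma G_lower w : cabs w <= 11 / 25 -> 3 / 100 <= cabs (w - z1) -> 3 / 100 <= cabs (w - z2) ->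
  7 * t ^+ 2 <= cabs (G w).
Proof.
have auxr (k x : R) : k <= 1000 * x -> k * t <= x.
  have p : (0 : R) < 1000 by rewrite ltr0n.
  by move=> h; rewrite -(ler_pM2l p) mulrCA tE mulr1.
have aux3 (x y d : R) : 479 <= 1000 * x -> y <= 11 / 25 -> x - y <= d -> 39 <= 1000 * d by lra.
have aux4 (x y d : R) : 549 <= 1000 * x -> y <= 11 / 25 -> x - y <= d -> 109 <= 1000 * d by lra.
have aux1 (d : R) : 3 / 100 <= d -> 30 <= 1000 * d by lra.
have aux (a b x T2 T3 T4 : R) : 10 * T2 <= a -> b <= 2 * T2 + T3 + T4 ->
    1000 * T3 = T2 -> 1000 * T4 = T3 -> 0 <= T2 -> a <= b + x -> 7 * T2 <= x by lra.
move=> hw h1 h2; have hf := G_factor hw; have hk := multiplier_le hw.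
have [s3 s4 s12] := separation.
have h12 : cabs (z1 - z2) <= cabs (w - z1) + cabs (w - z2).
  by rewrite (cabsB w z1); have := cabsD (z1 - w) (w - z2); rewrite subrKA.
have far z : cabs z - cabs w <= cabs (w - z) by rewrite cabsB; exact: lerB_cabs.
have h3 : 39 <= 1000 * cabs (w - z3) by exact: (aux3 _ _ _ s3 hw (far _)).
have h4 : 109 <= 1000 * cabs (w - z4) by exact: (aux4 _ _ _ s4 hw (far _)).
have := lower_aux tE (auxr _ _ (aux1 _ h1)) (auxr _ _ (aux1 _ h2)) (auxr _ _ s12) h12
  (auxr _ _ h3) (auxr _ _ h4); rewrite -!cabsM -linear_prod4 -/target_poly => hl.
have : cabs target_poly.[w] <= cabs (multiplier_poly.[w] * G w - target_poly.[w]) + cabs (G w).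
  apply: (@le_trans _ _ (cabs (multiplier_poly.[w] * G w - target_poly.[w]) + cabs (multiplier_poly.[w] * G w))).
    by rewrite cabsB -{1}[target_poly.[w]](subrK (multiplier_poly.[w] * G w)) cabsD.
  by rewrite lerD2l cabsM ler_piMl ?cabs_ge0.
have t3 : 1000 * t ^+ 3 = t ^+ 2 by rewrite exprS mulrA tE mul1r.
have t4 : 1000 * t ^+ 4 = t ^+ 3 by rewrite exprS mulrA tE mul1r.
have t20 : 0 <= t ^+ 2 by rewrite exprn_ge0 // ltW.
exact: (aux _ _ _ _ _ _ hl hf t3 t4 t20).
Qed.

End GBounds.

(** Here a and b approximate the two zeros of G_q in |w| <= 0.44. The last condition
    on them says that the line through 0 and a and the one through 0 and b are
    well apart. *)
Lemma RR_G_two_zeros (R : realType) :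
  let G := RR_G (expi (2 * pi * (2 / (99 + Num.sqrt 5))) : (R[i] : numFieldType)) in
  exists (a b : R[i]) (d e : R), [/\ 0 < d, 50 * e < d ^+ 2,
   [/\ cabs a <= 41 / 100, cabs b <= 41 / 100, 6 / 100 <= cabs b - cabs a,
       16 / 100 <= cabs (a - b) & 1 / 10 <= cabs (a * b^* - b * a^*)],
   [/\ cabs (G a) <= e, cabs (G b) <= e & forall w, cabs w <= 11 / 25 -> cabs (G w) <= 50] &
   forall w, cabs w <= 11 / 25 -> 3 / 100 <= cabs (w - a) -> 3 / 100 <= cabs (w - b) ->
     d <= cabs (G w)].
Proof.
have geo (x y s k : R) : 330 <= 1000 * x -> 1000 * x <= 335 -> 405 <= 1000 * y ->
    1000 * y <= 410 -> 160 <= 1000 * s -> 100 <= 1000 * k ->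
    [/\ x <= 41 / 100, y <= 41 / 100, 6 / 100 <= y - x, 16 / 100 <= s & 1 / 10 <= k] /\
    (x <= 11 / 25 /\ y <= 11 / 25).
  by move=> h1 h2 h3 h4 h5 h6; split; split; lra.
move=> G; have p0 : (0 <= 84)%ZZ by [].
have cert := certificate_ok; move: (84%ZZ) p0 cert => prec p0 cert.
have [t tE] : exists t : R, 1000 * t = 1 by exists (1000%:R^-1); rewrite mulfV ?pnatr_eq0.
have t0 : 0 < t by have := tE; lra.
have [m1 m2 m3 m4] := @moduli R prec p0 cert.
have [_ _ s12] := @separation R prec p0 cert.
have /and4P[_ /andP[r1 r2] _ /and4P[_ _ _ /(@center_cross R prec p0) hc]] := cert.
have ha := @G_residual R prec p0 cert t tE (root1 prec) erefl _ r1.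
have hb := @G_residual R prec p0 cert t tE (root2 prec) erefl _ r2.
have hu := @G_upper R prec p0 cert t tE; have hl := @G_lower R prec p0 cert t tE.
move: (bcenter R prec (root1 prec)) (bcenter R prec (root2 prec)) m1 m2 m3 m4 s12 hc ha hb hl => a b m1 m2 m3 m4 s12 hc ha hb hl.
exists a, b, (7 * t ^+ 2), (2 / 5 * t ^+ 4).
have t4 : 0 < t ^+ 4 by rewrite exprn_gt0.
split.
- by rewrite mulr_gt0 // exprn_gt0.
- have -> : (7 * t ^+ 2) ^+ 2 = 49 * t ^+ 4 by ring.
  by move: (t ^+ 4) t4; clear => T; lra.
- exact: (geo _ _ _ _ m1 m2 m3 m4 s12 hc).1.
- have [_ [a1 b1]] := geo _ _ _ _ m1 m2 m3 m4 s12 hc.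
  by split; [exact: ha|exact: hb|exact: hu].
- exact: hl.
Qed.

(** * Spurious poles of the convergents *)

Section SpuriousPoles.
Variable R : realType.
Local Notation C := (R[i] : numFieldType).

Lemma ratfun_value_pole (P Q : {poly C}) (z w : C) : Q != 0 -> Q.[z] = 0 -> P.[z] != 0 ->
  ~ ratfun_value (ratfun P Q) z w.
Proof.
move=> Q0 Qz Pz [P' [Q' [e Q'z _]]].
have Q'0 : Q' != 0 by apply: contraNneq Q'z => ->; rewrite horner0.
move/eqP: e; rewrite /ratfun eqr_div ?tofrac_eq0 // -!rmorphM tofrac_eq => /eqP.
move/(congr1 (fun p : {poly C} => p.[z])); rewrite !hornerM Qz mulr0 => /eqP.
by rewrite mulf_eq0 (negPf Pz) (negPf Q'z).
Qed.

Lemma continuous_complex : continuous (fun p : R * R => (p.1 +i* p.2 : C)).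
Proof.
move=> p; apply/cvgrPdist_le => /= e e0.
have eE : e = (complex.Re e)%:C by rewrite RRe_real // gtr0_real.
have e2 : 0 < complex.Re e / 2 by rewrite divr_gt0 // -ltcR -eE.
have h1 : \forall x \near p, `|p.1 - x.1| <= complex.Re e / 2.
  have /cvgrPdist_le h : (fun x : R * R => x.1) @ p --> p.1 by exact: cvg_fst.
  exact: h.
have h2 : \forall x \near p, `|p.2 - x.2| <= complex.Re e / 2.
  have /cvgrPdist_le h : (fun x : R * R => x.2) @ p --> p.2 by exact: cvg_snd.
  exact: h.
near=> x; rewrite eE le_cabs; apply: le_trans (cabs_ReIm _) _ => /=.
have b1 : `|p.1 - x.1| <= complex.Re e / 2 by near: x.
have b2 : `|p.2 - x.2| <= complex.Re e / 2 by near: x.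
by rewrite (le_trans (lerD b1 b2)) // -splitr.
Unshelve. all: by end_near. Qed.

(** R[i] carries the topology of its norm; compactness comes from the square in
    R * R of which the disc is part of the image. *)
Lemma compact_closed_disc (S : set C) (r : R) : closed S -> S `<=` [set z | cabs z <= r] -> compact S.
Proof.
move=> cS Sr.
pose I := [set x : R | x \in `[- r, r]].
have cI : compact ((fun p : R * R => (p.1 +i* p.2 : C)) @` (I `*` I)).
  apply: continuous_compact.
    by apply: continuous_subspaceT => p; exact: continuous_complex.
  by apply: compact_setX; exact: segment_compact.
apply: (subclosed_compact cS cI) => z /Sr /= hz.
exists (complex.Re z, complex.Im z) => /=; last by case: (z).
by split; rewrite /I /= in_itv /= -ler_norml; [apply: le_trans (cabs_Re _) hz|apply: le_trans (cabs_Im _) hz].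
Qed.

Section Denominators.
Variables (q : C) (A : R).
Hypotheses (hq : cabs q = 1) (hA : dioph q A).
Local Notation c := (RR_coef q).
Local Notation G := (RR_G q).

Lemma product_approx (x y a b : C) (L e : R) : cabs a <= L -> cabs b <= L -> cabs (x - a) <= e ->
  cabs (y - b) <= e -> e <= L -> cabs (x * y - a * b) <= 3 * L * e.
Proof.
move=> aL bL xa yb eL.
have L0 := le_trans (cabs_ge0 _) aL; have e0 := le_trans (cabs_ge0 _) xa.
have -> : x * y - a * b = (x - a) * (y - b) + (x - a) * b + a * (y - b) by ring.
apply: le_trans (cabsD _ _) _; apply: le_trans (lerD (cabsD _ _) (lexx _)) _; rewrite !cabsM.
have h1 := ler_pM (cabs_ge0 _) (cabs_ge0 _) xa (le_trans yb eL).
have h2 := ler_pM (cabs_ge0 _) (cabs_ge0 _) xa bL.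
have h3 := ler_pM (cabs_ge0 _) (cabs_ge0 _) aL yb.
lra.
Qed.

Lemma psum_twist w u : cabs w = 1 -> cabs u < 1 -> psum (twist q w) u = conjc (G (conjc (w * u))).
Proof.
move=> w1 u1; apply: psum_lim; apply: cvg_cabs => e e0.
have wu1 : cabs (conjc (w * u)) < 1 by rewrite cabs_conj cabsM w1 mul1r.
have [N hN] := cabs_cvg (subexp_psum_cvg (RR_subexp hq hA) wu1) e0.
exists N => n /hN; rewrite -cabs_conj (rmorphB (@conjc R)) /= RR_GE.
suff -> : power_series (twist q w) u n = conjc (power_series c (conjc (w * u)) n) by [].
rewrite /power_series /series /= (rmorph_sum (@conjc R)) /=; apply: eq_bigr => i _.
have conj_mul (x y : C) k : conjc (x * conjc y ^+ k) = conjc x * y ^+ k.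
  by rewrite rmorphM rmorphXn /= conjcK.
by rewrite /twist /RR_coefJ -mulrA -exprMn; exact/esym/conj_mul.
Qed.

Lemma cf_poly1_horner n u : (cf_poly q n 1).[u] = power_series (conv (twist q (q ^+ n)) c) u n.+1.
Proof.
rewrite (@horner_coef_wide _ n.+1); last by apply: leq_trans (size_cf_poly _ _ _) _; lia.
rewrite /power_series /series /= big_mkord; apply: eq_bigr => i _.
by rewrite (cf_poly1_coef hq hA) // -ltnS.
Qed.

Lemma cf_poly2_horner n z : (cf_poly q n 2).[z] = (cf_poly q n 1).[q * z].
Proof.
rewrite !(horner_coef_wide _ (size_cf_poly _ _ _)); apply: eq_bigr => i _.
by rewrite (cf_poly2_coef hq hA) exprMn mulrCA mulrA.
Qed.

(** cf_poly q n 1 is the truncation of the Cauchy product of G(u) and D(q^n u). The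
    coefficients of D(q^n u) have moduli independent of n, so the truncation error is
    uniform in n and in |u| <= 11/25. *)
Lemma cf_poly1_approx (e : R) : 0 < e -> exists N, forall n u, (N <= n)%N -> cabs u <= 11 / 25 ->
  cabs ((cf_poly q n 1).[u] - conjc (G (conjc (q ^+ n * u))) * G u) <= e.
Proof.
move=> e0.
have r1 : (1 : R) < 3 / 2 by lra.
have r0 : (0 : R) < 3 / 2 by lra.
have rs : (3 / 2 : R) < 2 by lra.
have t0 : (0 : R) <= 22 / 25 by lra.
have t1 : (22 / 25 : R) < 1 by lra.
have [M hM] := RR_subexp hq hA r1.
have M0 := geo_bounded_ge0 hM.
pose t : R := 22 / 25; pose L := M / (1 - t); pose B := M * M / (1 - (3 / 2) / 2) / (1 - t).
have L0 : 0 <= L by rewrite divr_ge0 // /t; lra.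
have [N1 h1] := geo_small (B + 3 * L * L) t0 t1 e0.
exists N1 => n u Nn u1.
have hJ : geo_bounded (twist q (q ^+ n)) M (3 / 2).
  by move=> k; rewrite /twist cabsM cabs_conj cabsX (cabs_q_pow hq) expr1n mulr1; exact: hM.
have rt : 3 / 2 * cabs u <= t by have := cabs_ge0 u; rewrite /t; lra.
have st : 2 * cabs u <= t by rewrite /t; lra.
have uu : cabs u < 1 by lra.
rewrite cf_poly1_horner -(psum_twist (cabs_q_pow hq n) uu) RR_GE.
have p1 := psum_tail_le (ltW r0) hJ n.+1 rt t1.
have p2 := psum_tail_le (ltW r0) hM n.+1 rt t1.
have p3 := conv_partial_le r0 rs hJ hM n.+1 st t1.
have p4 := psum_le (ltW r0) hJ rt t1.
have p5 := psum_le (ltW r0) hM rt t1.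
set x := power_series (twist _ _) u _ in p1 p3; set y := power_series c u _ in p2 p3.
have tn : t ^+ n.+1 <= 1 by rewrite exprn_ile1 // ltW.
have LE : M * t ^+ n.+1 / (1 - t) = L * t ^+ n.+1 by rewrite mulrAC.
rewrite -/t LE cabsB in p1; rewrite -/t LE cabsB in p2.
have eL : L * t ^+ n.+1 <= L by rewrite ler_piMr.
have p6 := product_approx p4 p5 p1 p2 eL.
have p7 := h1 n.+1 (leqW Nn).
rewrite -[X in cabs X](subrKA (x * y)); apply: le_trans (cabsD _ _) _.
apply: le_trans (lerD p3 p6) _; apply: le_trans p7.
rewrite -/t [leRHS]mulrDl /B; apply: lerD; last by rewrite mulrA.
by rewrite mulrAC.
Qed.

Section SpuriousZeros.
Variables (a b : C) (d e : R).
Hypotheses (d0 : 0 < d) (ed : 50 * e < d ^+ 2).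
Hypotheses (ha : cabs a <= 41 / 100) (hb : cabs b <= 41 / 100).
Hypotheses (hba : 6 / 100 <= cabs b - cabs a) (hab : 16 / 100 <= cabs (a - b)).
Hypothesis twisted : 1 / 10 <= cabs (a * conjc b - b * conjc a).
Hypotheses (Ga : cabs (G a) <= e) (Gb : cabs (G b) <= e).
Hypothesis G_le : forall w, cabs w <= 11 / 25 -> cabs (G w) <= 50.
Hypothesis G_ge : forall w, cabs w <= 11 / 25 -> 3 / 100 <= cabs (w - a) ->
  3 / 100 <= cabs (w - b) -> d <= cabs (G w).

Definition outside u := [/\ cabs u <= 11 / 25, 3 / 100 <= cabs (u - a) & 3 / 100 <= cabs (u - b)].

(** Near p = conj (q^n x) the second factor of the approximation vanishes: for u = p,
    conj (q^n u) = x, an approximate zero of G. If p is far from x and y, both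
    factors are at least d on the circle of radius 3/100 about p, whereas their
    product at the centre is at most 50 e, less than d^2. The minimum modulus
    principle then gives a zero of the polynomial in the disc. *)
Lemma zero_in_disc n (eps : R) (x y : C) : cabs (q ^+ n) = 1 ->
  cabs x <= 41 / 100 -> cabs (G x) <= e -> 16 / 100 <= cabs (x - y) ->
  (forall w, cabs w <= 11 / 25 -> 3 / 100 <= cabs (w - x) -> 3 / 100 <= cabs (w - y) -> d <= cabs (G w)) ->
  let p := conjc (q ^+ n * x) in
  6 / 100 <= cabs (p - x) -> 6 / 100 <= cabs (p - y) ->
  2 * eps < d ^+ 2 - 50 * e ->
  (forall u, cabs u <= 11 / 25 ->
    cabs ((cf_poly q n 1).[u] - conjc (G (conjc (q ^+ n * u))) * G u) <= eps) ->
  exists u, [/\ cabs u <= 11 / 25, 3 / 100 <= cabs (u - x), 3 / 100 <= cabs (u - y) & (cf_poly q n 1).[u] = 0].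
Proof.
move=> w1 x1 Gx xy Gge p px py he happ.
have aux3 (s v : R) : 16 / 100 <= s -> s <= 3 / 100 + v -> 3 / 100 <= v by lra.
have aux1 (D E s m k : R) : D <= m -> m - k <= s -> s <= E -> D - E <= k by lra.
have aux2 (D E s m k : R) : 2 * E < D - 50 * e -> D - E <= k -> k <= s + m -> s <= E ->
  m <= e * 50 -> False by lra.
have tri (u z : C) : 6 / 100 <= cabs (p - z) -> cabs (u - p) <= 3 / 100 -> 3 / 100 <= cabs (u - z).
  move=> h1 h2; have := cabsD (p - u) (u - z); rewrite subrKA cabsB [cabs (p - u)]cabsB; lra.
have pn : cabs p <= 41 / 100 by rewrite /p cabs_conj cabsM w1 mul1r.
have un (u : C) : cabs (u - p) <= 3 / 100 -> cabs u <= 11 / 25.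
  by move=> h; have := cabsD (u - p) p; rewrite subrK; lra.
set w := q ^+ n in p px py happ w1 tri pn un *.
have ww : conjc w * w = 1 by rewrite mulrC -sqr_normc cabsE w1 expr1n.
have vx (u : C) : cabs (conjc (w * u) - x) = cabs (u - p).
  have -> : conjc (w * u) - x = conjc (w * (u - p)).
    rewrite mulrBr rmorphB /= -/(conjc _); congr (_ - _).
    by rewrite /p !rmorphM /= !conjcK mulrA ww mul1r.
  by rewrite cabs_conj cabsM w1 mul1r.
case: (pselect (exists u, cabs (u - p) <= 3 / 100 /\ (cf_poly q n 1).[u] = 0)) => [[u [h1 h2]]|no].
  by exists u; split => //; [exact: un|exact: tri|exact: tri].
have e0 := le_trans (cabs_ge0 _) Gx.
have r0 : (0 : R) < 3 / 100 by lra.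
have m0 : 0 < d ^+ 2 - eps by have := exprn_gt0 2 d0; lra.
have nz (z : C) : cabs (z - p) <= 3 / 100 -> (cf_poly q n 1).[z] != 0.
  by move=> h; apply/eqP => hz; apply: no; exists z.
have circle (z : C) : cabs (z - p) = 3 / 100 -> d ^+ 2 - eps <= cabs (cf_poly q n 1).[z].
  move=> hz; have hz' : cabs (z - p) <= 3 / 100 by rewrite hz.
  have g1 : d <= cabs (G z) by apply: Gge; [exact: un|exact: tri|exact: tri].
  have g2 : d <= cabs (G (conjc (w * z))).
    apply: Gge; first by rewrite cabs_conj cabsM w1 mul1r; exact: un.
      by rewrite vx hz.
    have := cabsD (x - conjc (w * z)) (conjc (w * z) - y).
    rewrite subrKA [cabs (x - conjc _)]cabsB vx hz; exact: aux3 xy.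
  have g3 := ler_pM (ltW d0) (ltW d0) g2 g1.
  have := lerB_cabs (conjc (G (conjc (w * z))) * G z) (cf_poly q n 1).[z].
  rewrite cabsM cabs_conj cabsB -expr2 in g3 * => g4.
  exact: aux1 g3 g4 (happ z (un _ hz')).
have g0 := min_modulus r0 m0 nz circle.
have pc : cabs (p - p) <= 3 / 100 by rewrite subrr cabs0; lra.
have g1 : cabs (G p) <= 50 by apply: G_le; exact: un.
have vp : conjc (w * p) = x by apply/eqP; rewrite -subr_eq0 -cabs_eq0 vx subrr cabs0.
have := happ p (un _ pc); rewrite vp => g2.
have g3 := ler_pM (cabs_ge0 _) (cabs_ge0 _) Gx g1.
have := cabsD ((cf_poly q n 1).[p] - conjc (G x) * G p) (conjc (G x) * G p).
rewrite subrK cabsM cabs_conj => g4.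
by case: (aux2 _ _ _ _ _ he g0 g4 g2 g3).
Qed.

(** If conj (w a) were close to a and conj (w b) close to b, then a * conj b would be
    close to b * conj a: both are conj w * conj a * conj b up to the error. *)
Lemma twisted_far w : cabs w = 1 ->
  6 / 100 <= cabs (conjc (w * a) - a) \/ 6 / 100 <= cabs (conjc (w * b) - b).
Proof.
move=> w1; case: (lerP (6 / 100) (cabs (conjc (w * a) - a))) => [|ka]; first by left.
right; rewrite leNgt; apply/negP => kb.
have e1 : a * conjc b - b * conjc a =
    (conjc (w * b) - b) * conjc a - (conjc (w * a) - a) * conjc b.
  by rewrite !rmorphM /=; ring.
have h1 : cabs ((conjc (w * b) - b) * conjc a) <= 6 / 100 * (41 / 100).
  by rewrite cabsM cabs_conj; apply: ler_pM; rewrite ?cabs_ge0 // ltW.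
have h2 : cabs ((conjc (w * a) - a) * conjc b) <= 6 / 100 * (41 / 100).
  by rewrite cabsM cabs_conj; apply: ler_pM; rewrite ?cabs_ge0 // ltW.
have := twisted; rewrite e1 => h3.
have := cabsD ((conjc (w * b) - b) * conjc a) (- ((conjc (w * a) - a) * conjc b)).
rewrite cabsN; lra.
Qed.

Lemma spurious_zeros : exists N, forall n, (N <= n)%N ->
  exists2 u, outside u & (cf_poly q n 1).[u] = 0.
Proof.
have [eps eps0 eps2] : exists2 eps, 0 < eps & 2 * eps < d ^+ 2 - 50 * e.
  have third (x : R) : 0 < x -> 0 < x / 3 /\ 2 * (x / 3) < x by split; lra.
  have [] := third (d ^+ 2 - 50 * e); first by rewrite subr_gt0.
  by exists ((d ^+ 2 - 50 * e) / 3).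
have [N hN] := cf_poly1_approx eps0; exists N => n Nn.
have w1 := cabs_q_pow hq n.
have far (x y : C) : 6 / 100 <= cabs y - cabs x -> 6 / 100 <= cabs (conjc (q ^+ n * x) - y).
  move=> h; have := lerB_cabs y (conjc (q ^+ n * x)).
  by rewrite cabsB cabs_conj cabsM w1 mul1r; lra.
have far' (x y : C) : 6 / 100 <= cabs x - cabs y -> 6 / 100 <= cabs (conjc (q ^+ n * x) - y).
  move=> h; have := lerB_cabs (conjc (q ^+ n * x)) y.
  by rewrite cabs_conj cabsM w1 mul1r; lra.
case: (twisted_far w1) => h.
  have [u [h1 h2 h3 h4]] := zero_in_disc w1 ha Ga hab G_ge h (far _ _ hba) eps2 (fun u => hN n u Nn).
  by exists u.
have G_ge' w : cabs w <= 11 / 25 -> 3 / 100 <= cabs (w - b) -> 3 / 100 <= cabs (w - a) -> d <= cabs (G w).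
  by move=> k1 k2 k3; apply: G_ge.
have hab' : 16 / 100 <= cabs (b - a) by rewrite cabsB.
have [u [h1 h2 h3 h4]] := zero_in_disc w1 hb Gb hab' G_ge' h (far' _ _ hba) eps2 (fun u => hN n u Nn).
by exists u.
Qed.

Let q0 : q != 0. Proof. exact: q_neq0 hq. Qed.

Lemma compact_outside : compact [set z : C | outside (q * z)].
Proof.
have cl (x : C) (s : R) : closed [set z : C | s <= cabs (q * z - x)].
  rewrite -[X in closed X]setCK; apply: open_closedC; rewrite openE => z /= /negP hz.
  rewrite -ltNge in hz; apply/(near_cabs z (~` _)).
  exists (s - cabs (q * z - x)) => [|v hv]; first by rewrite subr_gt0.
  apply/negP; rewrite -ltNge; have := cabsD (q * (v - z)) (q * z - x).
  by rewrite cabsM hq mul1r mulrBr subrKA; lra.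
have cl' (s : R) : closed [set z : C | cabs z <= s].
  rewrite -[X in closed X]setCK; apply: open_closedC; rewrite openE => z /= /negP hz.
  rewrite -ltNge in hz; apply/(near_cabs z (~` _)).
  exists (cabs z - s) => [|v hv]; first by rewrite subr_gt0.
  apply/negP; rewrite -ltNge; have := lerB_cabs z v; rewrite cabsB; lra.
apply: (@compact_closed_disc _ (11 / 25)); last by move=> z []; rewrite cabsM hq mul1r.
have -> : [set z : C | outside (q * z)] = [set z | cabs z <= 11 / 25] `&`
   ([set z | 3 / 100 <= cabs (q * z - a)] `&` [set z | 3 / 100 <= cabs (q * z - b)]).
  by apply/seteqP; split => z; rewrite /outside /= cabsM hq mul1r => -[] // ? [].
by apply: closedI => //; apply: closedI.
Qed.

(** The compact set avoids the poles of H and contains a pole of each convergent of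
    large index, while uniform convergence in the sense considered requires that
    the convergents have no pole there eventually. *)
Lemma no_unif_cvg_subseq (H : C -> C) (psi : nat -> nat) :
  is_RR_H q [set z : C | `|z| < 1] H -> (forall n, (n <= psi n)%N) ->
  ~ has_unif_cvg_subseq [set z : C | `|z| < 46%:R / 100%:R] H (fun n => RR_convergent q (psi n)).
Proof.
move=> hH hpsi [phi [g [phi_inc _ hcv]]].
have phi_ge n : (n <= phi n)%N.
  by elim: n => // n IH; apply: leq_ltn_trans IH _; exact: phi_inc.
have e46 : (46%:R / 100%:R : C) = (46 / 100 : R)%:C by rewrite rmorphM /= fmorphV /= !rmorph_nat.
have SA : [set z : C | outside (q * z)] `<=` [set z : C | `|z| < 46%:R / 100%:R].
  by move=> z [h _ _]; rewrite /= e46 lt_cabs; move: h; rewrite cabsM hq mul1r; lra.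
have Snp z : outside (q * z) -> ~ is_pole H z.
  move=> [h1 h2 h3]; apply: (RR_H_not_pole hq hA hH).
    by move: h1; rewrite cabsM hq mul1r; lra.
  by rewrite -cabs_gt0; apply: lt_le_trans d0 _; exact: G_ge.
have [N hN] := hcv _ compact_outside SA Snp 1 ltr01.
have [N0 hN0] := spurious_zeros.
pose n := maxn N N0.
have big : (N0 <= psi (phi n))%N.
  by apply: leq_trans (leq_maxr N N0) _; exact: leq_trans (phi_ge n) (hpsi _).
have [u hu u0] := hN0 _ big.
have qz : q * (u / q) = u by rewrite mulrCA divff ?mulr1.
have Su : outside (q * (u / q)) by rewrite qz.
have [w hw _] := hN n (leq_maxl _ _) _ Su.
have P0 : (cf_poly q (psi (phi n)) 2).[u / q] = 0 by rewrite cf_poly2_horner qz.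
move: hw; rewrite /= RR_convergent_cf_poly; exact: (ratfun_value_pole (cf_poly_neq0 _ _ _) P0 (cf_poly_coprime q0 P0)).
Qed.

End SpuriousZeros.
End Denominators.

End SpuriousPoles.

Theorem theorem1p1 (R : realType) :
  let tau : R := 2 / (99 + Num.sqrt 5) in
  let q : R[i] := expi (2 * pi * tau) in
  let B : set R[i] := [set z : R[i] | `|z| < 1] in
  let A : set R[i] := [set z : R[i] | `|z| < 46%:R / 100%:R] in
  (exists H : R[i] -> R[i], is_RR_H q B H) /\
  (forall H : R[i] -> R[i], is_RR_H q B H ->
    [/\ analytic_at H 0,
        ~ has_unif_cvg_subseq A H (RR_convergent q) &
        forall c : nat -> R[i], taylor_at H 0 c ->
          ~ has_unif_cvg_subseq A H (fun n => pade c n n) /\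
          ~ has_unif_cvg_subseq A H (fun n => pade c n.+1 n)]).
Proof.
move=> tau q B A.
have hq : cabs q = 1 by exact: cabs_expi.
have hA : dioph q (18 : R) by exact: dioph_tau.
have [a [b [d [e [d0 ed [ha hb hba hab tw] [Ga Gb G_le] G_ge]]]]] := RR_G_two_zeros R.
split; first by exists (fun z => RR_G q z / RR_G q (q * z)); exact: (H0_is_RR_H hq hA).
move=> H hH.
have no psi := no_unif_cvg_subseq hq hA d0 ed ha hb hba hab tw Ga Gb G_le G_ge (psi := psi) hH.
split; [exact: (RR_H_analytic hq hA hH) | exact: (no id) |].
move=> c /(taylor_RR_H hq hA hH) hc.
have -> : (fun n => pade c n n) = (fun n => RR_convergent q n.*2).
  by apply/funext => n; exact: (pade_diag hq hA).
have -> : (fun n => pade c n.+1 n) = (fun n => RR_convergent q n.*2.+1).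
  by apply/funext => n; exact: (pade_superdiag hq hA).
split; apply: no => n; first by rewrite -addnn leq_addr.
by rewrite -addnn -addnS leq_addr.
Qed.
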